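(* Let $G$ be a $\mathbb{Z}$-periodic chain quantum graph with $m$ connecting edges, and let $\mathcal{H}$ be the corresponding Hamiltonian in $L^2(G)$ (minus the second derivative on each edge, with Kirchhoff vertex conditions). Let $\mathcal{H}(k)$, $k\in[-\pi,\pi]$, be its Floquet operators, $\lambda_j(k)$, $j=1,2,\dots$, its band functions, and $I_j=\lambda_j([-\pi,\pi])$ its bands. Then: (i) If $m=1$, the endpoints of the bands $I_j=\lambda_j([-\pi,\pi])$ (i.e., the extrema of the band functions) are attained at the points $k=0$, $k=\pm\pi$ (although they might be attained at some other points as well). In other words, the spectra of the periodic problem $\mathcal{H}(0)$ and the anti-periodic problem $\mathcal{H}(\pm\pi)$ provide the ends of the bands of the spectrum. (ii) If $m>1$, the conclusion of (i) is not always true.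
   Context: Chain graph: let $\Gamma$ be a finite graph and $m\ge1$ an integer. A $\mathbb{Z}$-periodic chain graph $G$ with $m$ connecting edges consists of identical copies $\Gamma_j$, $j\in\mathbb{Z}$, of $\Gamma$, together with exactly $m$ edges connecting $\Gamma_j$ to $\Gamma_{j+1}$ for each $j$, placed in the same way for all $j$; there are no other edges. The group $\mathbb{Z}$ acts on $G$ by shifts $(n,x)\mapsto\tau_n x$, with $\tau_n$ mapping $\Gamma_j$ to $\Gamma_{j+n}$. Quantum graph: each edge $e$ of $G$ has a finite length $0<l_e<\infty$, invariant under the $\mathbb{Z}$-action, and a ($\mathbb{Z}$-periodic) coordinate $x_e$ identifying $e$ with $[0,l_e]$. Hamiltonian: $\mathcal{H}$ acts as $-d^2/dx^2$ on each edge. Its domain consists of all functions $f$ on $G$ such that: (1) $f\in H^2(e)$ (Sobolev space of order 2) for each edge $e$; (2) $\sum_e\|f\|^2_{H^2(e)}<\infty$; (3) at each vertex $v$, $f$ is continuous and $\sum_e \frac{df}{dx_e}(v)=0$, where the sum is over edges adjacent to $v$ and derivatives are taken in the directions away from $v$ (Kirchhoff conditions). $\mathcal{H}$ is self-adjoint in $L^2(G)$. Floquet operators: for a quasi-momentum $k\in[-\pi,\pi]$, $\mathcal{H}(k)$ is defined in the same way as $\mathcal{H}$ except that condition (2) is replaced by $f(\tau_n x)=e^{ikn}f(x)$ for all $(n,x)\in\mathbb{Z}\times G$. The case $k=0$ is the periodic problem and $k=\pm\pi$ the anti-periodic problem. The spectrum of $\mathcal{H}(k)$ is discrete; its eigenvalues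 in non-decreasing order, counted with multiplicity, are denoted $\lambda_1(k)\le\lambda_2(k)\le\dots$. The functions $\lambda_j(k)$ are the band functions; they are continuous. The closed interval $I_j:=\lambda_j([-\pi,\pi])$ is the $j$-th band. The spectrum of $\mathcal{H}$ is the union of the bands. *)

(* Defs.v *)
From HB Require Import structures.
From mathcomp Require Import all_boot all_order all_algebra.
From mathcomp Require Import all_classical all_reals all_analysis.
From mathcomp Require Import complex.

Set Implicit Arguments.
Unset Strict Implicit.
Unset Printing Implicit Defensive.

Import Order.TTheory GRing.Theory Num.Theory.
Import numFieldNormedType.Exports.

Local Open Scope classical_set_scope.
Local Open Scope ring_scope.

(* A chain quantum graph is recorded by its fundamental cell.  The finite graph
   Gamma is a multigraph (loops and parallel edges allowed, connectedness not
   required) with edges [iedge].  Connecting edge [c] joins the vertex [csrc c]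
   of Gamma_j to the vertex [ctgt c] of Gamma_(j+1), for every j.
   The coordinate of an edge runs from its source (0) to its target (its
   length). *)
Record chain_graph (R : realType) (m : nat) := ChainGraph {
  vert : finType;
  iedge : finType;
  isrc : iedge -> vert;
  itgt : iedge -> vert;
  csrc : 'I_m -> vert;
  ctgt : 'I_m -> vert;
  len : (iedge + 'I_m)%type -> R;
  len_gt0 : forall d, 0 < len d }.

Section ChainGraph.
Variables (R : realType) (m : nat) (Q : chain_graph R m).

(* Vertices and edges of G: the integer is the index j of the copy; connecting
   edges from Gamma_j to Gamma_(j+1) carry the index j. *)
Definition gvert : Type := (vert Q * int)%type.
Definition gedge : Type := ((iedge Q + 'I_m) * int)%type.

Definition origin (e : gedge) : gvert :=
  match e.1 with
  | inl i => (isrc i, e.2)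
  | inr c => (csrc Q c, e.2)
  end.

Definition terminus (e : gedge) : gvert :=
  match e.1 with
  | inl i => (itgt i, e.2)
  | inr c => (ctgt Q c, e.2 + 1)
  end.

Definition elen (e : gedge) : R := len e.1.

Definition shift_edge (n : int) (e : gedge) : gedge := (e.1, e.2 + n).

(* Complex functions on G, in the coordinate of each edge; only the values
   [f e x] with 0 <= x <= elen e are meaningful. *)
Definition gfun : Type := gedge -> R -> R[i].

End ChainGraph.

Section Sobolev.
Variable R : realType.

(* [f'] is the derivative of [f] in the absolutely continuous sense on [0, l] *)
Definition ac_deriv (l : R) (f f' : R -> R) : Prop :=
  forall x, x \in `[0, l] ->
    f x = f 0 + \int[@lebesgue_measure R]_(t in `[0, x]) f' t.

Definition square_integrable (l : R) (g : R -> R) : Prop :=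
  measurable_fun `[0, l] g /\
  (@lebesgue_measure R).-integrable `[0, l] (fun x => (g x ^+ 2)%:E).

(* The Sobolev space H^2(0, l), described through the C^1 representatives of
   its elements, for which the values of f and f' at the ends of the edge make
   sense: f' is absolutely continuous with derivative f'' in L^2(0, l). *)
Definition H2_real (l : R) (f f' f'' : R -> R) : Prop :=
  [/\ ac_deriv l f f', ac_deriv l f' f'' & square_integrable l f''].

Definition H2 (l : R) (f f' f'' : R -> R[i]) : Prop :=
  H2_real l (fun x => complex.Re (f x)) (fun x => complex.Re (f' x))
    (fun x => complex.Re (f'' x)) /\
  H2_real l (fun x => complex.Im (f x)) (fun x => complex.Im (f' x))
    (fun x => complex.Im (f'' x)).

Definition expi (t : R) : R[i] := Complex (cos t) (sin t).

End Sobolev.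

Section Floquet.
Variables (R : realType) (m : nat) (Q : chain_graph R m).

Definition vertex_continuous (f : gfun Q) : Prop :=
  forall v : gvert Q, exists c : R[i],
    (forall e, origin e = v -> f e 0 = c) /\
    (forall e, terminus e = v -> f e (elen e) = c).

(* The derivative away from the vertex is f' at the origin of an edge and -f'
   at its terminus; a loop contributes through both of its ends.  Both sums
   are finite, G being locally finite. *)
Definition kirchhoff (f' : gfun Q) : Prop :=
  forall v : gvert Q,
    \sum_(e \in [set e : gedge Q | origin e = v]) f' e 0
    - \sum_(e \in [set e : gedge Q | terminus e = v]) f' e (elen e) = 0.

Definition floquet (k : R) (f : gfun Q) : Prop :=
  forall (n : int) (e : gedge Q) (x : R), x \in `[0, elen e] ->
    f (shift_edge n e) x = expi (k * n%:~R) * f e x.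

(* [f] is in the domain of H(k), with first and second derivatives [f'] and
   [f''] *)
Record floquet_domain (k : R) (f f' f'' : gfun Q) : Prop := FloquetDomain {
  floquet_H2 : forall e, H2 (elen e) (f e) (f' e) (f'' e);
  floquet_quasiperiodic : floquet k f;
  floquet_continuous : vertex_continuous f;
  floquet_kirchhoff : kirchhoff f' }.

(* the graph of the operator H(k): [f] is in its domain and H(k) f = g as
   elements of L^2 *)
Definition floquet_op (k : R) (f g : gfun Q) : Prop :=
  exists f' f'' : gfun Q, floquet_domain k f f' f'' /\
    forall e, g e = (fun x => - f'' e x)
                %[ae @lebesgue_measure R in `[0, elen e]%classic].

Definition floquet_eigenspace (k mu : R) : set (gfun Q) :=
  [set f | floquet_op k f (fun e x => Complex mu 0 * f e x)].

(* complex dimension of the kernel of H(k) - mu, functions being identified when they agree on G *)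
Definition eigenspace_dim (k mu : R) (n : nat) : Prop :=
  exists b : 'I_n -> gfun Q,
    [/\ forall i, floquet_eigenspace k mu (b i),
        forall c : 'I_n -> R[i],
          (forall e x, x \in `[0, elen e] -> \sum_(i < n) c i * b i e x = 0) ->
          forall i, c i = 0
      & forall f, floquet_eigenspace k mu f ->
          exists c : 'I_n -> R[i], forall e x, x \in `[0, elen e] ->
            f e x = \sum_(i < n) c i * b i e x].

(* [s 0 <= s 1 <= ...] are the eigenvalues of H(k), which are real, repeated
   according to their multiplicity *)
Definition eigenvalue_sequence (k : R) (s : nat -> R) : Prop :=
  (forall i j, (i <= j)%N -> s i <= s j) /\
  (forall mu, exists n, eigenspace_dim k mu n /\
                        ([set j | s j = mu] #= `I_n)%card).

(* [lam j k] is lambda_(j+1)(k) when eigenvalues are numbered from 1 *)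
Definition band_functions (lam : nat -> R -> R) : Prop :=
  forall k, k \in `[- pi, pi] -> eigenvalue_sequence k (fun j => lam j k).

End Floquet.

Definition band (R : realType) (lam : nat -> R -> R) (j : nat) : set R :=
  lam j @` `[- pi, pi].

Definition band_ends_attained (R : realType) (lam : nat -> R -> R) : Prop :=
  forall j,
    (exists2 k : R, [set 0; pi; - pi] k & lbound (band lam j) (lam j k)) /\
    (exists2 k : R, [set 0; pi; - pi] k & ubound (band lam j) (lam j k)).

(* Main.v *)
From HB Require Import structures.
Require Import Defs.
From mathcomp Require Import all_boot all_order perm all_algebra.
From mathcomp Require Import all_classical all_reals all_analysis.
From mathcomp Require Import measurable_realfun complex zify ring lra.


(* Fix M and cut every edge into pieces so short that no piece has a Dirichlet
   eigenvalue below M.  For mu < M an eigenfunction is determined by its values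
   y at the cut points and vertices, and the Kirchhoff conditions say that y is
   in the kernel of a Hermitian matrix H_k(mu), the matrix of
   int |f'|^2 - mu |f|^2 on solutions of - f'' = mu f.  On [0, M) this matrix is
   continuous and strictly decreasing in mu, so the number of eigenvalues of
   H(k) below mu is the negative index of H_k(mu).

   For m = 1, k enters through one twisted piece.  The forms H_k(mu) agree on a
   hyperplane, so their indices differ by at most one; and det H_k(mu) is affine
   in cos k, so it is a convex combination of its values at k = 0 and k = pi.
   The sign of the determinant being the parity of the index, the index at k
   lies between those at 0 and pi, hence so does each eigenvalue.

   For m > 1, let the shift exchange two disjoint lines.  Their frequencies are
   the numbers |k + pi n|, and a band function is the squared distance from k to
   pi Z, maximal only at k = - pi / 2 and k = pi / 2. *)

Set Implicit Arguments.
Unset Strict Implicit.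
Unset Printing Implicit Defensive.

Import Order.TTheory GRing.Theory Num.Theory.
Import numFieldNormedType.Exports.
Local Open Scope ring_scope.
Local Open Scope sesquilinear_scope.

(** * Hermitian matrices: index, nullity, determinant *)

Section HermitianIndex.
Variable C : numClosedFieldType.
Local Open Scope sesquilinear_scope.

(** Each [k] is treated by itself: the eigenvalues at [k], [0] and [pi] are compared through their
    counting functions at a common energy, and the cutoff [M] is chosen afterwards, above the three
    eigenvalues in question. The obstacle that forces the cutting is an energy at which sin (sqrt mu
    * l) vanishes on an edge of length l: the end values then no longer determine the solution, and
    the coefficients of the form blow up. Pieces of length h with sqrt M * h < pi avoid this. A rank
    bound alone does not suffice for one connecting edge. If the indices at 0 and pi agree, the
    index at [k] could still differ from them by one, and only the parity read off the determinant
    excludes it. This needs nonzero determinants at 0 and pi, so energies are picked where both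
    kernels vanish; such energies exist just to the right of any given one. The example must exist
    for every [m > 1]. The further connecting edges become intervals with Neumann ends, whose
    eigenvalues do not move with [k]; they only shift the number of the band that fails. *)

Definition hform n (H : 'M[C]_n) (x : 'rV[C]_n) : C := (x *m H *m x ^t*) 0 0.

Definition neg_index n (H : 'M[C]_n) : nat :=
  #|[set i | spectral_diag H 0 i < 0]|.

Definition nullity n (H : 'M[C]_n) : nat := (n - \rank H)%N.

Definition spectral_coord n (H : 'M[C]_n) (x : 'rV[C]_n) : 'rV[C]_n :=
  x *m (spectralmx H) ^t*.

Lemma spectral_decomp n (H : 'M[C]_n) : H \is hermsymmx ->
  H = (spectralmx H) ^t* *m diag_mx (spectral_diag H) *m spectralmx H.
Proof.
move=> hH; have /orthomx_spectralP {1}-> := hermitian_normalmx hH.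
by rewrite invmx_unitary // spectral_unitarymx.
Qed.

Lemma spectral_diag_real n (H : 'M[C]_n) i : H \is hermsymmx ->
  spectral_diag H 0 i \is Num.real.
Proof. by move=> hH; have /mxOverP := hermitian_spectral_diag_real hH; apply. Qed.

Lemma hform_spectral n (H : 'M[C]_n) x : H \is hermsymmx ->
  hform H x = \sum_i spectral_diag H 0 i * `|spectral_coord H x 0 i| ^+ 2.
Proof.
move=> hH; rewrite /hform {1}(spectral_decomp hH).
have -> : x *m (spectralmx H ^t* *m diag_mx (spectral_diag H) *m spectralmx H) *m x ^t*
  = spectral_coord H x *m diag_mx (spectral_diag H) *m (spectral_coord H x) ^t*.
  by rewrite /spectral_coord trmx_mul map_mxM trmxCK !mulmxA.
rewrite mul_mx_diag mxE; apply: eq_bigr => i _; rewrite !mxE.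
by rewrite normCK mulrAC mulrA mulrC mulrA [X in X * _]mulrC -mulrA mulrC.
Qed.

Lemma norm_spectral n (H : 'M[C]_n) x :
  \sum_i `|spectral_coord H x 0 i| ^+ 2 = \sum_i `|x 0 i| ^+ 2.
Proof.
have E (y : 'rV[C]_n) : \sum_i `|y 0 i| ^+ 2 = (y *m y ^t*) 0 0 :> C.
  by rewrite mxE; apply: eq_bigr => i _; rewrite !mxE normCK.
rewrite !E /spectral_coord trmx_mul map_mxM trmxCK mulmxA.
by rewrite mulmxKtV ?spectral_unitarymx.
Qed.


(** The rows of the unitary eigenbasis with index in [S] span a space of dimension [#|S|] on which
    the form involves only the chosen eigenvalues. *)
Lemma coord_subspace n (H : 'M[C]_n) (S : {set 'I_n}) :
  exists V : 'M[C]_(#|S|, n), row_free V /\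
    forall x : 'rV[C]_n, (x <= V)%MS -> forall i, i \notin S -> spectral_coord H x 0 i = 0.
Proof.
pose P := spectralmx H; pose f (i : 'I_#|S|) : 'I_n := enum_val i.
have PP : P *m P ^t* = 1%:M by apply/unitarymxP/spectral_unitarymx.
have VP : rowsub f P *m P ^t* = rowsub f 1%:M by rewrite mul_rowsub_mx PP.
exists (rowsub f P); split.
  apply/eqP/mxrank_unitary/unitarymxP.
  apply/matrixP => i j; have /matrixP/(_ (f i) (f j)) := PP.
  rewrite !mxE (inj_eq enum_val_inj) => <-.
  by apply: eq_bigr => k _; rewrite !mxE.
move=> x /submxP [y ->] i iS; rewrite /spectral_coord -mulmxA VP mxE.
apply: big1 => j _; rewrite !mxE; case: eqP => [fji|]; last by rewrite mulr0.
by rewrite -fji enum_valP in iS.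
Qed.

(** A system of [#|S|] linear equations in [r > #|S|] unknowns has a nonzero solution. *)
Lemma vanishing_coord n r (H : 'M[C]_n) (V : 'M[C]_(r, n)) (S : {set 'I_n}) :
  (#|S| < r)%N ->
  exists2 y : 'rV[C]_r, y != 0 &
    forall i, i \in S -> spectral_coord H (y *m V) 0 i = 0.
Proof.
move=> Sr; pose f (i : 'I_#|S|) : 'I_n := enum_val i.
pose M := colsub f (V *m (spectralmx H) ^t*).
have kM : kermx M != 0.
  rewrite kermx_eq0 /row_free; apply: contraTneq Sr => rM.
  by rewrite -leqNgt -rM rank_leq_col.
exists (nz_row (kermx M)); first by rewrite nz_row_eq0.
move=> i iS; have /sub_kermxP/matrixP/(_ 0 (enum_rank_in iS i)) := nz_row_sub (kermx M).
rewrite mxE [RHS]mxE => E; rewrite /spectral_coord -mulmxA mxE -[RHS]E.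
apply: eq_bigr => k _; congr (_ * _).
by rewrite [M _ _]mxE /f enum_rankK_in.
Qed.

(** A subspace of dimension above the index meets the span of the eigenvectors with nonnegative
    eigenvalue, where the form is nonnegative. *)
Lemma negative_subspace n r (H : 'M[C]_n) (V : 'M[C]_(r, n)) : H \is hermsymmx ->
  row_free V -> (forall x, (x <= V)%MS -> x != 0 -> hform H x < 0) ->
  (r <= neg_index H)%N.
Proof.
move=> hH Vfree negV; rewrite leqNgt; apply/negP => /(@vanishing_coord _ _ H V _)[y y0 Hy].
have yV0 : y *m V != 0 by rewrite mulmx_free_eq0.
suff /le_lt_trans /(_ (negV _ (submxMl y V) yV0)) : 0 <= hform H (y *m V).
  by rewrite ltxx.
rewrite hform_spectral //; apply: sumr_ge0 => i _.
have [di|di] := boolP (spectral_diag H 0 i < 0).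
  by rewrite Hy ?inE // normr0 expr0n mulr0.
by rewrite mulr_ge0 ?exprn_ge0 // real_leNgt ?real0 ?spectral_diag_real.
Qed.

Lemma sum_norm_sqr_eq0 n (x : 'rV[C]_n) : (\sum_i `|x 0 i| ^+ 2 == 0) = (x == 0).
Proof.
rewrite psumr_eq0 => [|i _]; last by rewrite exprn_ge0.
apply/allP/eqP => [x0|-> i _]; last by rewrite mxE normr0 expr0n eqxx.
apply/rowP => i; rewrite mxE; apply/eqP.
by have := x0 i (mem_index_enum i); rewrite expf_eq0 /= normr_eq0.
Qed.

Lemma sum_norm_sqr_gt0 n (x : 'rV[C]_n) : x != 0 -> 0 < \sum_i `|x 0 i| ^+ 2.
Proof.
move=> x0; rewrite lt_def sum_norm_sqr_eq0 x0 /=.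
by apply: sumr_ge0 => i _; apply: exprn_ge0.
Qed.

Lemma spectral_coord_eq0 n (H : 'M[C]_n) x : (spectral_coord H x == 0) = (x == 0).
Proof. by rewrite -sum_norm_sqr_eq0 norm_spectral sum_norm_sqr_eq0. Qed.

(** The dual count: a larger [r] would put a nonzero combination of negative eigenvectors into the
    subspace. *)
Lemma nonneg_subspace n r (H : 'M[C]_n) (V : 'M[C]_(r, n)) : H \is hermsymmx ->
  row_free V -> (forall x, (x <= V)%MS -> 0 <= hform H x) ->
  (r + neg_index H <= n)%N.
Proof.
move=> hH Vfree posV; pose S := [set i | spectral_diag H 0 i < 0].
have -> : neg_index H = #|S| by [].
rewrite -[X in (_ <= X)%N](card_ord n) -(cardsC S) addnC leq_add2l leqNgt.
apply/negP => /(@vanishing_coord _ _ H V _)[y y0 Hy].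
have yV0 : y *m V != 0 by rewrite mulmx_free_eq0.
suff /(le_lt_trans (posV _ (submxMl y V))) : hform H (y *m V) < 0.
  by rewrite ltxx.
rewrite hform_spectral //.
pose xi := spectral_coord H (y *m V).
have [i xi0] : exists i, xi 0 i != 0.
  apply/existsP; apply: contraNT yV0; rewrite negb_exists => /forallP xi0.
  rewrite -(spectral_coord_eq0 H); apply/eqP/rowP => i; rewrite [RHS]mxE.
  by apply/eqP; rewrite -[_ == _]negbK.
have le0 j : spectral_diag H 0 j * `|xi 0 j| ^+ 2 <= 0.
  have [jS|jS] := boolP (j \in S); last first.
    by rewrite /xi Hy ?finset.in_setC // normr0 expr0n mulr0.
  by rewrite nmulr_rle0 ?exprn_ge0 //; rewrite inE in jS.
rewrite (bigD1 i) //= -[X in _ < X]addr0; apply: ltr_leD; last first.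
  by apply: sumr_le0 => j _; apply: le0.
have iS : i \in S by apply: contraR xi0 => iS; rewrite /xi Hy // finset.in_setC.
by rewrite nmulr_rlt0 ?exprn_gt0 ?normr_gt0 //; rewrite inE in iS.
Qed.

Lemma spectral_kernel n (H : 'M[C]_n) (x : 'rV[C]_n) : H \is hermsymmx ->
  (x <= kermx H)%MS =
  [forall i, spectral_coord H x 0 i * spectral_diag H 0 i == 0].
Proof.
move=> hH; rewrite sub_kermx [in x *m H](spectral_decomp hH) !mulmxA.
rewrite mulmx_free_eq0 ?row_free_unit ?spectral_unit// mul_mx_diag.
apply/eqP/forallP => [/rowP E i|E]; first by have := E i; rewrite !mxE => ->.
by apply/rowP => i; rewrite !mxE; apply/eqP; have := E i; rewrite !mxE.
Qed.

Lemma nullity_spectral n (H : 'M[C]_n) : H \is hermsymmx ->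
  nullity H = #|[set i | spectral_diag H 0 i == 0]|.
Proof.
move=> hH; rewrite /nullity -mxrank_ker; set S := [set i | _].
apply/eqP; rewrite eqn_leq; apply/andP; split.
  rewrite leqNgt; apply/negP => /(@vanishing_coord _ _ H (row_base (kermx H)) _).
  move=> [y y0 Hy]; have : y *m row_base (kermx H) != 0.
    by rewrite mulmx_free_eq0 ?row_base_free.
  rewrite -(spectral_coord_eq0 H) => /negP; apply; apply/eqP/rowP => i.
  rewrite [RHS]mxE; have [iS|] := boolP (i \in S); first exact: Hy.
  rewrite inE => di.
  have : (y *m row_base (kermx H) <= kermx H)%MS.
    by rewrite (submx_trans (submxMl _ _)) // eq_row_base.
  by rewrite spectral_kernel // => /forallP/(_ i); rewrite mulf_eq0 (negPf di) orbF => /eqP.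
have [V [Vfree HV]] := coord_subspace H S.
rewrite -(eqP Vfree); apply: mxrankS; apply/row_subP => k.
rewrite spectral_kernel //; apply/forallP => i.
have [|iS] := boolP (i \in S); first by rewrite inE => /eqP->; rewrite mulr0.
by rewrite (HV _ (row_sub k V)) ?mul0r.
Qed.

Lemma det_spectral n (H : 'M[C]_n) : H \is hermsymmx ->
  \det H = \prod_i spectral_diag H 0 i.
Proof.
move=> hH; rewrite {1}(spectral_decomp hH) !det_mulmx det_diag mulrAC -det_mulmx.
have /unitarymxP /(congr1 determinant) := spectral_unitarymx H.
by rewrite !det_mulmx det1 [X in X = _]mulrC => ->; rewrite mul1r.
Qed.


Lemma sub_coord_sum n (x : 'rV[C]_n) (d : 'I_n -> C) (c : C) :
  (forall i, x 0 i != 0 -> d i <= c) ->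
  \sum_i d i * `|x 0 i| ^+ 2 <= c * \sum_i `|x 0 i| ^+ 2.
Proof.
move=> dc; rewrite mulr_sumr; apply: ler_sum => i _.
have [->|xi] := eqVneq (x 0 i) 0; first by rewrite normr0 expr0n !mulr0.
by rewrite ler_wpM2r ?exprn_ge0 // dc.
Qed.

(** On the span of the eigenvectors of [H] with eigenvalue at most 0 the form of [H] is nonpositive,
    so that of [H'] is negative. Including the kernel yields the jump of the index across an
    eigenvalue. *)
Lemma neg_index_decr n (H H' : 'M[C]_n) : H \is hermsymmx -> H' \is hermsymmx ->
  (forall x, x != 0 -> hform H' x < hform H x) ->
  (neg_index H + nullity H <= neg_index H')%N.
Proof.
move=> hH hH' ltH; rewrite nullity_spectral //.
set Z := [set i | _ == 0]; pose S := [set i | spectral_diag H 0 i < 0] :|: Z.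
have -> : (neg_index H + #|Z| = #|S|)%N.
  rewrite /S cardsU (_ : _ :&: _ = finset.set0) ?cards0 ?subn0 //.
  by apply/finset.setP => i; rewrite !inE; case: eqP => [->|_]; rewrite ?ltxx ?andbF.
have [V [Vfree HV]] := coord_subspace H S.
apply: (negative_subspace hH' Vfree) => x xV x0.
apply: (lt_le_trans (ltH x x0)); rewrite hform_spectral //.
apply: sumr_le0 => i _; have [|iS] := boolP (i \in S); last first.
  by rewrite HV // normr0 expr0n mulr0.
rewrite !inE => /orP[di|/eqP->]; last by rewrite mul0r.
by rewrite mulr_le0_ge0 ?exprn_ge0 // ltW.
Qed.

Lemma spectral_gap n (H : 'M[C]_n) : H \is hermsymmx -> exists2 c : C, 0 < c &
  forall i, spectral_diag H 0 i != 0 -> c <= `|spectral_diag H 0 i|.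
Proof.
(* A zero eigenvalue has inverse 0 and drops out of the sum; the 1 keeps [T] positive if all of them
   vanish. *)
move=> hH; pose T := 1 + \sum_i `|spectral_diag H 0 i|^-1.
have T0 : 0 < T by rewrite ltr_pwDl // sumr_ge0 // => i _; rewrite invr_ge0.
exists T^-1 => [|i di]; first by rewrite invr_gt0.
rewrite -[X in _ <= X]invrK lef_pV2 ?posrE ?invr_gt0 ?normr_gt0 //.
rewrite /T (bigD1 i) //= addrCA lerDl; apply: addr_ge0; first exact: ler01.
by apply: sumr_ge0 => j _; rewrite invr_ge0.
Qed.

(** A perturbation below the spectral gap preserves the sign on the span of the negative and on the
    span of the positive eigenvectors; only the kernel can add to the index. *)
Lemma neg_index_perturb n (H : 'M[C]_n) : H \is hermsymmx -> exists2 c : C, 0 < c &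
  forall H' : 'M[C]_n, H' \is hermsymmx ->
    (forall x, x != 0 -> `|hform H' x - hform H x| < c * \sum_i `|x 0 i| ^+ 2) ->
    (neg_index H <= neg_index H' <= neg_index H + nullity H)%N.
Proof.
move=> hH; have [c c0 gap] := spectral_gap hH; exists c => // H' hH' close.
have realH x : hform H x \is Num.real.
  rewrite hform_spectral //; apply: rpred_sum => i _.
  by rewrite rpredM ?spectral_diag_real // ger0_real ?exprn_ge0.
have realH' x : hform H' x \is Num.real.
  rewrite hform_spectral //; apply: rpred_sum => i _.
  by rewrite rpredM ?spectral_diag_real // ger0_real ?exprn_ge0.
apply/andP; split.
  pose S := [set i | spectral_diag H 0 i < 0].
  have [V [Vfree HV]] := coord_subspace H S.
  apply: (negative_subspace hH' Vfree) => x xV x0.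
  have := close x x0; rewrite real_ltr_norml ?rpredB //.
  move=> /andP[_]; rewrite ltrBlDr => /lt_le_trans; apply.
  rewrite -(norm_spectral H) (hform_spectral _ hH) -[X in X + _]opprK -mulNr.
  rewrite addrC subr_le0; apply: sub_coord_sum => i xi0.
  have : i \in S by apply: contraR xi0 => iS; rewrite HV.
  rewrite inE => di; rewrite lerNr -(ltr0_norm di) gap //.
  by rewrite lt_eqF.
pose S := [set i | spectral_diag H 0 i > 0].
have [V [Vfree HV]] := coord_subspace H S.
have : (#|S| + neg_index H' <= n)%N.
  apply: (nonneg_subspace hH' Vfree) => x xV.
  have [->|x0] := eqVneq x 0; first by rewrite /hform !mul0mx mxE.
  have := close x x0; rewrite real_ltr_norml ?rpredB //.
  move=> /andP[+ _]; rewrite ltrBrDr => /ltW/(le_trans _); apply.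
  rewrite -(norm_spectral H) (hform_spectral _ hH) addrC subr_ge0 -lerN2 -mulNr -sumrN.
  under eq_bigr do rewrite -mulNr.
  apply: sub_coord_sum => i xi0.
  have : i \in S by apply: contraR xi0 => iS; rewrite HV.
  rewrite inE => di; rewrite lerN2 -(gtr0_norm di) gap //.
  by rewrite gt_eqF.
rewrite nullity_spectral // /neg_index; set A := [set i | spectral_diag H 0 i < 0]; set Z := [set i | _ == 0].
have -> : S = ~: (A :|: Z).
  apply/finset.setP => i; rewrite !inE.
  by case: (real_ltgtP (real0 C) (spectral_diag_real i hH)).
have AZ : #|A :|: Z| = (#|A| + #|Z|)%N.
  rewrite cardsU (_ : _ :&: _ = finset.set0) ?cards0 ?subn0 //.
  by apply/finset.setP => i; rewrite !inE; case: eqP => [->|_]; rewrite ?ltxx ?andbF.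
by rewrite -[X in (_ <= X)%N](card_ord n) -(cardsC (A :|: Z)) AZ addnC leq_add2r.
Qed.

Lemma sign_det n (H : 'M[C]_n) : H \is hermsymmx -> \det H != 0 ->
  0 < (-1) ^+ neg_index H * \det H.
Proof.
move=> hH; rewrite det_spectral // => d0.
have -> : (-1) ^+ neg_index H = \prod_i (-1) ^+ (spectral_diag H 0 i < 0)%R :> C.
  by rewrite prodrXr /neg_index -sum1dep_card big_mkcond; congr (_ ^+ _); apply: eq_bigr => i _; case: ltP.
rewrite -big_split /=; apply: prodr_gt0 => i _.
have di : spectral_diag H 0 i != 0 by move/prodf_neq0: d0; apply.
case: (real_ltgtP (real0 C) (spectral_diag_real i hH)) di => //= di _.
  by rewrite mul1r.
by rewrite mulN1r oppr_gt0.
Qed.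

(** The hyperplane cuts the negative eigenspace of [H] in codimension at most one, and on this
    intersection [H'] is negative too. *)
Lemma neg_index_hyperplane n (H H' : 'M[C]_n) (i0 : 'I_n) :
  H \is hermsymmx -> H' \is hermsymmx ->
  (forall x : 'rV[C]_n, x 0 i0 = 0 -> hform H x = hform H' x) ->
  (neg_index H <= (neg_index H').+1)%N.
Proof.
move=> hH hH' eqH; pose S := [set i | spectral_diag H 0 i < 0].
have [V [Vfree HV]] := coord_subspace H S.
pose K := kermx (col i0 V).
have rK : (neg_index H <= (\rank K).+1)%N.
  rewrite mxrank_ker; have := rank_leq_col (col i0 V).
  by rewrite /neg_index -/S; case: (\rank _) => [|[|//]] _; rewrite ?subn0 // subn1 leqSpred.
apply: (leq_trans rK); rewrite ltnS.
apply: (@negative_subspace _ _ _ (row_base K *m V)) => //.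
  by rewrite /row_free mxrankMfree // (eqP (row_base_free K)).
move=> x /submxP [y ->]; rewrite mulmxA => x0.
set z := y *m row_base K *m V in x0 *.
have zi0 : z 0 i0 = 0.
  have : (y *m row_base K <= K)%MS by rewrite (submx_trans (submxMl _ _)) // eq_row_base.
  move=> /sub_kermxP/matrixP/(_ 0 0); rewrite !mxE => E; rewrite -[RHS]E.
  by apply: eq_bigr => k _; rewrite [col _ _ _ _]mxE.
rewrite -eqH // hform_spectral //.
have zV : (z <= V)%MS by apply: submxMl.
rewrite -(spectral_coord_eq0 H) in x0.
have [i xi0] : exists i, spectral_coord H z 0 i != 0.
  apply/existsP; apply: contraNT x0; rewrite negb_exists => /forallP xi0.
  apply/eqP/rowP => i; rewrite [RHS]mxE.
  by apply/eqP; rewrite -[_ == _]negbK.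
have neg j : spectral_coord H z 0 j != 0 -> spectral_diag H 0 j < 0.
  by apply: contraNT => jS; rewrite HV // inE.
rewrite (bigD1 i) //= -[X in _ < X]addr0; apply: ltr_leD.
  by rewrite nmulr_rlt0 ?neg // exprn_gt0 ?normr_gt0.
apply: sumr_le0 => j _; have [->|/neg dj] := eqVneq (spectral_coord H z 0 j) 0.
  by rewrite normr0 expr0n mulr0.
by rewrite nmulr_rle0 ?exprn_ge0.
Qed.

Lemma det_nullity0 n (H : 'M[C]_n) : nullity H = 0%N -> \det H != 0.
Proof.
move=> /eqP; rewrite subn_eq0 => rH; rewrite -unitfE -unitmxE -row_free_unit.
by rewrite /row_free eqn_leq rank_leq_row.
Qed.

(* If the indices of [H0] and [H1] agree, the determinants of [H0], [H1] and [H]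
   have the same sign, so the index of [H] has the same parity; being within 1
   of the other two, it equals them. *)
Lemma neg_index_between n (H0 H1 H : 'M[C]_n) (a b : C) (i0 : 'I_n) :
  H0 \is hermsymmx -> H1 \is hermsymmx -> H \is hermsymmx ->
  (forall x : 'rV[C]_n, x 0 i0 = 0 -> hform H0 x = hform H x) ->
  (forall x : 'rV[C]_n, x 0 i0 = 0 -> hform H1 x = hform H x) ->
  nullity H0 = 0%N -> nullity H1 = 0%N ->
  0 <= a -> 0 <= b -> a + b = 1 -> \det H = a * \det H0 + b * \det H1 ->
  (minn (neg_index H0) (neg_index H1) <= neg_index H
     <= maxn (neg_index H0) (neg_index H1))%N.
Proof.
move=> h0 h1 h E0 E1 n0 n1 a0 b0 ab detH.
have E01 (x : 'rV[C]_n) : x 0 i0 = 0 -> hform H0 x = hform H1 x by move=> x0; rewrite E0 // E1.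
have E10 (x : 'rV[C]_n) : x 0 i0 = 0 -> hform H1 x = hform H0 x by move=> x0; rewrite E0 // E1.
have E0' (x : 'rV[C]_n) : x 0 i0 = 0 -> hform H x = hform H0 x by move=> x0; rewrite E0.
have E1' (x : 'rV[C]_n) : x 0 i0 = 0 -> hform H x = hform H1 x by move=> x0; rewrite E1.
have := neg_index_hyperplane h0 h1 E01; have := neg_index_hyperplane h1 h0 E10.
have := neg_index_hyperplane h0 h E0; have := neg_index_hyperplane h h0 E0'.
have := neg_index_hyperplane h1 h E1; have := neg_index_hyperplane h h1 E1'.
have [eq01|] := eqVneq (neg_index H0) (neg_index H1); last by lia.
have pos : 0 < (-1) ^+ neg_index H0 * \det H.
  rewrite detH mulrDr !(mulrCA ((-1) ^+ _)).
  have d0 := sign_det h0 (det_nullity0 n0); have d1 := sign_det h1 (det_nullity0 n1).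
  rewrite -eq01 in d1; have [a_eq0|a_neq0] := eqVneq a 0.
    by move: ab; rewrite a_eq0 add0r => ->; rewrite mul0r mul1r add0r.
  by apply: ltr_pwDl; [rewrite mulr_gt0 // lt_def a_neq0 | rewrite mulr_ge0 // ltW].
have detH0 : \det H != 0.
  by apply: contraTneq pos => ->; rewrite mulr0 ltxx.
have : odd (neg_index H0) = odd (neg_index H).
  have := sign_det h detH0; have := pos.
  rewrite -[in X in X -> _]signr_odd -[in X in _ -> X -> _]signr_odd.
  case: (odd _); case: (odd _) => //=; rewrite ?mulN1r ?mul1r oppr_gt0 => p1 p2.
    by have := lt_trans p1 p2; rewrite ltxx.
  by have := lt_trans p1 p2; rewrite ltxx.
lia.
Qed.

Lemma gram_hermsym n p (W : 'M[C]_(n, p)) (d : 'rV[C]_p) : d \is a realmx ->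
  W *m diag_mx d *m W ^t* \is hermsymmx.
Proof.
move=> dR; apply/is_hermitianmxP; rewrite expr0 scale1r !trmx_mul !map_mxM trmxCK mulmxA.
rewrite tr_diag_mx map_diag_mx; congr (_ *m diag_mx _ *m _).
by apply/rowP => i; rewrite mxE; apply/esym/CrealP; move/mxOverP: dR; apply.
Qed.

Lemma hform_gram n p (W : 'M[C]_(n, p)) (d : 'rV[C]_p) x :
  hform (W *m diag_mx d *m W ^t*) x = \sum_j d 0 j * `|(x *m W) 0 j| ^+ 2.
Proof.
rewrite /hform (_ : x *m _ *m _ = x *m W *m diag_mx d *m (x *m W) ^t*); last first.
  by rewrite trmx_mul map_mxM !mulmxA.
rewrite mul_mx_diag mxE; apply: eq_bigr => i _; rewrite !mxE.
by rewrite normCK mulrAC mulrA mulrC mulrA [X in X * _]mulrC -mulrA mulrC.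
Qed.

Lemma hform_bounded n (H : 'M[C]_n) : H \is hermsymmx -> exists2 T : C, 0 <= T &
  forall x, hform H x <= T * \sum_i `|x 0 i| ^+ 2.
Proof.
move=> hH; exists (\sum_i `|spectral_diag H 0 i|); first by apply: sumr_ge0.
move=> x; rewrite -(norm_spectral H) hform_spectral //.
apply: sub_coord_sum => i _.
apply: (le_trans (real_ler_norm (spectral_diag_real i hH))).
by rewrite (bigD1 i) //= lerDl sumr_ge0.
Qed.

Lemma neg_index_eq0 n (H : 'M[C]_n) : H \is hermsymmx ->
  (forall x, 0 <= hform H x) -> neg_index H = 0%N.
Proof.
move=> hH H0; have /(_ n 1%:M) := @nonneg_subspace n _ H _ hH.
rewrite /row_free mxrank1 eqxx => /(_ isT (fun x _ => H0 x)).
by rewrite -[X in (_ <= X)%N]addn0 leq_add2l leqn0 => /eqP.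
Qed.

Lemma nullity_eq0 n (H : 'M[C]_n) :
  (forall x, x != 0 -> 0 < hform H x) -> nullity H = 0%N.
Proof.
move=> H0; rewrite /nullity -mxrank_ker; apply/eqP; rewrite mxrank_eq0.
rewrite -nz_row_eq0; apply: contraT => /H0.
have /sub_kermxP := nz_row_sub (kermx H).
by rewrite /hform => ->; rewrite mul0mx mxE ltxx.
Qed.

End HermitianIndex.

Local Open Scope classical_set_scope.
Local Open Scope ring_scope.

(** * Monotone pencils of Hermitian matrices *)

Section Counting.
Variables (R : realType) (n : nat) (M : R).

(** Continuity is asked of the forms, relative to the squared norm of [x]: this is what the
    perturbation bound for the index takes as input. *)
Definition decreasing_pencil (H : R -> 'M[R[i]]_n) :=
  [/\ forall t, H t \is hermsymmx,
      forall (s t : R) (x : 'rV[R[i]]_n), 0 <= s -> s < t -> t < M -> x != 0 ->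
        hform (H t) x < hform (H s) x
    & forall (t : R) (c : R[i]), 0 <= t -> t < M -> 0 < c ->
        exists2 d : R, 0 < d & forall s : R, 0 <= s -> s < M -> `|s - t| < d ->
          forall x : 'rV[R[i]]_n, x != 0 ->
            `|hform (H s) x - hform (H t) x| < c * \sum_i `|x 0 i| ^+ 2].

Definition pencil_spectrum (H : R -> 'M[R[i]]_n) (s : nat -> R) :=
  [/\ forall j, 0 <= s j, forall i j, (i <= j)%N -> s i <= s j
    & forall t : R, 0 <= t -> t < M ->
        ([set j | s j = t] #= `I_(nullity (H t)))%card].

Section Pencil.
Variable H : R -> 'M[R[i]]_n.
Hypothesis pencilH : decreasing_pencil H.

Lemma neg_index_near (t : R) : 0 <= t -> t < M -> exists2 d : R, 0 < d &
  forall s : R, 0 <= s -> s < M -> `|s - t| < d ->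
    (neg_index (H t) <= neg_index (H s) <= neg_index (H t) + nullity (H t))%N.
Proof.
move=> t0 tM; have [hermH _ contH] := pencilH.
have [c c0 Hc] := neg_index_perturb (hermH t).
have [d d0 Hd] := contH _ _ t0 tM c0; exists d => // s s0 sM sd.
by apply: Hc => //; apply: Hd.
Qed.

Lemma neg_index_jump (s t : R) : 0 <= s -> s < t -> t < M ->
  (neg_index (H s) + nullity (H s) <= neg_index (H t))%N.
Proof.
have [hermH decrH _] := pencilH => s0 st tM.
by apply: neg_index_decr => // x x0; exact: decrH.
Qed.

(** The perturbation bound gives one inequality and the jump the other. This matches a count of the
    eigenvalues strictly below [t], which is continuous from the left. *)
Lemma neg_index_left (t : R) : 0 < t -> t < M -> exists2 d : R, 0 < d &
  forall s : R, 0 <= s -> t - d < s -> s < t -> neg_index (H s) = neg_index (H t).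
Proof.
move=> t0 tM; have [d d0 Hd] := neg_index_near (ltW t0) tM; exists d => // s s0 ds st.
apply/eqP; rewrite eqn_leq (leq_trans (leq_addr _ _) (neg_index_jump s0 st tM)) /=.
by have /andP[] := Hd s s0 (lt_trans st tM) ltac:(rewrite ltr_distlC; lra).
Qed.

Lemma neg_index_right (t : R) : 0 <= t -> t < M -> exists2 d : R, 0 < d &
  forall s : R, t < s -> s < t + d -> s < M ->
    neg_index (H s) = (neg_index (H t) + nullity (H t))%N /\ nullity (H s) = 0%N.
Proof.
move=> t0 tM; have [d d0 Hd] := neg_index_near t0 tM; exists d => //.
have E (s : R) : t < s -> s < t + d -> s < M ->
    neg_index (H s) = (neg_index (H t) + nullity (H t))%N.
  move=> ts sd sM; apply/eqP; rewrite eqn_leq neg_index_jump // andbT.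
  by have /andP[] := Hd s ltac:(lra) sM ltac:(rewrite ltr_distlC; lra).
move=> s ts sd sM; split; first exact: E.
(* A second point beyond [s] with the same index: the jump from [s] to [u] then leaves no room for a
   kernel at [s]. *)
pose u := Num.min ((s + (t + d)) / 2) ((s + M) / 2).
have [u1 u2 u3] : [/\ s < u, u < t + d & u < M].
  by rewrite /u lt_min !gt_min; split; lra.
have := neg_index_jump (ltac:(lra) : 0 <= s) u1 u3.
by rewrite (E s) // (E u) ?(lt_trans ts) // -[X in (_ <= X)%N]addn0 leq_add2l leqn0 => /eqP.
Qed.

(** Monotonicity makes the level set of [t] a block of consecutive indices starting at [a];
    comparison with initial segments gives its length. *)
Lemma card_interval (s : nat -> R) (t : R) a m :
  (forall i j, (i <= j)%N -> s i <= s j) ->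
   ([set j | s j = t] #= `I_m)%card ->
  (forall j, (s j < t) = (j < a)%N) -> forall j, (s j <= t) = (j < a + m)%N.
Proof.
move=> s_incr cm lta.
have seg q : (addn a @` `I_q #= `I_q)%card by apply: inj_card_eq => x y _ _; apply: addnI.
have segS q : (addn a @` `I_q `<=` [set j | s j = t])%classic -> (q <= m)%N.
  by move=> /subset_card_le; rewrite (card_le_eql (seg q)) (card_le_eqr cm) card_le_II.
have Sseg q : ([set j | s j = t] `<=` addn a @` `I_q)%classic -> (m <= q)%N.
  by move=> /subset_card_le; rewrite (card_le_eqr (seg q)) (card_le_eql cm) card_le_II.
move=> j; apply/idP/idP => [sjt|].
  have [ja|aj] := ltnP j a; first exact: ltn_addr.
  rewrite -ltn_subLR //; apply: segS => _ [k /= kj <-].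
  apply/le_anti/andP; split.
    apply: le_trans sjt; apply: s_incr; lia.
  by rewrite leNgt lta -leqNgt leq_addr.
apply: contraLR; rewrite -ltNge -leqNgt => tsj.
have aj : (a <= j)%N by rewrite leqNgt -lta -leNgt ltW.
rewrite -(subnKC aj) leq_add2l; apply: Sseg => i /= sit.
have ai : (a <= i)%N by rewrite leqNgt -lta sit ltxx.
exists (i - a)%N; last by rewrite subnKC.
rewrite /= ltn_sub2rE // ltnNge; apply/negP => /s_incr; rewrite sit.
by rewrite leNgt tsj.
Qed.

(** Real induction, with [T] the supremum of the energies up to which the formula holds. It passes
    to [T] because both sides are continuous from the left, and beyond [T] because both jump there
    by the nullity and then stay constant for a while. *)
Lemma count_eigenvalues (s : nat -> R) (t : R) :
  pencil_spectrum H s -> neg_index (H 0) = 0%N -> 0 <= t -> t < M ->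
  forall j, (s j < t) = (j < neg_index (H t))%N.
Proof.
move=> [s_ge0 s_incr s_mult] H0_nonneg.
move=> t0 tM; pose P u := forall j, (s j < u) = (j < neg_index (H u))%N.
have P0 : P 0 by move=> j; rewrite H0_nonneg ltn0 ltNge s_ge0.
pose E := [set u | 0 <= u <= t /\ forall v : R, 0 <= v <= u -> P v].
have E0 : E 0.
  by split=> [|v v0]; rewrite ?lexx //; have -> : v = 0 by lra.
have supE : has_sup E by split; [exists 0 | exists t => u [/andP[]]].
pose T := sup E.
have T0 : 0 <= T by apply: ub_le_sup => //; case: supE.
have Tt : T <= t by apply: ge_sup; [exists 0 | move=> u [/andP[]]].
have PltT (v : R) : 0 <= v -> v < T -> P v.
  move=> v0 vT; have Tv : 0 < T - v by lra.
  have [u Eu vu] := sup_adherent Tv supE.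
  by apply: Eu.2; rewrite -/T in vu; lra.
have PT : P T.
  have [T_eq0|T_gt0] := eqVneq T 0; first by rewrite T_eq0.
  have {}T_gt0 : 0 < T by rewrite lt_def T_gt0.
  have [d d0 Hd] := neg_index_left T_gt0 (le_lt_trans Tt tM).
  (* Energies just below [T] that have the index of [T], taken beyond a given [u] so as to separate
     [s j] from [T]. *)
  have near (u : R) : u < T -> exists v : R, [/\ 0 <= v, u < v, v < T & neg_index (H v) = neg_index (H T)].
    move=> uT; pose m := Num.max u (Num.max 0 (T - d)).
    have [m1 m2 m3 m4] : [/\ u <= m, 0 <= m, T - d <= m & m < T].
      by rewrite /m !le_max !gt_max !lexx ?orbT; split=> //; rewrite uT T_gt0; lra.
    exists ((m + T) / 2); split; [lra|lra|lra|apply: Hd; lra].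
  move=> j; apply/idP/idP => [sj|jT].
    by have [v [v0 sv vT <-]] := near _ sj; rewrite -PltT.
  have [v [v0 _ vT vE]] := near _ T_gt0.
  by apply: (lt_trans _ vT); rewrite PltT // vE.
have [//|tT] := eqVneq T t; first by move=> <-.
have {}tT : T < t by rewrite lt_neqAle tT.
have TM := lt_trans tT tM.
have [d d0 Hd] := neg_index_right T0 TM.
have leT := card_interval s_incr (s_mult _ T0 TM) PT.
have Pright (u : R) : T < u -> u < T + d -> u < M -> P u.
  move=> Tu ud uM j; have [-> _] := Hd u Tu ud uM; rewrite -leT.
  apply/idP/idP => [sju|sjT]; last exact: le_lt_trans sjT Tu.
  rewrite leNgt; apply/negP => Tsj.
  have := s_mult _ (s_ge0 j) (lt_trans sju uM).
  rewrite (Hd _ Tsj (lt_trans sju ud) (lt_trans sju uM)).2.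
  by rewrite II0 card_eq0 => /eqP sj0; suff : set0 j by []; rewrite -sj0.
pose u := Num.min (T + d / 2) t.
have [u1 u2 u3] : [/\ T < u, u < T + d & u <= t].
  by rewrite /u lt_min gt_min ge_min lexx orbT tT; split=> //; lra.
have Eu : E u.
  split=> [|v /andP[v0 vu]]; first by lra.
  have [vT|Tv] := ltP v T; first exact: PltT.
  have [->//|vT] := eqVneq v T.
  by apply: Pright; [rewrite lt_def vT | lra | lra].
have : u <= T by apply: ub_le_sup => //; case: supE.
lra.
Qed.

End Pencil.

(** If [s j] lay outside the interval, then at an energy [v] between it and both [s0 j] and [s1 j]
    the index [j] would be counted by [H] alone, or by [H0] and [H1] but not by [H]. Taking [v] off
    the spectra of [H0] and [H1] makes the comparison of indices available. *)
Lemma spectrum_between (H0 H1 H : R -> 'M[R[i]]_n) (s0 s1 s : nat -> R) :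
  decreasing_pencil H0 -> decreasing_pencil H1 -> decreasing_pencil H ->
  pencil_spectrum H0 s0 -> pencil_spectrum H1 s1 -> pencil_spectrum H s ->
  neg_index (H0 0) = 0%N -> neg_index (H1 0) = 0%N -> neg_index (H 0) = 0%N ->
  (forall t, nullity (H0 t) = 0%N -> nullity (H1 t) = 0%N ->
    (minn (neg_index (H0 t)) (neg_index (H1 t)) <= neg_index (H t)
       <= maxn (neg_index (H0 t)) (neg_index (H1 t)))%N) ->
  forall j, s0 j < M -> s1 j < M -> s j < M ->
  Num.min (s0 j) (s1 j) <= s j <= Num.max (s0 j) (s1 j).
Proof.
move=> p0 p1 p S0 S1 S i0 i1 iS between j s0M s1M sM.
have generic t u : 0 <= t -> t < u -> u < M -> exists v : R,
    [/\ t < v, v < u, nullity (H0 v) = 0%N & nullity (H1 v) = 0%N].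
  move=> t0 tu uM; have tM := lt_trans tu uM.
  have [d0 d0_gt0 Hd0] := neg_index_right p0 t0 tM.
  have [d1 d1_gt0 Hd1] := neg_index_right p1 t0 tM.
  pose m := Num.min u (Num.min (t + d0) (t + d1)).
  have [m0 m1 m2 m3] : [/\ t < m, m <= u, m <= t + d0 & m <= t + d1].
    by rewrite /m !lt_min !ge_min !lexx ?orbT tu; split=> //; lra.
  exists ((t + m) / 2); split; [lra|lra|apply: (Hd0 _ _ _ _).2; lra|apply: (Hd1 _ _ _ _).2; lra].
have [s0_ge0 _ _] := S0; have [s1_ge0 _ _] := S1; have [s_ge0 _ _] := S.
apply/andP; split; rewrite leNgt; apply/negP; rewrite ?lt_min ?gt_max.
  move=> /andP[ss0 ss1].
  have [|||v [sv]] := generic (s j) (Num.min (s0 j) (s1 j)); rewrite ?lt_min ?gt_min //.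
    by rewrite ss0.
    by rewrite s0M.
  move=> /andP[vs0 vs1] n0 n1; have /andP[_] := between v n0 n1.
  have v0 : 0 <= v by rewrite ltW // (le_lt_trans (s_ge0 j)).
  have vM := lt_trans vs0 s0M.
  have := count_eigenvalues p S iS v0 vM j.
  have := count_eigenvalues p0 S0 i0 v0 vM j.
  have := count_eigenvalues p1 S1 i1 v0 vM j.
  rewrite sv (lt_gtF vs0) (lt_gtF vs1); lia.
move=> /andP[ss0 ss1].
have [|||v [sv]] := generic (Num.max (s0 j) (s1 j)) (s j); rewrite ?le_max ?gt_max ?s0_ge0 ?ss0 //.
move=> vs n0 n1; move: sv; rewrite gt_max => /andP[vs0 vs1].
have /andP[+ _] := between v n0 n1.
have v0 : 0 <= v by rewrite ltW // (le_lt_trans (s0_ge0 j)).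
have vM := lt_trans vs sM.
have := count_eigenvalues p S iS v0 vM j.
have := count_eigenvalues p0 S0 i0 v0 vM j.
have := count_eigenvalues p1 S1 i1 v0 vM j.
rewrite vs0 vs1 (lt_gtF vs); lia.
Qed.

End Counting.

(** * Pencils that are weighted sums of squares *)

Section GramPencil.
Variables (R : realType) (n p : nat) (M : R) (W : 'M[R[i]]_(n, p)).
Variable a : R -> 'I_p -> R.
Hypothesis Wfree : row_free W.

Definition gram_pencil (t : R) : 'M[R[i]]_n :=
  W *m diag_mx (\row_j (real_complex _ (a t j))) *m W ^t*.

Lemma gram_pencil_hermsym t : gram_pencil t \is hermsymmx.
Proof.
apply: gram_hermsym; apply/mxOverP => i j; rewrite mxE.
by apply/complex_realP; exists (a t j).
Qed.

Lemma hform_gram_pencil t x :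
  hform (gram_pencil t) x = \sum_j real_complex _ (a t j) * `|(x *m W) 0 j| ^+ 2.
Proof. by rewrite hform_gram; apply: eq_bigr => j _; rewrite mxE. Qed.

Lemma gram_coord_neq0 (x : 'rV[R[i]]_n) : x != 0 -> exists j, (x *m W) 0 j != 0.
Proof.
move=> x0; apply/existsP; apply: contraNT x0; rewrite negb_exists => /forallP xW.
rewrite -(mulmx_free_eq0 _ Wfree); apply/eqP/rowP => j; rewrite [RHS]mxE.
by apply/eqP; rewrite -[_ == _]negbK.
Qed.

(** Only the weights depend on [t], so the claims reduce to scalar functions. As [W] is free, a
    nonzero [x] has a nonzero coordinate in [x *m W], which makes the decrease strict. *)
Lemma gram_pencil_decreasing :
  (forall (s t : R) j, 0 <= s -> s < t -> t < M -> a t j < a s j) ->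
  (forall (t e : R) j, 0 <= t -> t < M -> 0 < e -> exists2 d : R, 0 < d &
     forall s : R, 0 <= s -> s < M -> `|s - t| < d -> `|a s j - a t j| < e) ->
  decreasing_pencil M gram_pencil.
Proof.
move=> decr_a cont_a; split; first exact: gram_pencil_hermsym.
  move=> s t x s0 st tM /gram_coord_neq0[j xj]; rewrite !hform_gram_pencil.
  rewrite (bigD1 j) //= [ltRHS](bigD1 j) //=; apply: ltr_leD.
    by rewrite ltr_pM2r ?exprn_gt0 ?normr_gt0 // ltcR decr_a.
  apply: ler_sum => i _; rewrite ler_wpM2r ?exprn_ge0 // lecR ltW //.
  exact: decr_a.
move=> t c t0 tM c0.
have [T T0 HT] : exists2 T : R[i], 0 <= T &
    forall x : 'rV[R[i]]_n, \sum_j `|(x *m W) 0 j| ^+ 2 <= T * \sum_i `|x 0 i| ^+ 2.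
  have hW : W *m diag_mx (const_mx 1) *m W ^t* \is hermsymmx.
    by apply: gram_hermsym; apply/mxOverP => i j; rewrite mxE rpred1.
  have [T T0 HT] := hform_bounded hW; exists T => // x; apply: le_trans (HT x).
  by rewrite hform_gram; apply: ler_sum => j _; rewrite [const_mx _ _ _]mxE mul1r.
have [k cE] : exists k, c = real_complex _ k by apply/complex_realP; rewrite ger0_real ?ltW.
have [l TE] : exists l, T = real_complex _ l by apply/complex_realP; rewrite ger0_real.
rewrite cE ltcR in c0; rewrite TE lecR in T0.
(* Here [l] bounds the squared norm of [x *m W] against that of [x]; with [l + 1] the inequality
   [e * l < k] holds for [l = 0] as well. *)
pose e := k / (l + 1).
have e0 : 0 < e by rewrite divr_gt0 //; lra.
have /choice[dl Hdl] : forall j, exists d : R, 0 < d /\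
     forall s : R, 0 <= s -> s < M -> `|s - t| < d -> `|a s j - a t j| < e.
  by move=> j; have [d d0 Hd] := cont_a t e j t0 tM e0; exists d.
exists (\big[Order.min/1]_j dl j).
  by apply/lt_bigmin; [exact: ltr01 | move=> j _; have [] := Hdl j].
move=> s s0 sM /bigmin_gtP[_ sd] x x0; rewrite !hform_gram_pencil -sumrB.
under eq_bigr do rewrite -mulrBl -rmorphB.
apply: (@le_lt_trans _ _ (real_complex _ e * \sum_j `|(x *m W) 0 j| ^+ 2)).
  rewrite mulr_sumr; apply: le_trans (ler_norm_sum _ _ _) _; apply: ler_sum => j _.
  rewrite normrM normrX normr_id ler_wpM2r ?exprn_ge0 // normc_def /= expr0n addr0 sqrtr_sqr.
  by rewrite lecR ltW // (Hdl j).2 // sd.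
apply: (@le_lt_trans _ _ (real_complex _ (e * l) * \sum_i `|x 0 i| ^+ 2)).
  have -> : real_complex _ (e * l) = real_complex _ e * T by rewrite TE -rmorphM.
  by rewrite -mulrA ler_wpM2l ?lecR ?(ltW e0).
rewrite cE ltr_pM2r ?sum_norm_sqr_gt0 // ltcR /e mulrAC ltr_pdivrMr; last by lra.
by rewrite ltr_pM2l //; lra.
Qed.

End GramPencil.

(** * The equation [- f'' = mu f] on an edge *)

Section EdgeSolutions.
Variable R : realType.
Implicit Types (mu l x t : R) (f g : R -> R).
Local Notation leb := (@lebesgue_measure R).

(** The solution with value 1 and slope 0 at 0, while [ssol] has value 0 and slope 1: trigonometric,
    affine or hyperbolic according to the sign of [mu]. Negative [mu] serves to exclude negative
    eigenvalues. *)
Definition csol mu t : R :=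
  if 0 < mu then cos (Num.sqrt mu * t)
  else if mu == 0 then 1
  else (expR (Num.sqrt (- mu) * t) + expR (- (Num.sqrt (- mu) * t))) / 2.

Definition ssol mu t : R :=
  if 0 < mu then sin (Num.sqrt mu * t) / Num.sqrt mu
  else if mu == 0 then t
  else (expR (Num.sqrt (- mu) * t) - expR (- (Num.sqrt (- mu) * t))) / (2 * Num.sqrt (- mu)).

Lemma csol0 mu : csol mu 0 = 1.
Proof.
rewrite /csol !mulr0 oppr0 cos0 expR0; case: ifP => // _; case: ifP => // _.
by field.
Qed.

Lemma ssol0 mu : ssol mu 0 = 0.
Proof. by rewrite /ssol !mulr0 oppr0 sin0 expR0 subrr !mul0r !if_same. Qed.

Lemma is_derive_csol mu t : is_derive t 1 (csol mu) (- mu * ssol mu t).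
Proof.
rewrite /csol /ssol; case: ifPn => mu0.
  have w0 : Num.sqrt mu != 0 by rewrite gt_eqF ?sqrtr_gt0.
  have := sqr_sqrtr (ltW mu0); set w := Num.sqrt mu in w0 * => <-.
  by apply: is_derive_eq; rewrite /GRing.scale /=; field.
case: ifPn => mu1; first by apply: is_derive_eq; rewrite (eqP mu1) oppr0 mul0r.
have mu2 : 0 < - mu by rewrite oppr_gt0 lt_neqAle mu1 leNgt.
have w0 : Num.sqrt (- mu) != 0 by rewrite gt_eqF ?sqrtr_gt0.
have := sqr_sqrtr (ltW mu2); set w := Num.sqrt (- mu) in w0 * => <-.
by apply: is_derive_eq; rewrite /GRing.scale /=; field.
Qed.

Lemma is_derive_ssol mu t : is_derive t 1 (ssol mu) (csol mu t).
Proof.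
rewrite /csol /ssol; case: ifPn => mu0.
  have w0 : Num.sqrt mu != 0 by rewrite gt_eqF ?sqrtr_gt0.
  by apply: is_derive_eq; rewrite /GRing.scale /=; field.
case: ifPn => mu1; first by apply: is_derive_eq.
have mu2 : 0 < - mu by rewrite oppr_gt0 lt_neqAle mu1 leNgt.
have w0 : Num.sqrt (- mu) != 0 by rewrite gt_eqF ?sqrtr_gt0.
by apply: is_derive_eq; rewrite /GRing.scale /=; field.
Qed.

(** The left side is the Wronskian of [csol] and [ssol], hence constant in [t]. *)
Lemma csol_ssol_sqr mu t : csol mu t ^+ 2 + mu * ssol mu t ^+ 2 = 1.
Proof.
pose f := csol mu * csol mu + mu *: (ssol mu * ssol mu).
have df (y : R) : is_derive y 1 (f : R -> R) 0.
  have dC := is_derive_csol mu y; have dS := is_derive_ssol mu y.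
  apply: (is_derive_eq (is_deriveD (is_deriveM dC dC) (is_deriveZ mu (is_deriveM dS dS)))).
  by rewrite /GRing.scale /=; ring.
have := is_derive_0_is_cst t 0 df.
by rewrite /f !fctE /= csol0 ssol0 /GRing.scale /= !mulr0 addr0 mulr1 !expr2.
Qed.

Lemma continuous_csol mu : continuous (csol mu).
Proof.
move=> t; apply: differentiable_continuous; apply/derivable1_diffP.
have dC := is_derive_csol mu t; exact: ex_derive.
Qed.

Lemma continuous_ssol mu : continuous (ssol mu).
Proof.
move=> t; apply: differentiable_continuous; apply/derivable1_diffP.
have dS := is_derive_ssol mu t; exact: ex_derive.
Qed.

Lemma cst_of_derive0 (l : R) g : {within `[0, l], continuous g} ->
  (forall x, x \in `]0, l[ -> is_derive x 1 g 0) -> forall x, x \in `[0, l] -> g x = g 0.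
Proof.
move=> cg dg x; rewrite in_itv /= => /andP[+ xl].
rewrite le_eqVlt => /predU1P[<-//|x0].
have sub : `[0, x] `<=` `[0, l].
  by move=> y /=; rewrite !in_itv /= => /andP[-> /le_trans]; apply.
have dg0 (y : R) : y \in `]0, x[ -> is_derive y 1 g 0.
  rewrite in_itv /= => /andP[y0 yx]; apply: dg.
  by rewrite in_itv /= y0 (lt_le_trans yx).
have [c _] := MVT x0 dg0 (continuous_subspaceW sub cg).
by rewrite mul0r => /eqP; rewrite subr_eq0 => /eqP.
Qed.

(** The Wronskians of [f] with [ssol] and [csol] are constant, and [csol_ssol_sqr] inverts the two
    resulting relations. *)
Lemma solution_unique mu l f g :
  {within `[0, l], continuous f} -> {within `[0, l], continuous g} ->
  (forall x, x \in `]0, l[ -> is_derive x 1 f (g x)) ->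
  (forall x, x \in `]0, l[ -> is_derive x 1 g (- mu * f x)) ->
  forall x, x \in `[0, l] ->
    f x = f 0 * csol mu x + g 0 * ssol mu x /\
    g x = - mu * f 0 * ssol mu x + g 0 * csol mu x.
Proof.
move=> cf cg df dg x xl.
have cC : {within `[0, l], continuous (csol mu)}.
  exact: continuous_subspaceT (@continuous_csol mu).
have cS : {within `[0, l], continuous (ssol mu)}.
  exact: continuous_subspaceT (@continuous_ssol mu).
have cst1 : (f * csol mu - g * ssol mu) x = (f * csol mu - g * ssol mu) 0.
  have cst (y : R) : y \in `]0, l[ -> is_derive y 1 (f * csol mu - g * ssol mu) 0.
    move=> yl; have dC := is_derive_csol mu y; have dS := is_derive_ssol mu y.
    apply: (is_derive_eq (is_deriveB (is_deriveM (df y yl) dC) (is_deriveM (dg y yl) dS))).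
    by rewrite /GRing.scale /=; ring.
  apply: (cst_of_derive0 _ cst) xl => y.
  by apply: cvgB; apply: cvgM; [exact: cf|exact: cC|exact: cg|exact: cS].
have cst2 : (mu *: (f * ssol mu) + g * csol mu) x = (mu *: (f * ssol mu) + g * csol mu) 0.
  have cst (y : R) : y \in `]0, l[ -> is_derive y 1 (mu *: (f * ssol mu) + g * csol mu) 0.
    move=> yl; have dC := is_derive_csol mu y; have dS := is_derive_ssol mu y.
    apply: (is_derive_eq (is_deriveD (is_deriveZ mu (is_deriveM (df y yl) dS))
      (is_deriveM (dg y yl) dC))).
    by rewrite /GRing.scale /=; ring.
  apply: (cst_of_derive0 _ cst) xl => y.
  apply: cvgD; last by apply: cvgM; [exact: cg|exact: cC].
  by apply: cvgZr; apply: cvgM; [exact: cf|exact: cS].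
have := csol_ssol_sqr mu x.
move: cst1 cst2; rewrite !fctE /= csol0 ssol0 /GRing.scale /=.
rewrite !mulr0 subr0 add0r !mulr1 => cst1 cst2 CS; split.
  transitivity ((f x * csol mu x - g x * ssol mu x) * csol mu x
    + (mu * (f x * ssol mu x) + g x * csol mu x) * ssol mu x).
    by rewrite -[LHS]mulr1 -CS; ring.
  by rewrite cst1 cst2.
transitivity (- mu * (f x * csol mu x - g x * ssol mu x) * ssol mu x
  + (mu * (f x * ssol mu x) + g x * csol mu x) * csol mu x).
  by rewrite -[LHS]mulr1 -CS; ring.
by rewrite cst1 cst2.
Qed.

(** On a bounded interval the bound [|g| <= 1 + g ^+ 2] suffices. *)
Lemma square_integrable_integrable l g : square_integrable l g ->
  leb.-integrable `[0, l] (EFin \o g).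
Proof.
move=> [mg ig].
have i1 : leb.-integrable `[0, l] (EFin \o cst (1 : R)).
  apply: continuous_compact_integrable; first exact: segment_compact.
  by move=> x; exact: cvg_cst.
apply: le_integrable (integrableD _ i1 ig) => //; first exact/measurable_EFinP.
move=> x _; change (`|(g x)%:E| <= `|(1 + g x ^+ 2)%:E|)%E.
rewrite lee_fin [leRHS]ger0_norm; last by rewrite addr_ge0 ?sqr_ge0.
by have := sqr_ge0 (`|g x| - 1); rewrite -(real_normK (num_real (g x))); nra.
Qed.

Lemma ac_deriv_continuous l f g : 0 < l -> leb.-integrable `[0, l] (EFin \o g) ->
  ac_deriv l f g -> {within `[0, l], continuous f}.
Proof.
move=> l0 ig fg; have cF := parameterized_integral_continuous (ltW l0) ig.
apply: (@subspace_eq_continuous _ _ _ (fun x => f 0 + parameterized_integral leb 0 x g)).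
  by move=> x; rewrite inE => xl; rewrite [RHS]fg //.
by move=> x; apply: cvgD; [exact: cvg_cst|exact: cF].
Qed.

Lemma ac_deriv_is_derive l f g : 0 < l -> {within `[0, l], continuous g} ->
  ac_deriv l f g -> forall x, x \in `]0, l[ -> is_derive x 1 f (g x).
Proof.
move=> l0 cg fg x xl; have [x0 lx] : 0 < x /\ x < l by move: xl; rewrite in_itv /= => /andP.
have ig : leb.-integrable `[0, l] (EFin \o g).
  by apply: continuous_compact_integrable => //; exact: segment_compact.
have [dF F'] := @continuous_FTC1_closed R g 0 x l lx ig x0
  (within_continuous_continuous l0 cg xl).
set F := fun y => \int[leb]_(t in `[0, y]) g t in dF F'.
have {dF F'} dF : is_derive x 1 F (g x).
  by apply: DeriveDef; [exact: dF | rewrite -derive1E].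
apply: (@near_eq_is_derive R R^o R^o (cst (f 0) + F)).
  near=> y; rewrite [RHS]fg //; apply: subset_itv_oo_cc; near: y.
  exact: near_in_itvoo.
by apply: is_derive_eq; rewrite add0r.
Unshelve. all: by end_near.
Qed.

(** The equation holds only almost everywhere, but under the integral it replaces [h] by the
    continuous function [- mu * f]. The slope is then differentiable in the classical sense inside
    the edge, and uniqueness applies. *)
Lemma H2_real_solution mu l f g h : 0 < l -> H2_real l f g h ->
  {ae leb, forall x, `[0, l]%classic x -> mu * f x = - h x} ->
  forall x, x \in `[0, l] ->
    f x = f 0 * csol mu x + g 0 * ssol mu x /\
    g x = - mu * f 0 * ssol mu x + g 0 * csol mu x.
Proof.
move=> l0 [fg gh sh] aeh.
have ih := square_integrable_integrable sh.
have cg := ac_deriv_continuous l0 ih gh.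
have ig : leb.-integrable `[0, l] (EFin \o g).
  by apply: continuous_compact_integrable => //; exact: segment_compact.
have cf := ac_deriv_continuous l0 ig fg.
have cf' : {within `[0, l], continuous (fun x => - mu * f x)}.
  by move=> x; apply: cvgM; [exact: cvg_cst | exact: cf].
apply: solution_unique => //; first exact: ac_deriv_is_derive.
apply: ac_deriv_is_derive => // x xl; rewrite gh //; congr (_ + fine _).
have sub : `[0, x] `<=` `[0, l].
  by move=> y /=; move: xl; rewrite !in_itv /= => /andP[_ xl] /andP[-> /le_trans]; apply.
apply: ae_eq_integral => //.
- apply/measurable_EFinP; apply: measurable_funS sub sh.1; first exact: measurable_itv.
- apply/measurable_EFinP; apply: measurable_funS sub _; first exact: measurable_itv.
  exact: subspace_continuous_measurable_fun.
apply: filterS aeh; first exact: (ae_filter_ringOfSetsType leb).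
move=> y Hy /sub /Hy E /=; congr (_%:E).
by rewrite mulNr E opprK.
Qed.

Lemma ac_deriv_smooth l f g : continuous g -> (forall x, is_derive x 1 f (g x)) ->
  ac_deriv l f g.
Proof.
move=> cg df x; rewrite in_itv /= => /andP[+ _]; rewrite le_eqVlt => /predU1P[<-|x0].
  by rewrite set_itv1 /Rintegral integral_set1 addr0.
rewrite /Rintegral (@continuous_FTC2 _ g f 0 x) //.
- by rewrite fineB //= addrC subrK.
- exact: continuous_subspaceT.
- have cf y : {for y, continuous f}.
    apply: differentiable_continuous; apply/derivable1_diffP.
    have := df y; move=> dfy; exact: ex_derive.
  split; first by move=> y _; have := df y; move=> dfy; exact: ex_derive.
    by apply: cvg_at_right_filter; exact: cf.
  by apply: cvg_at_left_filter; exact: cf.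
by move=> y _; rewrite derive1E; have dfy := df y; rewrite derive_val.
Qed.

Lemma solution_H2_real mu l u b : 0 < l ->
  H2_real l (fun x => u * csol mu x + b * ssol mu x)
    (fun x => - mu * u * ssol mu x + b * csol mu x)
    (fun x => - mu * (u * csol mu x + b * ssol mu x)).
Proof.
move=> l0.
have cont (p q : R) : continuous (fun x => p * csol mu x + q * ssol mu x).
  move=> x; apply: cvgD; apply: cvgM; try exact: cvg_cst.
    exact: continuous_csol.
  exact: continuous_ssol.
have cont' (p q : R) : continuous (fun x => p * ssol mu x + q * csol mu x).
  move=> x; apply: cvgD; apply: cvgM; try exact: cvg_cst.
    exact: continuous_ssol.
  exact: continuous_csol.
have conth : continuous (fun x => - mu * (u * csol mu x + b * ssol mu x)).
  by move=> x; apply: cvgM; [exact: cvg_cst | exact: cont].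
have dval x : is_derive x 1 (fun t => u * csol mu t + b * ssol mu t)
    (- mu * u * ssol mu x + b * csol mu x).
  have dC := is_derive_csol mu x; have dS := is_derive_ssol mu x.
  apply: (is_derive_eq (is_deriveD (is_deriveZ u dC) (is_deriveZ b dS))).
  by rewrite /GRing.scale /=; ring.
have dslope x : is_derive x 1 (fun t => - mu * u * ssol mu t + b * csol mu t)
    (- mu * (u * csol mu x + b * ssol mu x)).
  have dC := is_derive_csol mu x; have dS := is_derive_ssol mu x.
  apply: (is_derive_eq (is_deriveD (is_deriveZ (- mu * u) dS) (is_deriveZ b dC))).
  by rewrite /GRing.scale /=; ring.
split; [exact: ac_deriv_smooth | exact: ac_deriv_smooth |].
split.
  apply: subspace_continuous_measurable_fun => //; exact: continuous_subspaceT.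
apply: continuous_compact_integrable; first exact: segment_compact.
apply: continuous_subspaceT => x; apply: cvgM; exact: conth.
Qed.

End EdgeSolutions.

(** * Dependence of the solutions on the energy *)

Section SolutionMonotonicity.
Variable R : realType.
Implicit Types (mu nu h t x : R).

(** A translate solves the same equation, so uniqueness gives the addition formulas for all signs of
    [mu] at once. *)
Lemma solution_shift mu x : 0 <= x -> forall h, 0 <= h ->
  csol mu (x + h) = csol mu x * csol mu h - mu * ssol mu x * ssol mu h /\
  ssol mu (x + h) = ssol mu x * csol mu h + csol mu x * ssol mu h.
Proof.
move=> x0 h h0.
have dshift (f : R -> R) (df : R -> R) : (forall y : R, is_derive y 1 f (df y)) ->
    forall y : R, is_derive y 1 (f \o shift x : R -> R) (df (y + x)).
  move=> Hf y; have := @is_derive1_comp R f (shift x) y _ _ (Hf (y + x)) (is_derive_shift y 1 x).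
  by rewrite mulr1.
have cshift f : continuous f -> {within `[0, h], continuous (f \o shift x : R -> R)}.
  move=> cf; apply: continuous_subspaceT => y; apply: continuous_comp; last exact: cf.
  by apply: cvgD; [exact: cvg_id | exact: cvg_cst].
have hh : h \in `[0, h] by rewrite in_itv /= h0 lexx.
have [] := @solution_unique R mu h (ssol mu \o shift x) (csol mu \o shift x) _ _ _ _ h hh.
- by apply: cshift; apply: continuous_ssol.
- by apply: cshift; apply: continuous_csol.
- by move=> y _; exact: (dshift (ssol mu) (csol mu) (is_derive_ssol mu)).
- by move=> y _; exact: (dshift (csol mu) (fun z => - mu * ssol mu z) (is_derive_csol mu)).
rewrite /= add0r addrC => -> ->; split; last by [].
by ring.
Qed.

Lemma csol_cos mu t : 0 <= mu -> csol mu t = cos (Num.sqrt mu * t).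
Proof.
rewrite /csol le_eqVlt => /predU1P[<-|->//].
by rewrite ltxx eqxx sqrtr0 mul0r cos0.
Qed.

(** For negative [mu] the root [Num.sqrt mu] is 0, so the bound by [pi] holds automatically, and the
    hyperbolic cosine is positive. *)
Lemma csol_gtN1 mu t : 0 <= t -> Num.sqrt mu * t < pi -> 0 < 1 + csol mu t.
Proof.
move=> t0 tpi; have [mu0|mu0] := leP 0 mu.
  rewrite csol_cos // -ltrBlDl sub0r -cospi ltr_cos //.
    by rewrite in_itv /= mulr_ge0 ?sqrtr_ge0 //= ltW.
  by rewrite in_itv /= pi_ge0 lexx.
rewrite /csol (lt_gtF mu0) (lt_eqF mu0) addr_gt0 // divr_gt0 // addr_gt0 //; exact: expR_gt0.
Qed.

Lemma ssol_gt0 mu t : 0 < t -> Num.sqrt mu * t < pi -> 0 < ssol mu t.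
Proof.
move=> t0 tpi; rewrite /ssol; case: ifPn => mu0.
  rewrite divr_gt0 ?sqrtr_gt0 // sin_gt0_pi // tpi andbT.
  by rewrite mulr_gt0 ?sqrtr_gt0.
case: ifPn => // mu1; have mu2 : 0 < - mu by rewrite oppr_gt0 lt_neqAle mu1 leNgt.
rewrite divr_gt0 ?mulr_gt0 ?sqrtr_gt0 // subr_gt0 ltr_expR.
have : 0 < Num.sqrt (- mu) * t by rewrite mulr_gt0 ?sqrtr_gt0.
lra.
Qed.

(* For mu > 0 this is tan (sqrt mu * t / 2) / sqrt mu.  Its derivative in t is
   1 / (1 + C), which is monotone in mu: this gives monotonicity and continuity
   in mu without a special treatment of mu = 0. *)
Definition half_tan mu t := ssol mu t / (1 + csol mu t).

Lemma is_derive_half_tan mu t : 0 <= t -> Num.sqrt mu * t < pi ->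
  is_derive t 1 (half_tan mu) (1 + csol mu t)^-1.
Proof.
move=> t0 tpi; have c0 := csol_gtN1 t0 tpi.
have dC := is_derive_csol mu t; have dS := is_derive_ssol mu t.
have nz : 1 + csol mu t != 0 by rewrite gt_eqF.
have d1C : is_derive t 1 (fun y => 1 + csol mu y) (- mu * ssol mu t).
  by apply: is_derive_eq; rewrite add0r mul1r.
have dV := is_deriveV (nz : (fun y => 1 + csol mu y) t != 0).
rewrite /half_tan; apply: is_derive_eq; rewrite /GRing.scale /=.
have := csol_ssol_sqr mu t; move: nz; set C := csol mu t; set S := ssol mu t => nz CS.
(* The term [mu * S ^+ 2] is written as the conserved quantity minus [C ^+ 2]. *)
transitivity (((1 + C) * C + (C ^+ 2 + mu * S ^+ 2 - C ^+ 2)) / (1 + C) ^+ 2); first by field.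
by rewrite CS; field.
Qed.

Lemma half_tan_gt0 mu t : 0 < t -> Num.sqrt mu * t < pi -> 0 < half_tan mu t.
Proof. by move=> t0 tpi; rewrite divr_gt0 ?ssol_gt0 ?csol_gtN1 // ltW. Qed.

(** Both functions of [t] vanish at 0; the mean value theorem for their difference turns a
    comparison in [mu] into one of [csol] at an intermediate point. *)
Lemma half_tan_mean mu nu t : 0 < t -> Num.sqrt mu * t < pi -> Num.sqrt nu * t < pi ->
  exists2 c, 0 < c < t & half_tan nu t - half_tan mu t =
    ((1 + csol nu c)^-1 - (1 + csol mu c)^-1) * t.
Proof.
move=> t0 mupi nupi; pose g := half_tan nu - half_tan mu.
have lepi la c : 0 <= c -> c <= t -> Num.sqrt la * t < pi -> Num.sqrt la * c < pi.
  by move=> c0 ct; apply: le_lt_trans; rewrite ler_wpM2l ?sqrtr_ge0.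
have dg c : 0 <= c -> c <= t ->
    is_derive c 1 g ((1 + csol nu c)^-1 - (1 + csol mu c)^-1).
  move=> c0 ct.
  have dmu := is_derive_half_tan c0 (lepi _ _ c0 ct mupi).
  have dnu := is_derive_half_tan c0 (lepi _ _ c0 ct nupi).
  by apply: is_derive_eq.
have [||c cI] := MVT (f := g) (df := fun c => (1 + csol nu c)^-1 - (1 + csol mu c)^-1) t0.
- by move=> c; rewrite in_itv /= => /andP[/ltW c0 /ltW ct]; apply: dg.
- apply: derivable_within_continuous => c; rewrite in_itv /= => /andP[c0 ct].
  by have dgc := dg c c0 ct; exact: ex_derive.
rewrite subr0 /g !fctE /half_tan !ssol0 !mul0r subr0 subr0 => E.
by exists c.
Qed.

Lemma csol_decreasing mu nu t : 0 <= mu -> mu < nu -> 0 < t -> Num.sqrt nu * t < pi ->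
  csol nu t < csol mu t.
Proof.
move=> mu0 munu t0 nupi; have nu0 := le_lt_trans mu0 munu.
have lt_sqrt : Num.sqrt mu * t < Num.sqrt nu * t by rewrite ltr_pM2r // ltr_sqrt.
have itv la : Num.sqrt la * t <= pi -> Num.sqrt la * t \in `[0, pi].
  by rewrite in_itv /= mulr_ge0 ?sqrtr_ge0 ?(ltW t0).
by rewrite !csol_cos ?(ltW nu0) // ltr_cos // itv // ltW // (lt_trans lt_sqrt).
Qed.

Lemma half_tan_increasing mu nu t : 0 <= mu -> mu < nu -> 0 < t ->
  Num.sqrt nu * t < pi -> half_tan mu t < half_tan nu t.
Proof.
move=> mu0 munu t0 nupi; have nu0 := le_lt_trans mu0 munu.
have mupi : Num.sqrt mu * t < pi.
  by apply: lt_trans nupi; rewrite ltr_pM2r // ltr_sqrt.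
rewrite -subr_gt0; have [c /andP[c0 ct] ->] := half_tan_mean t0 mupi nupi.
have cpi la : Num.sqrt la * t < pi -> Num.sqrt la * c < pi.
  by apply: le_lt_trans; rewrite ler_wpM2l ?sqrtr_ge0 ?ltW.
rewrite mulr_gt0 // subr_gt0 ltf_pV2 ?posrE ?csol_gtN1 ?ltW ?cpi // ltrD2l.
by rewrite csol_decreasing // cpi.
Qed.

Lemma cos_lipschitz (x y : R) : `|cos x - cos y| <= `|x - y|.
Proof.
wlog xy : x y / y < x.
  move=> H; have [/H //|yx|->] := ltgtP y x; last by rewrite !subrr.
  by rewrite distrC [leRHS]distrC H.
have [|c _ ->] := MVT (f := cos) (df := fun t => - sin t) xy (fun z _ => is_derive_cos z).
  exact: continuous_subspaceT (@continuous_cos R).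
by rewrite normrM normrN ler_piMl // sin_max.
Qed.

(** The energy 0 has to be covered, and there the square root is only Hoelder continuous with
    exponent 1/2. *)
Lemma sqrt_holder mu nu : 0 <= mu -> 0 <= nu ->
  (Num.sqrt mu - Num.sqrt nu) ^+ 2 <= `|mu - nu|.
Proof.
wlog munu : mu nu / mu <= nu.
  move=> H mu0 nu0; have [/H|/ltW/H] := leP mu nu; first exact.
  by rewrite distrC -sqrrN opprB; apply.
move=> mu0 nu0; rewrite distrC ger0_norm ?subr_ge0 //.
have le_sqrt : Num.sqrt mu <= Num.sqrt nu by rewrite ler_sqrt.
rewrite -[in leRHS](sqr_sqrtr mu0) -[in leRHS](sqr_sqrtr nu0).
by have := sqrtr_ge0 mu; nra.
Qed.

Definition continuous_on_seg (M : R) (a : R -> R) :=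
  forall t e, 0 <= t -> t < M -> 0 < e -> exists2 d, 0 < d &
    forall s, 0 <= s -> s < M -> `|s - t| < d -> `|a s - a t| < e.

Lemma continuous_on_segP M a : continuous_on_seg M a <->
  forall t, 0 <= t < M -> a s @[s --> within [set s | 0 <= s < M] (nbhs t)] --> a t.
Proof.
split=> [ca t /andP[t0 tM]|ca t e t0 tM e0].
  apply/cvgrPdist_lt => e e0; have [d d0 Hd] := ca t e t0 tM e0.
  rewrite near_withinE; apply/nbhs_ballP; exists d => // s /= sd /andP[s0 sM].
  by rewrite distrC Hd // distrC.
have /cvgrPdist_lt /(_ e e0) := ca t (introT andP (conj t0 tM)).
rewrite near_withinE => /nbhs_ballP[d /= d0 Hd]; exists d => // s s0 sM sd.
by rewrite distrC; apply: Hd; [rewrite /ball /= distrC | rewrite s0 sM].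
Qed.

Lemma half_tan_continuous M t : 0 < t -> Num.sqrt M * t < pi ->
  continuous_on_seg M (half_tan^~ t).
Proof.
move=> t0 Mpi mu e mu0 muM e0.
have M0 : 0 < M := le_lt_trans mu0 muM.
(* A lower bound for [1 + csol] at all energies in [0, M) and all points up to [t], since the cosine
   decreases on [0, pi]. *)
pose q := 1 + cos (Num.sqrt M * t).
have q0 : 0 < q by rewrite /q -csol_cos ?(ltW M0) // csol_gtN1 // ltW.
(* Energies closer than [r ^+ 2] have roots closer than [r]; the cosines then differ by less than
   [r * t], and the values of [half_tan] by less than [r * t ^+ 2 / q ^+ 2 = e]. *)
pose r := e * q ^+ 2 / t ^+ 2.
have r0 : 0 < r by rewrite /r divr_gt0 ?mulr_gt0 ?exprn_gt0.
exists (r ^+ 2) => [|nu nu0 nuM numu]; first by rewrite exprn_gt0.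
have lepi la c : 0 <= la -> la < M -> 0 <= c -> c <= t -> Num.sqrt la * c <= Num.sqrt M * t.
  by move=> la0 laM c0 ct; rewrite ler_pM ?sqrtr_ge0 ?ler_sqrt // ltW.
have [c /andP[c0 ct] ->] := half_tan_mean t0
  (le_lt_trans (lepi mu t mu0 muM (ltW t0) (lexx _)) Mpi)
  (le_lt_trans (lepi nu t nu0 nuM (ltW t0) (lexx _)) Mpi).
have leq la : 0 <= la -> la < M -> q <= 1 + csol la c.
  move=> la0 laM; rewrite csol_cos // /q lerD2l.
  have Lc := lepi la c la0 laM (ltW c0) (ltW ct).
  have I1 : Num.sqrt M * t \in `[0, pi] by rewrite in_itv /= mulr_ge0 ?sqrtr_ge0 ?ltW.
  have I2 : Num.sqrt la * c \in `[0, pi].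
    by rewrite in_itv /= mulr_ge0 ?sqrtr_ge0 ?ltW // (le_lt_trans Lc).
  by rewrite leNgt ltr_cos // -leNgt.
have qmu := leq mu mu0 muM; have qnu := leq nu nu0 nuM.
have dsqrt : `|Num.sqrt mu - Num.sqrt nu| < r.
  rewrite -(@ltr_pXn2r _ 2) ?nnegrE ?(ltW r0) // real_normK ?num_real //.
  by apply: le_lt_trans numu; rewrite distrC; apply: sqrt_holder.
have dcos : `|csol mu c - csol nu c| <= `|Num.sqrt mu - Num.sqrt nu| * t.
  rewrite !csol_cos //; apply: le_trans (cos_lipschitz _ _) _.
  rewrite -mulrBl normrM (gtr0_norm c0) ler_wpM2l // ltW //.
have -> : (1 + csol nu c)^-1 - (1 + csol mu c)^-1 =
    (csol mu c - csol nu c) / ((1 + csol mu c) * (1 + csol nu c)).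
  by field; rewrite !gt_eqF // ?(lt_le_trans q0).
rewrite !normrM (gtr0_norm t0) normfV (gtr0_norm (_ : 0 < _ * _)); last first.
  by rewrite mulr_gt0 // (lt_le_trans q0).
have qq : q ^+ 2 <= (1 + csol mu c) * (1 + csol nu c) by rewrite expr2 ler_pM // ltW.
rewrite mulrAC ltr_pdivrMr; last by apply: lt_le_trans qq; rewrite exprn_gt0.
apply: (@lt_le_trans _ _ (e * q ^+ 2)); last by rewrite ler_pM2l.
have -> : e * q ^+ 2 = r * t * t by rewrite /r; field; rewrite gt_eqF.
rewrite ltr_pM2r //; apply: le_lt_trans dcos _; by rewrite ltr_pM2r.
Qed.

(** With [coef_diff], half the eigenvalues of the energy form of a piece in its two end values, the
    matrix with diagonal [C / S] and off-diagonal [- 1 / S]. Each of the two is monotone in [mu] by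
    itself. *)
Definition coef_sum mu t := (csol mu t - 1) / (2 * ssol mu t).
Definition coef_diff mu t := (csol mu t + 1) / (2 * ssol mu t).

Lemma coef_sumE mu t : 0 < t -> Num.sqrt mu * t < pi ->
  coef_sum mu t = - (mu / 2) * half_tan mu t.
Proof.
move=> t0 tpi; have S0 := ssol_gt0 t0 tpi; have C0 := csol_gtN1 (ltW t0) tpi.
have := csol_ssol_sqr mu t; rewrite /coef_sum /half_tan.
move: S0 C0; set S := ssol mu t; set C := csol mu t => S0 C0 CS.
have muE : mu = (1 - C ^+ 2) / S ^+ 2 by rewrite -CS; field; rewrite gt_eqF.
by rewrite [X in - (X / 2)]muE; field; rewrite !gt_eqF.
Qed.

Lemma coef_diffE mu t : 0 < t -> Num.sqrt mu * t < pi ->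
  coef_diff mu t = (2 * half_tan mu t)^-1.
Proof.
move=> t0 tpi; have S0 := ssol_gt0 t0 tpi; have C0 := csol_gtN1 (ltW t0) tpi.
by rewrite /coef_diff /half_tan; field; rewrite !gt_eqF.
Qed.

Lemma sqrt_mul_lt_pi M mu t : mu < M -> 0 < t -> Num.sqrt M * t < pi -> Num.sqrt mu * t < pi.
Proof.
by move=> muM t0; apply: le_lt_trans; rewrite ler_pM2r // ler_wsqrtr // ltW.
Qed.

Lemma coef_sum_decreasing M t mu nu : 0 < t -> Num.sqrt M * t < pi ->
  0 <= mu -> mu < nu -> nu < M -> coef_sum nu t < coef_sum mu t.
Proof.
move=> t0 Mpi mu0 munu nuM.
have nupi := sqrt_mul_lt_pi nuM t0 Mpi.
have mupi := sqrt_mul_lt_pi munu t0 nupi.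
rewrite !coef_sumE //; have T0 := half_tan_gt0 t0 mupi.
have Tlt := half_tan_increasing mu0 munu t0 nupi.
have : 0 <= mu * (half_tan nu t - half_tan mu t) by rewrite mulr_ge0 // subr_ge0 ltW.
nra.
Qed.

Lemma coef_diff_decreasing M t mu nu : 0 < t -> Num.sqrt M * t < pi ->
  0 <= mu -> mu < nu -> nu < M -> coef_diff nu t < coef_diff mu t.
Proof.
move=> t0 Mpi mu0 munu nuM.
have nupi := sqrt_mul_lt_pi nuM t0 Mpi.
have mupi := sqrt_mul_lt_pi munu t0 nupi.
have T0 := half_tan_gt0 t0 mupi; have T1 := half_tan_gt0 t0 nupi.
have Tlt := half_tan_increasing mu0 munu t0 nupi.
by rewrite !coef_diffE // ltf_pV2 ?posrE; lra.
Qed.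

Lemma coef_sum_continuous M t : 0 < t -> Num.sqrt M * t < pi ->
  continuous_on_seg M (coef_sum^~ t).
Proof.
move=> t0 Mpi; have /continuous_on_segP cT := half_tan_continuous t0 Mpi.
have E mu : mu < M -> coef_sum mu t = - (mu / 2) * half_tan mu t.
  by move=> muM; rewrite coef_sumE // (sqrt_mul_lt_pi muM).
suff cE : continuous_on_seg M (fun mu => - (mu / 2) * half_tan mu t).
  move=> mu e mu0 muM e0; have [d d0 Hd] := cE mu e mu0 muM e0.
  by exists d => // nu nu0 nuM /(Hd nu nu0 nuM); rewrite !E.
apply/continuous_on_segP => mu muI; apply: cvgM; last exact: cT.
apply: cvgN; apply: cvgM; last exact: cvg_cst.
by apply: cvg_within_filter; exact: cvg_id.
Qed.

Lemma coef_diff_continuous M t : 0 < t -> Num.sqrt M * t < pi ->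
  continuous_on_seg M (coef_diff^~ t).
Proof.
move=> t0 Mpi; have /continuous_on_segP cT := half_tan_continuous t0 Mpi.
have E mu : mu < M -> coef_diff mu t = (2 * half_tan mu t)^-1.
  by move=> muM; rewrite coef_diffE // (sqrt_mul_lt_pi muM).
suff cE : continuous_on_seg M (fun mu => (2 * half_tan mu t)^-1).
  move=> mu e mu0 muM e0; have [d d0 Hd] := cE mu e mu0 muM e0.
  by exists d => // nu nu0 nuM /(Hd nu nu0 nuM); rewrite !E.
apply/continuous_on_segP => mu muI; have /andP[mu0 muM] := muI; apply: cvgV.
  by rewrite mulf_neq0 // gt_eqF // half_tan_gt0 // (sqrt_mul_lt_pi muM).
by apply: cvgM; [exact: cvg_cst | exact: cT].
Qed.

(** The conserved quantity gives [(C - 1) * (1 + C) = - mu * S ^+ 2], which is positive. *)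
Lemma csol_neg_gt1 mu t : mu < 0 -> 0 < t -> 1 < csol mu t.
Proof.
move=> mu0 t0; have := csol_ssol_sqr mu t.
have S0 : 0 < ssol mu t.
  by apply: ssol_gt0; rewrite // ltr0_sqrtr // mul0r pi_gt0.
have C0 : 0 < 1 + csol mu t.
  by apply: csol_gtN1; rewrite ?ltW // ltr0_sqrtr // mul0r pi_gt0.
move=> E; rewrite -subr_gt0 -(pmulr_lgt0 _ C0).
have -> : (csol mu t - 1) * (1 + csol mu t) = - mu * ssol mu t ^+ 2.
  by transitivity (csol mu t ^+ 2 - 1); [ring | rewrite -[X in _ - X]E; ring].
by rewrite mulr_gt0 ?oppr_gt0 ?exprn_gt0.
Qed.

End SolutionMonotonicity.

(** * Eigenfunctions as solutions on the fundamental cell *)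

Section ExpI.
Variable R : realType.
Implicit Types s t : R.

Lemma expi0 : expi 0 = 1 :> R[i].
Proof. by rewrite /expi cos0 sin0. Qed.

Lemma expiD s t : expi (s + t) = expi s * expi t.
Proof. by rewrite /expi cosD sinD; apply/eqP; rewrite eq_complex /= !eqxx /= addrC [X in X + _]mulrC [X in _ + X]mulrC. Qed.

Lemma expiN t : expi (- t) = (expi t)^*.
Proof. by rewrite /expi cosN sinN. Qed.

Lemma expiNK t : expi (- t) * expi t = 1.
Proof. by rewrite -expiD addNr expi0. Qed.

Lemma expi_neq0 t : expi t != 0.
Proof. by apply: contraTneq (oner_neq0 R[i]) => t0; rewrite -(expiNK t) t0 mulr0 eqxx. Qed.

End ExpI.

Section CellSolutions.
Variables (R : realType) (m : nat) (Q : chain_graph R m).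

Definition cedge : Type := (iedge Q + 'I_m)%type.
HB.instance Definition _ := Finite.on cedge.

Definition csource (d : cedge) : vert Q :=
  match d with inl i => isrc i | inr c => csrc Q c end.
Definition ctarget (d : cedge) : vert Q :=
  match d with inl i => itgt i | inr c => ctgt Q c end.
Definition cshift (d : cedge) : int := if d is inr _ then 1 else 0.
Definition twist (k : R) (d : cedge) : R[i] := expi (k * (cshift d)%:~R).

(** A vertex sum ranges over the infinite edge set of G but meets each orbit of edges at most once,
    in the copy [h d]. *)
Lemma fsum_cell (P : pred cedge) (h : cedge -> int) (F : gedge Q -> R[i]) :
  \sum_(e \in [set e : gedge Q | P e.1 /\ e.2 = h e.1]) F e =
  \sum_(d | P d) F (d, h d).
Proof.
pose r : seq (gedge Q) := [seq (d, h d) | d <- enum P].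
have rE e : (e \in r) = (P e.1) && (e.2 == h e.1).
  apply/mapP/andP => [[d]|[Pe he]].
    by rewrite mem_enum => Pd -> /=; split.
  by exists e.1; rewrite ?mem_enum // -(eqP he); case: e {Pe he}.
rewrite (@fsbigE _ _ _ _ _ r).
- rewrite big_map big_enum_cond /=; apply: eq_bigl => d.
  by apply/andP/idP => [[]//|Pd]; split=> //; apply/mem_set; split.
- by rewrite map_inj_uniq ?enum_uniq // => d d' [].
- by move=> e /=; rewrite rE => /andP[? /eqP].
by move=> e /= [Pe he]; rewrite rE Pe he eqxx.
Qed.


Lemma origin_set (w : vert Q) (j : int) :
  [set e : gedge Q | origin e = (w, j)] =
  [set e : gedge Q | (csource e.1 == w) /\ e.2 = j].
Proof.
apply/seteqP; split=> -[[i|c] n]; rewrite /origin /=.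
- by move=> [<- <-].
- by move=> [<- <-].
- by move=> [/eqP <- ->].
- by move=> [/eqP <- ->].
Qed.

Lemma terminus_set (w : vert Q) (j : int) :
  [set e : gedge Q | terminus e = (w, j)] =
  [set e : gedge Q | (ctarget e.1 == w) /\ e.2 = j - cshift e.1].
Proof.
apply/seteqP; split=> -[[i|c] n]; rewrite /terminus /=.
- by move=> [<- <-]; rewrite subr0.
- by move=> [<- <-]; rewrite addrK.
- by move=> [/eqP <- ->]; rewrite subr0.
- by move=> [/eqP <- ->]; rewrite subrK.
Qed.

Lemma terminus_cell (d : cedge) (j : int) :
  terminus (d, j - cshift d) = (ctarget d, j) :> gvert Q.
Proof. by case: d => [i|c]; rewrite /terminus /= ?subr0 ?subrK. Qed.

Lemma origin_cell (d : cedge) (j : int) : origin (d, j) = (csource d, j) :> gvert Q.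
Proof. by case: d. Qed.

Variables (k mu : R).
Local Notation C t := (real_complex R (csol mu t)).
Local Notation S t := (real_complex R (ssol mu t)).
Local Notation mu' := (real_complex R mu).

Definition edge_val (u b : R[i]) (x : R) : R[i] := u * C x + b * S x.
Definition edge_slope (u b : R[i]) (x : R) : R[i] := - mu' * u * S x + b * C x.

(** Everything is referred to copy 0: [val] gives the vertex values there and [b] the slopes at the
    origins of the edges that start there. A connecting edge ends in copy 1, whence the phase in the
    end value; one that arrives in copy 0 starts in copy -1, whence the conjugate phase in the slope
    balance. *)
Record cell_solution (val : vert Q -> R[i]) (b : cedge -> R[i]) : Prop := CellSolution {
  cell_end : forall d, edge_val (val (csource d)) (b d) (len d) = twist k d * val (ctarget d);
  cell_kirchhoff : forall v, \sum_(d | csource d == v) b d =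
    \sum_(d | ctarget d == v) (twist k d)^* * edge_slope (val (csource d)) (b d) (len d) }.

Definition wave (val : vert Q -> R[i]) (b : cedge -> R[i]) : gfun Q :=
  fun e x => expi (k * e.2%:~R) * edge_val (val (csource e.1)) (b e.1) x.

(** [ssol] and its derivative [csol] have no common zero. At a point where [ssol] is nonzero the
    slope at the origin can be recovered from the value, even when [mu] is a Dirichlet eigenvalue of
    the edge. *)
Lemma ssol_neq0 (l : R) : 0 < l -> exists2 x, x \in `[0, l] & ssol mu x != 0.
Proof.
move=> l0; apply: contrapT => nS.
have S0 x : x \in `[0, l] -> ssol mu x = 0.
  by move=> xl; apply/eqP; apply: contrapT => /negP Sx; apply: nS; exists x.
have l2 : l / 2 \in `]0, l[ by rewrite in_itv /=; apply/andP; split; lra.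
have : is_derive (l / 2) 1 (ssol mu) 0.
  apply: (@near_eq_is_derive R R^o R^o (cst 0)).
    near=> y; rewrite S0 //; apply: subset_itv_oo_cc; near: y.
    exact: near_in_itvoo.
move=> d0; have := csol_ssol_sqr mu (l / 2).
have -> : csol mu (l / 2) = 0.
  have d1 := is_derive_ssol mu (l / 2).
  by rewrite -(@derive_val _ _ _ _ _ _ _ d1) (@derive_val _ _ _ _ _ _ _ d0).
rewrite S0 ?(subset_itv_oo_cc l2) // expr0n mulr0 addr0 => /eqP.
by rewrite eq_sym oner_eq0.
Unshelve. all: by end_near.
Qed.

Lemma H2_edge (l : R) (f f' f'' : R -> R[i]) : 0 < l -> H2 l f f' f'' ->
  (fun x => Complex mu 0 * f x) = (fun x => - f'' x) %[ae @lebesgue_measure R in `[0, l]%classic] ->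
  forall x, x \in `[0, l] ->
    f x = edge_val (f 0) (f' 0) x /\ f' x = edge_slope (f 0) (f' 0) x.
Proof.
move=> l0 [H2re H2im] eqf x xl.
have aeRe : {ae @lebesgue_measure R, forall x, `[0, l]%classic x ->
    mu * complex.Re (f x) = - complex.Re (f'' x)}.
  apply: filterS eqf; first exact: (ae_filter_ringOfSetsType (@lebesgue_measure R)).
  move=> y Hy yl; have := congr1 (@complex.Re R) (Hy yl).
  by case: (f y) => p q; case: (f'' y) => p' q' /=; rewrite mul0r subr0.
have aeIm : {ae @lebesgue_measure R, forall x, `[0, l]%classic x ->
    mu * complex.Im (f x) = - complex.Im (f'' x)}.
  apply: filterS eqf; first exact: (ae_filter_ringOfSetsType (@lebesgue_measure R)).
  move=> y Hy yl; have := congr1 (@complex.Im R) (Hy yl).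
  by case: (f y) => p q; case: (f'' y) => p' q' /=; rewrite mul0r addr0.
have [re re'] := H2_real_solution l0 H2re aeRe xl.
have [im im'] := H2_real_solution l0 H2im aeIm xl.
rewrite /edge_val /edge_slope; move: re re' im im'.
case: (f x) => p q; case: (f' x) => p' q'; case: (f 0) => p0 q0; case: (f' 0) => p1 q1 /=.
move=> -> -> -> ->; split; apply/eqP; rewrite eq_complex /=; apply/andP; split; apply/eqP; ring.
Qed.

Lemma edge_val_H2 (l : R) (a u b : R[i]) : 0 < l ->
  H2 l (fun x => a * edge_val u b x) (fun x => a * edge_slope u b x)
    (fun x => - mu' * (a * edge_val u b x)).
Proof.
move=> l0; have H (p q : R) := solution_H2_real mu p q l0.
move: a u b => [a1 a2] [u1 u2] [b1 b2]; split.
  have := H (a1 * u1 - a2 * u2) (a1 * b1 - a2 * b2).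
  congr H2_real; apply/funext => x; rewrite /edge_val /edge_slope /=; ring.
have := H (a1 * u2 + a2 * u1) (a1 * b2 + a2 * b1).
congr H2_real; apply/funext => x; rewrite /edge_val /edge_slope /=; ring.
Qed.

Lemma edge_val0 u b : edge_val u b 0 = u.
Proof. by rewrite /edge_val csol0 ssol0 !rmorph0 rmorph1 mulr1 mulr0 addr0. Qed.

Lemma edge_slope0 u b : edge_slope u b 0 = b.
Proof. by rewrite /edge_slope csol0 ssol0 !rmorph0 rmorph1 mulr1 mulr0 add0r. Qed.

Lemma in_itv0 (e : gedge Q) : 0 \in `[0, elen e].
Proof. by rewrite in_itv /= lexx ltW // len_gt0. Qed.

Lemma in_itv_len (e : gedge Q) : elen e \in `[0, elen e].
Proof. by rewrite in_itv /= lexx ltW // len_gt0. Qed.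

Lemma wave_eq0 val b : (forall e x, x \in `[0, elen e] -> wave val b e x = 0) ->
  forall d, val (csource d) = 0 /\ b d = 0.
Proof.
move=> w0 d; have w d0 x : x \in `[0, len d0] ->
    edge_val (val (csource d0)) (b d0) x = 0.
  by move=> xl; have := w0 (d0, 0) x xl; rewrite /wave /= mulr0 expi0 mul1r.
have v0 : val (csource d) = 0 by rewrite -[LHS](edge_val0 _ (b d)) w // (in_itv0 (d, 0)).
split=> //; have [x xl Sx] := ssol_neq0 (len_gt0 d).
have := w d x xl; rewrite /edge_val v0 mul0r add0r => /eqP.
rewrite mulf_eq0 => /orP[/eqP //|/eqP/(congr1 (@complex.Re R)) /= S0].
by rewrite S0 eqxx in Sx.
Qed.

Lemma twistE d (j : int) : expi (k * j%:~R) = twist k d * expi (k * (j - cshift d)%:~R).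
Proof. by rewrite /twist -expiD -mulrDr -intrD addrC subrK. Qed.

Lemma twistNE d (j : int) : expi (k * (j - cshift d)%:~R) = (twist k d)^* * expi (k * j%:~R).
Proof. by rewrite /twist -expiN -expiD -mulrN -mulrDr -intrN -intrD addrC. Qed.

Lemma cell_solution_eigenspace val b : cell_solution val b ->
  floquet_eigenspace k mu (wave val b).
Proof.
move=> [cend ckir].
exists (fun e x => expi (k * e.2%:~R) * edge_slope (val (csource e.1)) (b e.1) x).
exists (fun e x => - mu' * (expi (k * e.2%:~R) * edge_val (val (csource e.1)) (b e.1) x)).
split; last first.
  move=> e; apply: aeW => x _; rewrite /wave -[Complex mu 0]/mu'.
  by rewrite mulNr opprK.
split.
- by move=> e; apply: edge_val_H2; apply: len_gt0.
- move=> n e x _; rewrite /wave /= mulrA -expiD -mulrDr -intrD addrC //.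
- move=> [w j]; exists (expi (k * j%:~R) * val w); split=> -[d n].
    rewrite origin_cell => -[<- <-]; by rewrite /wave /= edge_val0.
  rewrite -[n](addrK (cshift d)); set i := n + cshift d.
  rewrite terminus_cell => -[<- <-]; rewrite /wave /elen /= cend (twistE d i).
  by rewrite mulrA [_ * twist k d]mulrC.
move=> [w j]; rewrite origin_set terminus_set.
rewrite (fsum_cell (fun d => csource d == w) (fun _ => j)).
rewrite (fsum_cell (fun d => ctarget d == w) (fun d => j - cshift d)) /=.
under eq_bigr do rewrite edge_slope0.
rewrite -mulr_sumr ckir mulr_sumr -sumrB big1 // => d _; rewrite /elen /=.
by rewrite twistNE mulrCA !mulrA subrr.
Qed.

Lemma eigenspace_cell_solution f : floquet_eigenspace k mu f ->
  exists val b, cell_solution val b /\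
    forall e x, x \in `[0, elen e] -> f e x = wave val b e x.
Proof.
move=> [f' [f'' [[fH2 fper fcont fkir] feig]]].
have fE e := H2_edge (len_gt0 e.1) (fH2 e) (feig e).
have fj d (j : int) x : x \in `[0, len d] -> f (d, j) x = expi (k * j%:~R) * f (d, 0) x.
  by move=> xl; rewrite -(fper j (d, 0)) // /shift_edge /= add0r.
(* [floquet] speaks of [f] only; the slopes inherit the phase because the values along the edge
   determine them. *)
have f'j d (j : int) : f' (d, j) 0 = expi (k * j%:~R) * f' (d, 0) 0.
  have [x xl Sx] := ssol_neq0 (len_gt0 d).
  have Sx' : S x != 0 by apply: contraNneq Sx => /(congr1 (@complex.Re R)) /= ->.
  have := fj d j x xl; rewrite (fE (d, j) x xl).1 (fE (d, 0) x xl).1 /edge_val.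
  rewrite (fj d j 0 (in_itv0 (d, 0))) mulrDr !mulrA => /addrI.
  by move=> /(mulIf Sx').
have [val0 Hval] := boolp.choice fcont.
pose val w := val0 (w, 0 : int); pose b d := f' (d, 0 : int) 0.
have f0 d : f (d, 0) 0 = val (csource d).
  by apply: (Hval _).1; rewrite origin_cell.
have fend d : f (d, 0) (len d) = twist k d * val (ctarget d).
  have <- : f (d, 0 - cshift d) (len d) = val (ctarget d).
    by apply: (Hval (ctarget d, 0)).2 (d, _) _; rewrite terminus_cell.
  rewrite [in RHS]fj ?(in_itv_len (d, 0)) // mulrA -twistE mulr0 expi0 mul1r //.
exists val, b; split.
  split=> [d|w]; first by rewrite -fend -f0 (fE (d, 0) _ (in_itv_len (d, 0))).1.
  have := fkir (w, 0); rewrite origin_set terminus_set.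
  rewrite (fsum_cell (fun d => csource d == w) (fun _ => 0)).
  rewrite (fsum_cell (fun d => ctarget d == w) (fun d => 0 - cshift d)) /=.
  move=> /eqP; rewrite subr_eq0 => /eqP ->; apply: eq_bigr => d _.
  rewrite (fE _ _ (in_itv_len (d, 0 - cshift d))).2 f'j fj ?(in_itv0 (d, 0)) //.
  have := twistNE d 0; rewrite mulr0 expi0 mulr1 => <-.
  by rewrite f0 /edge_slope /elen -[f' (d, 0) 0]/(b d) /=; ring.
move=> [d j] x xl; rewrite /wave /= -f0 fj // (fE (d, 0) x xl).1 //.
Qed.

End CellSolutions.

(** * The discretized quadratic form *)

Section EdgeSteps.
Variables (R : realType) (mu : R).
Local Notation C t := (real_complex R (csol mu t)).
Local Notation S t := (real_complex R (ssol mu t)).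

Lemma edge_step u b (x h : R) : 0 <= x -> 0 <= h ->
  edge_val mu u b (x + h) = edge_val mu (edge_val mu u b x) (edge_slope mu u b x) h /\
  edge_slope mu u b (x + h) = edge_slope mu (edge_val mu u b x) (edge_slope mu u b x) h.
Proof.
move=> x0 h0; have [Ch Sh] := solution_shift mu x0 h0.
rewrite /edge_val /edge_slope Ch Sh !(rmorphB, rmorphD, rmorphM) /=.
by split; ring.
Qed.

Lemma edge_val_jump (u v : R[i]) h : ssol mu h != 0 ->
  edge_val mu u ((v - u * C h) / S h) h = v.
Proof.
move=> Sh; have S0 : S h != 0 by apply: contraNneq Sh => /(congr1 (@complex.Re R)) /= ->.
by rewrite /edge_val; field.
Qed.

Lemma edge_slope_jump (u v : R[i]) h : ssol mu h != 0 ->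
  edge_slope mu u ((v - u * C h) / S h) h = (C h * v - u) / S h.
Proof.
move=> Sh; have S0 : S h != 0 by apply: contraNneq Sh => /(congr1 (@complex.Re R)) /= ->.
have CS : C h ^+ 2 + real_complex R mu * S h ^+ 2 = 1.
  by rewrite -!rmorphXn -rmorphM -rmorphD csol_ssol_sqr rmorph1.
apply: (mulIf S0); rewrite divfK // /edge_slope mulrDl.
transitivity (C h * v - u * (C h ^+ 2 + real_complex R mu * S h ^+ 2)); first by field.
by rewrite CS mulr1.
Qed.

End EdgeSteps.

Section Grid.
Variables (R : realType) (m : nat) (Q : chain_graph R m) (k M : R) (n : nat).
Local Notation node := (vert Q + cedge Q * 'I_n.+2)%type.
Local Notation piece := (cedge Q * 'I_n.+2)%type.

(* The [i]-th cut point of [d].  The nodes [inr (d, 0)] stay unused: the two ends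
   of [d] are vertices. *)
Definition mark (d : cedge Q) (i : nat) : node :=
  if i == 0 then inl (csource d)
  else if (i < n.+2)%N then inr (d, inord i) else inl (ctarget d).

Definition pstart (q : piece) : node := mark q.1 q.2.
Definition pend (q : piece) : node := mark q.1 q.2.+1.
(** The phase of an edge sits on its last piece alone, so that with one connecting edge a single
    piece depends on [k]. *)
Definition ptwist (q : piece) : R[i] := if q.2 == ord_max then twist k q.1 else 1.
Definition plen (q : piece) : R := len q.1 / n.+2%:R.
Definition isolated (t : node) := [forall q, (pstart q != t) && (pend q != t)].

Lemma pstart_vert q v : (pstart q == inl v) = (q.2 == ord0) && (csource q.1 == v).
Proof.
rewrite /pstart /mark -val_eqE /=; case: q => d i /=.
by have [//|_] := eqVneq (i : nat) 0%N; rewrite ltn_ord.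
Qed.

Lemma pend_vert q v : (pend q == inl v) = (q.2 == ord_max) && (ctarget q.1 == v).
Proof.
rewrite /pend /mark -val_eqE /=; case: q => d i /=.
have := ltn_ord i; rewrite !ltnS; case: ltngtP => // [iln|->] _; last by rewrite ltnn.
by rewrite -ltnS iln.
Qed.

Lemma pstart_inner q d (i : 'I_n.+2) : i != ord0 -> (pstart q == inr (d, i)) = (q == (d, i)).
Proof.
rewrite -val_eqE /= => i0; rewrite /pstart /mark; case: q => d' j /=.
rewrite ltn_ord; have [j0|j0] := eqVneq (j : nat) 0%N.
  by apply/esym/eqP => -[_ ji]; rewrite -ji j0 eqxx in i0.
by rewrite inord_val.
Qed.

Lemma pend_inner q d (i : 'I_n.+2) (j : 'I_n.+2) : i = j.+1 :> nat ->
  (pend q == inr (d, i)) = (q == (d, j)).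
Proof.
move=> ij; rewrite /pend /mark; case: q => d' l /=.
case: ltnP => [ln|nl].
  apply/eqP/eqP => [[-> li]|[-> ->]]; last by congr (inr (_, _)); apply/val_inj; rewrite /= inordK -ij ?ltn_ord.
  by congr (_, _); apply/val_inj => /=; move: (congr1 val li); rewrite /= inordK // ij => -[].
apply/esym/eqP => -[_ lj]; have := ltn_ord i; rewrite ij -lj; lia.
Qed.

Lemma isolated_inner0 d : isolated (inr (d, ord0)).
Proof.
apply/forallP => -[d' l]; rewrite /pstart /pend /mark /=; apply/andP; split.
  have [//|l0] := eqVneq (l : nat) 0%N; rewrite ltn_ord inord_val.
  by apply/eqP => -[_ l1]; rewrite l1 in l0.
case: ltnP => // ln; apply/eqP => -[_ /(congr1 val)] /=; rewrite inordK //.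
Qed.

Lemma sum_pstart_vert (F : piece -> R[i]) v :
  \sum_(q | pstart q == inl v) F q = \sum_(d | csource d == v) F (d, ord0).
Proof.
rewrite (reindex_onto (fun d => (d, ord0)) fst) /=; last first.
  by move=> [d i]; rewrite pstart_vert => /andP[/eqP /= ->].
by apply: eq_bigl => d; rewrite pstart_vert !eqxx andbT.
Qed.

Lemma sum_pend_vert (F : piece -> R[i]) v :
  \sum_(q | pend q == inl v) F q = \sum_(d | ctarget d == v) F (d, ord_max).
Proof.
rewrite (reindex_onto (fun d => (d, ord_max)) fst) /=; last first.
  by move=> [d i]; rewrite pend_vert => /andP[/eqP /= ->].
by apply: eq_bigl => d; rewrite pend_vert !eqxx andbT.
Qed.

Lemma ptwist_conj q : ptwist q * (ptwist q)^* = 1.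
Proof.
rewrite /ptwist; case: ifP => _; last by rewrite rmorph1 mulr1.
by rewrite /twist -expiN mulrC expiNK.
Qed.

(* On a piece of length h with end values u and v, int |f'|^2 - mu |f|^2 equals
   (C - 1) / (2 S) |u + v|^2 + (C + 1) / (2 S) |u - v|^2, where C and S are taken
   at h.  A node that lies on no piece carries the term (M - mu) |y|^2, which
   keeps the form strictly decreasing without adding to the kernel. *)
Definition col_vec (t : node) (j : piece + piece + node) : R[i] :=
  match j with
  | inl (inl q) => (t == pstart q)%:R + ptwist q * (t == pend q)%:R
  | inl (inr q) => (t == pstart q)%:R - ptwist q * (t == pend q)%:R
  | inr s => ((t == s) && isolated t)%:R
  end.

Definition col_coef (mu : R) (j : piece + piece + node) : R :=
  match j with
  | inl (inl q) => coef_sum mu (plen q)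
  | inl (inr q) => coef_diff mu (plen q)
  | inr s => M - mu
  end.

Definition grid_mx : 'M[R[i]]_(#|{: node}|, #|{: piece + piece + node}|) :=
  \matrix_(i, j) col_vec (enum_val i) (enum_val j).

Definition grid_pencil : R -> 'M[R[i]]_(#|{: node}|) :=
  gram_pencil grid_mx (fun mu j => col_coef mu (enum_val j)).

Definition node_val (x : 'rV[R[i]]_(#|{: node}|)) (t : node) : R[i] := x 0 (enum_rank t).

Definition col_val (y : node -> R[i]) (j : piece + piece + node) : R[i] :=
  match j with
  | inl (inl q) => y (pstart q) + ptwist q * y (pend q)
  | inl (inr q) => y (pstart q) - ptwist q * y (pend q)
  | inr s => (isolated s)%:R * y s
  end.

Lemma sum_delta (y : node -> R[i]) s : \sum_t y t * (t == s)%:R = y s.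
Proof.
rewrite (bigD1 s) //= eqxx mulr1 big1 ?addr0 // => t /negPf ->.
by rewrite mulr0.
Qed.

Lemma mul_grid_mx x j : (x *m grid_mx) 0 (enum_rank j) = col_val (node_val x) j.
Proof.
rewrite mxE (reindex enum_rank) /=; last by apply: onW_bij; exact: enum_rank_bij.
under eq_bigr do rewrite mxE !enum_rankK -/(node_val x _).
case: j => [[q|q]|s] /=.
- under eq_bigr do rewrite mulrDr mulrCA.
  by rewrite big_split /= -mulr_sumr !sum_delta.
- under eq_bigr do rewrite mulrBr mulrCA.
  by rewrite sumrB -mulr_sumr !sum_delta.
rewrite (bigD1 s) //= eqxx mulrC big1 ?addr0 // => t /negPf ->.
by rewrite mulr0.
Qed.

(** The two columns of a piece vanish together only if both end values do, the phase being
    invertible; an isolated node has a column of its own. *)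
Lemma grid_mx_free : row_free grid_mx.
Proof.
rewrite -kermx_eq0; apply/rowV0P => x /sub_kermxP xW.
have cv j : col_val (node_val x) j = 0 by rewrite -mul_grid_mx xW mxE.
apply/rowP => i; rewrite mxE -(enum_valK i) -/(node_val x _).
set t := enum_val i; have [It|/forallPn[q]] := boolP (isolated t).
  by have := cv (inr t); rewrite /= It mul1r.
rewrite negb_and !negbK.
have /= h1 := cv (inl (inl q)); have /= h2 := cv (inl (inr q)).
have ys : node_val x (pstart q) = 0.
  apply: (@mulfI _ 2); first by rewrite pnatr_eq0.
  by rewrite mulr0 -[RHS](addr0 0) -{1}h1 -h2; ring.
rewrite ys add0r in h1; have ye : node_val x (pend q) = 0.
  by rewrite -[LHS]mul1r -(ptwist_conj q) mulrAC h1 mul0r.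
by move=> /orP[/eqP<-|/eqP<-].
Qed.

Variable mu : R.
Local Notation C t := (real_complex R (csol mu t)).
Local Notation S t := (real_complex R (ssol mu t)).

(** With [slope_end], the slopes at the two ends of the solution on a piece that takes the values
    [y (pstart q)] and [ptwist q * y (pend q)] there. *)
Definition slope_start (y : node -> R[i]) (q : piece) : R[i] :=
  (ptwist q * y (pend q) - y (pstart q) * C (plen q)) / S (plen q).
Definition slope_end (y : node -> R[i]) (q : piece) : R[i] :=
  (C (plen q) * (ptwist q * y (pend q)) - y (pstart q)) / S (plen q).

(** The Kirchhoff defect at a node. At an inner cut point its vanishing means that the derivative is
    continuous; at an isolated node only the last term remains. *)
Definition residual (y : node -> R[i]) (t : node) : R[i] :=
  - (\sum_(q | pstart q == t) slope_start y q)
  + \sum_(q | pend q == t) (ptwist q)^* * slope_end y q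
  + (isolated t)%:R * real_complex R (M - mu) * y t.

Hypothesis S_neq0 : forall q, ssol mu (plen q) != 0.

Lemma sum_column (F : piece + piece + node -> R[i]) :
  \sum_j F j = \sum_q (F (inl (inl q)) + F (inl (inr q))) + \sum_s F (inr s).
Proof.
rewrite big_sumType /= big_sumType /=; congr (_ + _).
by rewrite big_split.
Qed.

(** A discrete Green formula: on solutions the energy form reduces to boundary terms, so each row of
    the kernel equation is the slope balance at one node. *)
Lemma mul_grid_pencil x t :
  (x *m grid_pencil mu) 0 (enum_rank t) = residual (node_val x) t.
Proof.
have XE := mul_grid_mx x; rewrite /grid_pencil /gram_pencil !mulmxA.
move: XE; set X := x *m grid_mx; move: X => X XE.
rewrite mul_mx_diag mxE (reindex enum_rank) /=; last by apply: onW_bij; exact: enum_rank_bij.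
under eq_bigr do rewrite !mxE XE !enum_rankK.
rewrite sum_column /residual; congr (_ + _).
  rewrite -sumrN [X in _ = X + _]big_mkcond [X in _ = _ + X]big_mkcond -big_split /=; apply: eq_bigr => q _.
  have Sq : S (plen q) != 0.
    by apply: contraNneq (S_neq0 q) => /(congr1 (@complex.Re R)) /= ->.
  have cs : real_complex R (coef_sum mu (plen q)) = (C (plen q) - 1) / (2 * S (plen q)).
    by rewrite /coef_sum !(fmorph_div, rmorphB, rmorphM, rmorph1, rmorph_nat).
  have cd : real_complex R (coef_diff mu (plen q)) = (C (plen q) + 1) / (2 * S (plen q)).
    by rewrite /coef_diff !(fmorph_div, rmorphD, rmorphM, rmorph1, rmorph_nat).
  rewrite cs cd /slope_start /slope_end rmorphD rmorphB !rmorphM !rmorph_nat ![t == _]eq_sym.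
  by case: (pstart q == t); case: (pend q == t) => /=; field.
rewrite (bigD1 t) //= eqxx rmorph_nat big1 ?addr0 => [|s st].
  by case: (isolated t); rewrite /= ?mul1r ?mulr1 ?mul0r // mulrC.
by rewrite eq_sym (negPf st) rmorph0 mulr0.
Qed.

Lemma ker_grid_pencil x :
  (x <= kermx (grid_pencil mu))%MS <-> forall t, residual (node_val x) t = 0.
Proof.
rewrite sub_kermx; split=> [/eqP xH t|r0].
  by rewrite -mul_grid_pencil xH mxE.
by apply/eqP/rowP => i; rewrite -(enum_valK i) mul_grid_pencil r0 mxE.
Qed.


Lemma plen_gt0 q : 0 < plen q.
Proof. by rewrite divr_gt0 ?len_gt0 ?ltr0n. Qed.

Lemma edge_step_slope y q :
  edge_val mu (y (pstart q)) (slope_start y q) (plen q) = ptwist q * y (pend q) /\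
  edge_slope mu (y (pstart q)) (slope_start y q) (plen q) = slope_end y q.
Proof. by rewrite edge_val_jump ?edge_slope_jump. Qed.

Lemma markS d (i : nat) : (i < n.+2)%N ->
  pstart (d, inord i) = mark d i /\ pend (d, inord i) = mark d i.+1.
Proof. by move=> i_n; rewrite /pstart /pend /= inordK. Qed.

Lemma ptwist_inner d (i : nat) : (i.+1 < n.+2)%N -> ptwist (d, inord i) = 1.
Proof.
move=> i_n; rewrite /ptwist -val_eqE /= inordK; last exact: ltnW.
by rewrite -ltnS in i_n; case: eqP => // iE; rewrite iE ltnn in i_n.
Qed.

Lemma not_isolated_start q : isolated (pstart q) = false.
Proof. by apply/negbTE/forallPn; exists q; rewrite eqxx. Qed.

Lemma not_isolated_end q : isolated (pend q) = false.
Proof. by apply/negbTE/forallPn; exists q; rewrite eqxx andbF. Qed.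

Lemma residual_inner y d (i : nat) : (i.+1 < n.+2)%N ->
  residual y (inr (d, inord i.+1)) = slope_end y (d, inord i) - slope_start y (d, inord i.+1).
Proof.
move=> i_n; have i_n' := ltnW i_n.
have i0 : inord i.+1 != ord0 :> 'I_n.+2 by rewrite -val_eqE /= inordK.
rewrite /residual (big_pred1 (d, inord i.+1)); last by move=> q; rewrite /= pstart_inner.
rewrite (big_pred1 (d, inord i)) => [|q]; last first.
  by rewrite /= (@pend_inner _ d _ (inord i)) // !inordK.
rewrite ptwist_inner // rmorph1 mul1r.
have /eqP st : pstart (d, inord i.+1) == inr (d, inord i.+1) by rewrite pstart_inner.
by have := not_isolated_start (d, inord i.+1); rewrite st => ->; rewrite !mul0r addr0 addrC.
Qed.

Lemma residual_vert y v : ~~ isolated (inl v) -> residual y (inl v) =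
  \sum_(d | ctarget d == v) (twist k d)^* * slope_end y (d, ord_max)
  - \sum_(d | csource d == v) slope_start y (d, ord0).
Proof.
move=> /negPf Iv; rewrite /residual Iv !mul0r addr0 sum_pstart_vert sum_pend_vert addrC.
by congr (_ - _); apply: eq_bigr => d _; rewrite /ptwist eqxx.
Qed.

Definition grid_source (y : node -> R[i]) (v : vert Q) : R[i] := y (inl v).
Definition grid_slope (y : node -> R[i]) (d : cedge Q) : R[i] := slope_start y (d, ord0).

Section Propagation.
Variable y : node -> R[i].
Hypothesis y0 : forall t, residual y t = 0.

(** Vanishing residuals at the cut points glue the solutions on successive pieces into one solution
    along the edge. *)
Lemma propagate d (i : nat) : (i < n.+2)%N ->
  edge_val mu (y (inl (csource d))) (grid_slope y d) (i%:R * plen (d, ord0)) = y (mark d i) /\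
  edge_slope mu (y (inl (csource d))) (grid_slope y d) (i%:R * plen (d, ord0)) =
    slope_start y (d, inord i).
Proof.
elim: i => [_|i IH i_n].
  rewrite mul0r edge_val0 edge_slope0; split=> //; rewrite /grid_slope.
  by congr (slope_start y (d, _)); apply/val_inj; rewrite /= inordK.
have [IHv IHs] := IH (ltnW i_n).
have h0 := plen_gt0 (d, ord0).
have [] := edge_step mu (y (inl (csource d))) (grid_slope y d)
  (mulr_ge0 (ler0n _ i) (ltW h0)) (ltW h0).
have -> : i%:R * plen (d, ord0) + plen (d, ord0) = i.+1%:R * plen (d, ord0).
  by rewrite -natr1 mulrDl mul1r.
have [st en] := markS d (ltnW i_n).
have [v' s'] := edge_step_slope y (d, inord i).
rewrite IHv IHs -st -[plen (d, ord0)]/(plen (d, inord i)) v' s' => -> ->; split.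
  by rewrite ptwist_inner // mul1r en.
have := y0 (inr (d, inord i.+1)); rewrite residual_inner // => /eqP.
by rewrite subr_eq0 => /eqP.
Qed.

Lemma propagate_end d :
  edge_val mu (y (inl (csource d))) (grid_slope y d) (len d) = twist k d * y (inl (ctarget d)) /\
  edge_slope mu (y (inl (csource d))) (grid_slope y d) (len d) = slope_end y (d, ord_max).
Proof.
have [Pv Ps] := propagate d (ltnSn n.+1).
have h0 := plen_gt0 (d, ord0).
have [] := edge_step mu (y (inl (csource d))) (grid_slope y d)
  (mulr_ge0 (ler0n _ n.+1) (ltW h0)) (ltW h0).
have -> : n.+1%:R * plen (d, ord0) + plen (d, ord0) = len d.
  rewrite -{2}(mul1r (plen _)) -mulrDl natr1 /plen /= mulrCA divff ?mulr1 ?pnatr_eq0 //.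
have [st en] := markS d (ltnSn n.+1).
have [v' s'] := edge_step_slope y (d, inord n.+1).
rewrite Pv Ps -st -[plen (d, ord0)]/(plen (d, inord n.+1)) v' s' => -> ->.
have -> : inord n.+1 = ord_max :> 'I_n.+2 by apply/val_inj; rewrite /= inordK.
by rewrite /ptwist /pend /mark /= ltnn eqxx.
Qed.

Lemma residual_cell_solution : cell_solution k mu (grid_source y) (grid_slope y).
Proof.
split=> [d|v]; first by rewrite (propagate_end d).1.
have [Iv|Iv] := boolP (isolated (inl v)).
  rewrite !big_pred0 // => d; apply: contraTF Iv => /eqP dv; apply/forallPn.
    by exists (d, ord_max); rewrite (_ : pend _ == inl v) ?andbF // pend_vert dv !eqxx.
  by exists (d, ord0); rewrite (_ : pstart _ == inl v) // pstart_vert dv !eqxx.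
have := y0 (inl v); rewrite residual_vert // => /eqP; rewrite subr_eq0 => /eqP.
rewrite /grid_slope => <-; apply: eq_bigr => d _.
by rewrite (propagate_end d).2.
Qed.

(** Node values can be read off the wave, except at isolated nodes, where the coefficient [M - mu]
    forces the value 0. *)
Lemma residual_zero :
  (forall e x, x \in `[0, elen e] -> wave k mu (grid_source y) (grid_slope y) e x = 0) ->
  real_complex R (M - mu) != 0 -> forall t, y t = 0.
Proof.
move=> /wave_eq0 w0 Mmu t; have [It|/forallPn[q]] := boolP (isolated t).
  have := y0 t; rewrite /residual It mul1r.
  rewrite !big_pred0 ?oppr0 ?add0r => [/eqP|q|q]; last 2 first.
  - by apply: contraTF It => /eqP <-; rewrite not_isolated_end.
  - by apply: contraTF It => /eqP <-; rewrite not_isolated_start.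
  by rewrite mulf_eq0 (negPf Mmu) => /eqP.
have start0 p : y (pstart p) = 0.
  case: p => d i; have [] := propagate d (ltn_ord i); have [] := w0 d.
  rewrite /grid_source => -> ->.
  by rewrite /edge_val !mul0r addr0 => <-.
rewrite negb_and !negbK => /orP[/eqP<-|/eqP<-]; first exact: start0.
case: q => d i; rewrite /pend /=; have [lti|gei] := ltnP i.+1 n.+2.
  by rewrite -(markS d lti).1 start0.
rewrite /mark ltnNge gei /=; apply/eqP.
have := (propagate_end d).1; have [] := w0 d; rewrite /grid_source => -> ->.
rewrite /edge_val !mul0r addr0 => /esym/eqP; rewrite mulf_eq0.
by rewrite /twist (negPf (expi_neq0 _)).
Qed.

End Propagation.

Lemma cell_solution_residual val b : cell_solution k mu val b ->
  exists2 y, (forall t, residual y t = 0) &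
    forall e x, wave k mu (grid_source y) (grid_slope y) e x = wave k mu val b e x.
Proof.
move=> [cend ckir].
pose g d (i : nat) := edge_val mu (val (csource d)) (b d) (i%:R * plen (d, ord0)).
pose g' d (i : nat) := edge_slope mu (val (csource d)) (b d) (i%:R * plen (d, ord0)).
(* The solution is sampled at the cut points. Isolated nodes receive the value 0, as their residual
   demands; no edge sees it. *)
pose y (t : node) : R[i] := if isolated t then 0 else
  match t with inl v => val v | inr (d, i) => g d i end.
have ystart q : y (pstart q) = g q.1 q.2.
  rewrite /y not_isolated_start /pstart /mark; case: q => d i /=.
  have [->|i0] := eqVneq (i : nat) 0%N; first by rewrite /g mul0r edge_val0.
  by rewrite ltn_ord inord_val.
have gend d : g d n.+2 = twist k d * val (ctarget d).
  by rewrite -cend /g /plen /= mulrCA divff ?mulr1 ?pnatr_eq0.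
have yend q : ptwist q * y (pend q) = g q.1 q.2.+1.
  rewrite /y not_isolated_end /pend /mark; case: q => d i /=.
  rewrite /ptwist -val_eqE /=; have [lti|gei] := ltnP i.+1 n.+2.
    by rewrite inordK // ltn_eqF ?mul1r.
  have ie : i = n.+1 :> nat by apply/eqP; rewrite eqn_leq -ltnS ltn_ord.
  by rewrite ie eqxx gend.
have step (q : piece) : g q.1 q.2.+1 = edge_val mu (g q.1 q.2) (g' q.1 q.2) (plen q) /\
    g' q.1 q.2.+1 = edge_slope mu (g q.1 q.2) (g' q.1 q.2) (plen q).
  have h0 := plen_gt0 q; rewrite /g /g' -natr1 mulrDl mul1r.
  exact: edge_step (mulr_ge0 (ler0n _ _) (ltW h0)) (ltW h0).
have S0 q : S (plen q) != 0.
  by apply: contraNneq (S_neq0 q) => /(congr1 (@complex.Re R)) /= ->.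
have ss q : slope_start y q = g' q.1 q.2.
  rewrite /slope_start yend ystart (step q).1 /edge_val.
  by rewrite addrAC subrr add0r mulfK.
have se q : slope_end y q = g' q.1 q.2.+1.
  by rewrite -(edge_step_slope y q).2 ystart ss (step q).2.
exists y; last first.
  move=> e x; rewrite /wave /grid_source /grid_slope ss /g' /= mul0r edge_slope0.
  have /= := ystart (e.1, ord0); rewrite /pstart /mark /= => ->.
  by rewrite /g mul0r edge_val0.
case=> [v|[d i]].
  have [Iv|Iv] := boolP (isolated (inl v)); last first.
    rewrite residual_vert //; apply/eqP; rewrite subr_eq0; apply/eqP.
    under eq_bigr do rewrite se /=.
    under [RHS]eq_bigr do rewrite ss /g' /= mul0r edge_slope0.
    rewrite ckir; apply: eq_bigr => d _; congr (_ * edge_slope _ _ _ _).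
    by rewrite /plen /= mulrCA divff ?mulr1 ?pnatr_eq0.
  rewrite /residual {3}/y Iv mulr0 addr0 !big_pred0 ?oppr0 ?addr0 // => q.
    by apply: contraTF Iv => /eqP <-; rewrite not_isolated_end.
  by apply: contraTF Iv => /eqP <-; rewrite not_isolated_start.
have [->|i0] := eqVneq i ord0.
  have Iv := isolated_inner0 d.
  rewrite /residual {3}/y Iv mulr0 addr0 !big_pred0 ?oppr0 ?addr0 // => q.
    by apply: contraTF Iv => /eqP <-; rewrite not_isolated_end.
  by apply: contraTF Iv => /eqP <-; rewrite not_isolated_start.
have i_gt0 : (0 < i)%N by rewrite lt0n; apply: contra i0 => /eqP i0; apply/eqP/val_inj.
have lti : (i.-1.+1 < n.+2)%N by rewrite (prednK i_gt0).
have iE : i = inord i.-1.+1 by rewrite (prednK i_gt0) inord_val.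
rewrite [X in inr (d, X)]iE residual_inner // ss se /=.
by rewrite (inordK lti) (inordK (ltnW lti)) subrr.
Qed.

Definition grid_wave (x : 'rV[R[i]]_(#|{: node}|)) : gfun Q :=
  wave k mu (grid_source (node_val x)) (grid_slope (node_val x)).

Lemma grid_waveD x x' e t : grid_wave (x + x') e t = grid_wave x e t + grid_wave x' e t.
Proof.
rewrite /grid_wave /wave /edge_val /grid_source /grid_slope /slope_start /node_val !mxE.
by ring.
Qed.

Lemma grid_waveZ a x e t : grid_wave (a *: x) e t = a * grid_wave x e t.
Proof.
rewrite /grid_wave /wave /edge_val /grid_source /grid_slope /slope_start /node_val !mxE.
by ring.
Qed.

Lemma grid_wave_mulmx N (c : 'rV[R[i]]_N) (X : 'M[R[i]]_(N, #|{: node}|)) e t :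
  grid_wave (c *m X) e t = \sum_i c 0 i * grid_wave (row i X) e t.
Proof.
have w0 : grid_wave 0 e t = 0 by rewrite -(scale0r 0) grid_waveZ mul0r.
rewrite mulmx_sum_row.
rewrite (big_morph (fun x => grid_wave x e t) (fun x x' => grid_waveD x x' e t) w0).
by apply: eq_bigr => i _; rewrite grid_waveZ.
Qed.

(** Kernel vectors have eigenfunctions as waves, every eigenfunction arises so, and the wave
    determines the vector. A basis of the eigenspace thus becomes a basis [X] of the kernel. *)
Lemma grid_nullity N : real_complex R (M - mu) != 0 ->
  eigenspace_dim Q k mu N -> N = nullity (grid_pencil mu).
Proof.
move=> Mmu [b [b_eig b_free b_span]].
have /boolp.choice[x Hx] : forall i, exists x : 'rV[R[i]]_(#|{: node}|),
    (x <= kermx (grid_pencil mu))%MS /\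
    forall e t, t \in `[0, elen e] -> b i e t = grid_wave x e t.
  move=> i; have [val [s [vs Hb]]] := eigenspace_cell_solution (b_eig i).
  have [y y0 wy] := cell_solution_residual vs.
  exists (\row_j y (enum_val j)).
  have yE : node_val (\row_j y (enum_val j)) = y.
    by apply/funext => t; rewrite /node_val mxE enum_rankK.
  split; first by apply/ker_grid_pencil; rewrite yE.
  by move=> e t te; rewrite Hb // /grid_wave yE wy.
pose X : 'M[R[i]]_(N, #|{: node}|) := \matrix_i x i.
have Xker : (X <= kermx (grid_pencil mu))%MS.
  by apply/row_subP => i; rewrite rowK (Hx i).1.
have bX (c : 'rV[R[i]]_N) e t : t \in `[0, elen e] ->
    \sum_i c 0 i * b i e t = grid_wave (c *m X) e t.
  move=> te; rewrite grid_wave_mulmx; apply: eq_bigr => i _.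
  by rewrite rowK (Hx i).2.
have Xfree : row_free X.
  rewrite -kermx_eq0; apply/rowV0P => c /sub_kermxP cX.
  apply/rowP => i; rewrite mxE; apply: (b_free (c 0)) => e t te.
  by rewrite bX // cX -(scale0r 0) grid_waveZ mul0r.
rewrite -(eqP Xfree) /nullity -mxrank_ker; apply/eqP.
rewrite eqn_leq mxrankS //=; apply: mxrankS; apply/rV_subP => z zker.
have wz : floquet_eigenspace k mu (grid_wave z).
  apply: cell_solution_eigenspace; apply: residual_cell_solution.
  exact/ker_grid_pencil.
have [c Hc] := b_span _ wz.
have -> : z = (\row_i c i) *m X; last exact: submxMl.
apply/eqP; rewrite -subr_eq0; set v := z - _.
have vker : (v <= kermx (grid_pencil mu))%MS.
  by rewrite addmx_sub // eqmx_opp (submx_trans (submxMl _ _)).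
apply/eqP/rowP => j; rewrite [RHS]mxE -(enum_valK j) -/(node_val v _).
apply: residual_zero Mmu _; first exact/ker_grid_pencil.
move=> e t te; rewrite -/(grid_wave v e t) grid_waveD -scaleN1r grid_waveZ.
rewrite Hc // -bX // mulN1r; apply/eqP; rewrite subr_eq0; apply/eqP.
by apply: eq_bigr => i _; rewrite mxE.
Qed.

End Grid.

(** The cofactors along row [i] do not involve the entry at [i], [j], so the determinant is affine
    in that entry. *)
Lemma det_add_delta (C : comNzRingType) n (A : 'M[C]_n) (i j : 'I_n) (b z : C) :
  \det (A + z *: (b *: delta_mx i j)) =
  (1 - z) * \det A + z * \det (A + b *: delta_mx i j).
Proof.
have cof (c : C) l : cofactor (A + c *: delta_mx i j) i l = cofactor A i l.
  rewrite /cofactor; congr (_ * \det _); apply/matrixP => p q; rewrite !mxE.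
  by rewrite [lift i p == i]eq_sym (negPf (neq_lift _ _)) mulr0 addr0.
have E c : \det (A + c *: delta_mx i j) = \det A + c * cofactor A i j.
  rewrite (expand_det_row _ i) (expand_det_row A i).
  rewrite (bigD1 j) //= [in RHS](bigD1 j) //= cof !mxE !eqxx mulr1.
  rewrite mulrDl -!addrA; congr (_ + _); rewrite addrC; congr (_ + _).
  by apply: eq_bigr => l lj; rewrite cof !mxE eqxx (negPf lj) mulr0 addr0.
by rewrite scalerA !E; ring.
Qed.

(** * Eigenvalues of the operator as singular points of the pencil *)

Section GridSpectrum.
Variables (R : realType) (m : nat) (Q : chain_graph R m) (k M : R) (n : nat).
Hypothesis M_gt0 : 0 < M.
Hypothesis fine_grid : forall q, Num.sqrt M * plen (Q := Q) (n := n) q < pi.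

Lemma fine_grid_lt mu q : mu < M -> Num.sqrt mu * plen (Q := Q) (n := n) q < pi.
Proof. by move=> muM; apply: sqrt_mul_lt_pi muM (plen_gt0 q) (fine_grid q). Qed.

Lemma grid_ssol_gt0 mu q : mu < M -> 0 < ssol mu (plen (Q := Q) (n := n) q).
Proof. by move=> muM; apply: ssol_gt0 (plen_gt0 q) (fine_grid_lt q muM). Qed.

Lemma grid_pencil_decreasing : decreasing_pencil M (grid_pencil Q k M n).
Proof.
apply: gram_pencil_decreasing; first exact: grid_mx_free.
  move=> s t j s0 st tM; case: (enum_val j) => [[q|q]|u] /=.
  - exact: (coef_sum_decreasing (plen_gt0 q) (fine_grid q)).
  - exact: (coef_diff_decreasing (plen_gt0 q) (fine_grid q)).
  - by rewrite ltrD2l ltrN2.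
move=> t e j t0 tM e0; case: (enum_val j) => [[q|q]|u] /=.
- exact: (coef_sum_continuous (plen_gt0 q) (fine_grid q)).
- exact: (coef_diff_continuous (plen_gt0 q) (fine_grid q)).
exists e => // s _ _; have -> : M - s - (M - t) = - (s - t) by ring.
by rewrite normrN.
Qed.

(** At energy 0 the weights [coef_sum] vanish and the others are nonnegative: the form is the
    Dirichlet integral plus the terms of isolated nodes. *)
Lemma grid_pencil_index0 : neg_index (grid_pencil Q k M n 0) = 0%N.
Proof.
apply: neg_index_eq0; first exact: gram_pencil_hermsym.
move=> x; rewrite hform_gram_pencil; apply: sumr_ge0 => j _.
rewrite mulr_ge0 ?exprn_ge0 // lecR; case: (enum_val j) => [[q|q]|u] /=.
- by rewrite /coef_sum /csol ltxx eqxx subrr mul0r.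
- rewrite /coef_diff divr_ge0 ?mulr_ge0 ?(ltW (grid_ssol_gt0 q M_gt0)) //.
  by rewrite /csol ltxx eqxx.
by rewrite subr0 ltW.
Qed.

(** Below energy 0 the inequality [1 < csol] makes all weights positive; this rules out negative
    eigenvalues. *)
Lemma grid_pencil_neg mu : mu < 0 -> nullity (grid_pencil Q k M n mu) = 0%N.
Proof.
move=> mu0; have muM := lt_trans mu0 M_gt0.
apply: nullity_eq0 => x /(gram_coord_neq0 (grid_mx_free Q k n))[j xj].
rewrite hform_gram_pencil.
have a0 i : 0 < col_coef M mu (enum_val i : _ + _ + (vert Q + cedge Q * 'I_n.+2)).
  case: (enum_val i) => [[q|q]|u] /=.
  - have C1 := csol_neg_gt1 mu0 (plen_gt0 q).
    by rewrite divr_gt0 ?mulr_gt0 ?grid_ssol_gt0 //; lra.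
  - have C1 := csol_neg_gt1 mu0 (plen_gt0 q).
    by rewrite divr_gt0 ?mulr_gt0 ?grid_ssol_gt0 //; lra.
  by rewrite subr_gt0.
rewrite (bigD1 j) //= ltr_pwDl //.
  by rewrite mulr_gt0 ?ltcR ?exprn_gt0 ?normr_gt0.
by apply: sumr_ge0 => i _; rewrite mulr_ge0 ?exprn_ge0 // lecR ltW.
Qed.

Lemma grid_spectrum s : eigenvalue_sequence Q k s ->
  pencil_spectrum M (grid_pencil Q k M n) s.
Proof.
move=> [s_incr s_mult].
have mult mu : mu < M -> ([set j | s j = mu] #= `I_(nullity (grid_pencil Q k M n mu)))%card.
  move=> muM; have [N [dN cN]] := s_mult mu.
  rewrite -(grid_nullity _ _ dN) //.
    by move=> q; rewrite gt_eqF // grid_ssol_gt0.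
  by apply/eqP => /(congr1 (@complex.Re R)) /= /eqP; rewrite gt_eqF // subr_gt0.
split=> [j|//|mu _ muM]; last exact: mult.
rewrite leNgt; apply/negP => sj0; have := mult _ (lt_trans sj0 M_gt0).
by rewrite grid_pencil_neg // II0 card_eq0 => /eqP s0; suff : set0 j by []; rewrite -s0.
Qed.

End GridSpectrum.

(** The sum [L] bounds [Num.sqrt M * len d / pi] for all edges at once, and more than [L] pieces per
    edge bring every piece below [pi]. *)
Lemma fine_grid_exists (R : realType) m (Q : chain_graph R m) (M : R) :
  exists n, forall q, Num.sqrt M * plen (Q := Q) (n := n) q < pi.
Proof.
pose L := \sum_(d : cedge Q) Num.sqrt M * len d / pi.
exists (Num.truncn L) => -[d i]; rewrite /plen /= mulrA ltr_pdivrMr ?ltr0n //.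
have le_L : Num.sqrt M * len d / pi <= L.
  rewrite /L (bigD1 d) //= lerDl; apply: sumr_ge0 => e _.
  rewrite divr_ge0 ?pi_ge0 // mulr_ge0 ?sqrtr_ge0 //; exact: ltW (len_gt0 e).
rewrite ler_pdivrMr ?pi_gt0 // in le_L; apply: (le_lt_trans le_L).
rewrite mulrC ltr_pM2l ?pi_gt0 //; apply: (lt_trans (truncnS_gt L)).
by rewrite ltr_nat.
Qed.

(** * One connecting edge *)

Lemma expipi (R : realType) : expi pi = -1 :> R[i].
Proof. by rewrite /expi cospi sinpi; apply/eqP; rewrite eq_complex /= oppr0 !eqxx. Qed.

Section GridEntries.
Variables (R : realType) (m : nat) (Q : chain_graph R m) (M mu : R) (n : nat).
Local Notation node := (vert Q + cedge Q * 'I_n.+2)%type.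
Local Notation piece := (cedge Q * 'I_n.+2)%type.

Lemma grid_pencil_entry k (s t : node) :
  grid_pencil Q k M n mu (enum_rank s) (enum_rank t) =
  \sum_j col_vec k s j * real_complex R (col_coef M mu j) * (col_vec k t j)^*.
Proof.
rewrite /grid_pencil /gram_pencil mul_mx_diag mxE.
rewrite (reindex enum_rank) /=; last by apply: onW_bij; exact: enum_rank_bij.
by apply: eq_bigr => j _; rewrite !mxE !enum_rankK.
Qed.

Lemma ptwistN k q : ptwist (Q := Q) (n := n) (- k) q = (ptwist k q)^*.
Proof.
rewrite /ptwist; case: ifP => _; last by rewrite rmorph1.
by rewrite /twist mulNr expiN.
Qed.

(** The vectors for [- k] are conjugate to those for [k], and the weights are real. *)
Lemma grid_pencil_tr k : (grid_pencil Q k M n mu)^T = grid_pencil Q (- k) M n mu.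
Proof.
have cv (t : node) j : col_vec (- k) t j = (col_vec k t j)^*.
  case: j => [[q|q]|s] /=; last by rewrite rmorph_nat.
    by rewrite ptwistN rmorphD rmorphM !rmorph_nat.
  by rewrite ptwistN rmorphB rmorphM !rmorph_nat.
apply/matrixP => i j; rewrite mxE -(enum_valK i) -(enum_valK j) !grid_pencil_entry.
by apply: eq_bigr => l _; rewrite !cv conjCK; ring.
Qed.

End GridEntries.

Section SingleConnectingEdge.
Variables (R : realType) (Q : chain_graph R 1) (M : R) (n : nat).
Local Notation node := (vert Q + cedge Q * 'I_n.+2)%type.
Local Notation piece := (cedge Q * 'I_n.+2)%type.

Definition twisted_piece : piece := (inr ord0, ord_max).
Local Notation q0 := twisted_piece.

Lemma ptwist_single k (q : piece) : ptwist k q = if q == q0 then expi k else 1.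
Proof.
rewrite /ptwist /twist /twisted_piece; case: q => [[i|c] j]; rewrite xpair_eqE /=.
  by rewrite mulr0 expi0 if_same.
by rewrite !ord1 eqxx mulr1.
Qed.

(** The quasi-momentum only multiplies the value at the end of the twisted piece. *)
Lemma hform_hyperplane mu k l (x : 'rV[R[i]]_(#|{: node}|)) : x 0 (enum_rank (pend q0)) = 0 ->
  hform (grid_pencil Q k M n mu) x = hform (grid_pencil Q l M n mu) x.
Proof.
move=> x0; rewrite !hform_gram_pencil; apply: eq_bigr => i _.
rewrite -(enum_valK i) !mul_grid_mx; congr (_ * `|_| ^+ 2).
have yE (q : piece) : ptwist k q * node_val x (pend q) = ptwist l q * node_val x (pend q).
  by rewrite !ptwist_single; case: eqP => // ->; rewrite /node_val x0 !mulr0.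
by case: (enum_val i) => [[q|q]|s] //=; rewrite yE.
Qed.

(** This is [- 1 / S], the coupling between the two ends of the twisted piece. *)
Definition twist_entry mu : R[i] :=
  real_complex R (coef_sum mu (plen q0) - coef_diff mu (plen q0)).

Definition twist_mx : 'M[R[i]]_(#|{: node}|) :=
  delta_mx (enum_rank (pend q0)) (enum_rank (pstart q0)).

(** A phase of modulus one cancels in the diagonal contributions and affects only the two entries
    that couple the ends of the twisted piece. *)
Lemma grid_pencil_twist mu k : grid_pencil Q k M n mu = grid_pencil Q 0 M n mu
  + (expi k - 1) *: (twist_entry mu *: twist_mx)
  + (expi (- k) - 1) *: (twist_entry mu *: twist_mx^T).
Proof.
apply/matrixP => i j; rewrite -(enum_valK i) -(enum_valK j).
set s := enum_val i; set t := enum_val j.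
have := grid_pencil_entry M mu k s t; have := grid_pencil_entry M mu 0 s t.
move: (grid_pencil Q 0 M n mu) (grid_pencil Q k M n mu) => G0 Gk G0E GkE.
rewrite !mxE G0E GkE !(inj_eq enum_rank_inj) -addrA.
apply/eqP; rewrite addrC -subr_eq -sumrB; apply/eqP.
rewrite sum_column [X in _ + X]big1 ?addr0; last by move=> u _; rewrite subrr.
rewrite (bigD1 q0) //= [X in _ + X]big1 ?addr0; last first.
  by move=> q /negPf qq; rewrite !ptwist_single qq !subrr addr0.
have -> : twist_entry mu =
    real_complex R (coef_sum mu (plen q0)) - real_complex R (coef_diff mu (plen q0)).
  by rewrite -[RHS]rmorphB.
rewrite !ptwist_single eqxx expi0 !mul1r /=.
move: (real_complex R (coef_sum _ _)) (real_complex R (coef_diff _ _)) => a b.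
have z0 := expi_neq0 k; have wz := expiNK k; rewrite expiN in wz *.
move: (expi k) z0 wz => z z0 wz.
have zE : z^* = z^-1 by apply: (mulIf z0); rewrite wz mulVf.
rewrite !rmorphD !rmorphN !rmorphM !rmorph_nat /= zE ![_ == pend q0]eq_sym ![_ == pstart q0]eq_sym.
case: (pend q0 == s); case: (pend q0 == t); case: (pstart q0 == s); case: (pstart q0 == t);
  by rewrite /=; field.
Qed.

(* The determinant is affine in each of e^{ik} and e^{-ik}, and even in k since
   transposition changes k into -k. *)
Lemma det_grid_pencil mu k : \det (grid_pencil Q k M n mu) =
  real_complex R ((1 + cos k) / 2) * \det (grid_pencil Q 0 M n mu)
  + real_complex R ((1 - cos k) / 2) * \det (grid_pencil Q pi M n mu).
Proof.
pose E : 'M[R[i]]_(#|{: node}|) :=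
  twist_entry mu *: delta_mx (enum_rank (pend q0)) (enum_rank (pstart q0)).
pose E' : 'M[R[i]]_(#|{: node}|) :=
  twist_entry mu *: delta_mx (enum_rank (pstart q0)) (enum_rank (pend q0)).
(* The matrix with the coupling across the twisted piece removed. [P], [P1], [P2] and [P3] are the
   four corner values of a determinant affine in each of the two couplings. *)
pose B := grid_pencil Q 0 M n mu - E - E'.
pose P := \det B; pose P1 := \det (B + E'); pose P2 := \det (B + E).
pose P3 := \det (B + E + E').
have detE l : \det (grid_pencil Q l M n mu) =
    (1 - expi l) * ((1 - expi (- l)) * P + expi (- l) * P1)
    + expi l * ((1 - expi (- l)) * P2 + expi (- l) * P3).
  have -> : grid_pencil Q l M n mu = B + expi (- l) *: E' + expi l *: E.
    rewrite grid_pencil_twist /twist_mx trmx_delta /B !scalerBl !scale1r -/E -/E'.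
    by rewrite !addrA [LHS](ACl (1*3*5*4*2)).
  rewrite det_add_delta -/E; congr (_ * _ + _ * _).
    by rewrite /E' det_add_delta.
  by rewrite addrAC /E' det_add_delta.
have detN : \det (grid_pencil Q (- k) M n mu) = \det (grid_pencil Q k M n mu).
  by rewrite -grid_pencil_tr det_tr.
have d0 := detE 0; have dpi := detE pi; have dk := detE k; have dNk := detE (- k).
rewrite !(oppr0, expi0, subrr, mul0r, add0r, mul1r) in d0.
rewrite expiN !expipi rmorphN rmorph1 in dpi.
rewrite detN opprK in dNk.
apply: (@mulfI _ 2); first by rewrite pnatr_eq0.
have csum : expi k + expi (- k) = 2 * real_complex R (cos k).
  rewrite /expi cosN sinN; apply/eqP; rewrite eq_complex /=.
  by apply/andP; split; apply/eqP; ring.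
rewrite d0 dpi !rmorphM rmorphD rmorphB rmorph1 fmorphV rmorph_nat.
(* Adding the expansions at [k] and [- k] removes the odd part and leaves a function of [cos k]. *)
have -> (D : R[i]) : 2 * D = D + D by ring.
rewrite [X in X + _ = _]dk [X in _ + X = _]dNk -!/(real_complex R (cos k)).
have z0 := expi_neq0 k; have wE : expi (- k) = (expi k)^-1.
  by apply: (mulIf z0); rewrite expiNK mulVf.
have cE : real_complex R (cos k) = (expi k + (expi k)^-1) / 2.
  by rewrite -wE csum mulrC mulKf // pnatr_eq0.
rewrite /= cE wE; move: (expi k) z0 => z z0.
clear detE detN dk d0 dpi dNk csum wE cE; clearbody P P1 P2 P3.
by field.
Qed.

End SingleConnectingEdge.

Lemma neg_index_grid_between (R : realType) (Q : chain_graph R 1) (M mu k : R) (n : nat) :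
  nullity (grid_pencil Q 0 M n mu) = 0%N -> nullity (grid_pencil Q pi M n mu) = 0%N ->
  (minn (neg_index (grid_pencil Q 0 M n mu)) (neg_index (grid_pencil Q pi M n mu))
     <= neg_index (grid_pencil Q k M n mu)
     <= maxn (neg_index (grid_pencil Q 0 M n mu)) (neg_index (grid_pencil Q pi M n mu)))%N.
Proof.
move=> n0 npi; have cos_bounds := conj (cos_geN1 k) (cos_le1 k).
have detk := @det_grid_pencil R Q M n mu k.
apply: (neg_index_between (i0 := enum_rank (pend (twisted_piece Q n))) _ _ _ _ _ n0 npi _ _ _ detk).
- exact: gram_pencil_hermsym.
- exact: gram_pencil_hermsym.
- exact: gram_pencil_hermsym.
- by move=> x; apply: hform_hyperplane.
- by move=> x; apply: hform_hyperplane.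
- by rewrite lecR divr_ge0 //; lra.
- by rewrite lecR divr_ge0 //; lra.
by rewrite -rmorphD -(rmorph1 (real_complex R)); congr (real_complex R _); field.
Qed.

Lemma band_between (R : realType) (Q : chain_graph R 1) (lam : nat -> R -> R) :
  band_functions Q lam -> forall k j, k \in `[- pi, pi] ->
  Num.min (lam j 0) (lam j pi) <= lam j k <= Num.max (lam j 0) (lam j pi).
Proof.
move=> lamQ k j kpi.
(* A cutoff above the three eigenvalues compared; the 0 makes it positive. *)
pose M := Num.max 0 (Num.max (lam j k) (Num.max (lam j 0) (lam j pi))) + 1.
have [M1 M2 M3 M4] : [/\ 0 < M, lam j k < M, lam j 0 < M & lam j pi < M].
  by split; rewrite /M ltr_pwDr // !le_max lexx ?orbT.
have [n fine_n] := fine_grid_exists Q M.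
have I0 : 0 \in `[- pi, (pi : R)] by rewrite in_itv /= oppr_le0 pi_ge0.
have Ipi : pi \in `[- pi, (pi : R)] by rewrite in_itv /= lexx andbT; have := pi_ge0 R; lra.
have pen l := @grid_pencil_decreasing R 1 Q l M n fine_n.
have spec l (Il : l \in `[- pi, pi]) := grid_spectrum M1 fine_n (lamQ l Il).
have ind l := @grid_pencil_index0 R 1 Q l M n M1 fine_n.
apply: (spectrum_between (pen 0) (pen pi) (pen k) (spec 0 I0) (spec pi Ipi) (spec k kpi)
  (ind 0) (ind pi) (ind k) _ M3 M4 M2) => mu.
exact: neg_index_grid_between.
Qed.

Lemma single_edge_band_ends (R : realType) (Q : chain_graph R 1) (lam : nat -> R -> R) :
  band_functions Q lam -> band_ends_attained lam.
Proof.
move=> lamQ j; have between k := @band_between R Q lam lamQ k j.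
split.
  have [le0pi|/ltW lepi0] := leP (lam j 0) (lam j pi).
    exists 0; first by left; left.
    by move=> _ [k /= /between] /[swap] <-; rewrite (min_idPl le0pi) => /andP[].
  exists pi; first by left; right.
  by move=> _ [k /= /between] /[swap] <-; rewrite (min_idPr lepi0) => /andP[].
have [le0pi|/ltW lepi0] := leP (lam j 0) (lam j pi).
  exists pi; first by left; right.
  by move=> _ [k /= /between] /[swap] <-; rewrite (max_idPr le0pi) => /andP[].
exists 0; first by left; left.
by move=> _ [k /= /between] /[swap] <-; rewrite (max_idPl lepi0) => /andP[].
Qed.

(** * Two interchanged lines *)

Section SwapGraph.
Variables (R : realType) (n : nat).
Local Notation m := n.+2.

Definition line0 : 'I_m := ord0.
Definition line1 : 'I_m := Ordinal (isT : (1 < m)%N).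
Local Notation c0 := line0.
Local Notation c1 := line1.

(* The lines [c0] and [c1] are exchanged by the shift; every other
   connecting edge is a separate component of G. *)
Definition swap_graph : chain_graph R m := @ChainGraph R m
  ('I_m * bool)%type void (of_void _) (of_void _)
  (fun c => (c, false)) (fun c => (tperm c0 c1 c, (1 < c)%N))
  (fun=> 1) (fun=> ltr01).
Local Notation Q := swap_graph.
Local Notation cedge := (cedge Q).
Local Notation edge c := (inr c : cedge).

Variables (k mu : R).
Local Notation z := (expi k : R[i]).
Local Notation C := (real_complex R (csol mu 1)).
Local Notation S := (real_complex R (ssol mu 1)).

Lemma tperm_fix (c : 'I_m) : (1 < c)%N -> tperm c0 c1 c = c.
Proof. by move=> c_gt1; rewrite tpermD // -val_eqE /= neq_ltn (ltnW c_gt1, c_gt1). Qed.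

Lemma source_sum (F : cedge -> R[i]) v :
  \sum_(d | csource d == v) F d = if v.2 then 0 else F (edge v.1).
Proof.
case: v => c [] /=; first by rewrite big_pred0 // => -[[]|d]; rewrite /= xpair_eqE andbF.
rewrite (big_pred1 (edge c)) // => -[[]|d] /=.
by rewrite xpair_eqE andbT.
Qed.

Lemma target_sum (F : cedge -> R[i]) v :
  \sum_(d | ctarget d == v) F d =
  if v.2 == (1 < v.1)%N then F (edge (tperm c0 c1 v.1)) else 0.
Proof.
case: v => c b /=.
have gt1 (d : 'I_m) : (1 < tperm c0 c1 d)%N = (1 < d)%N.
  by case: tpermP => [->|->|//].
have P d : (ctarget (edge d) == (c, b)) = (d == tperm c0 c1 c) && (b == (1 < c)%N).
  rewrite /= xpair_eqE (can2_eq (tpermK _ _) (tpermK _ _)).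
  by case: eqP => //= ->; rewrite gt1 eq_sym.
case: ifP => bc.
  by rewrite (big_pred1 (edge (tperm c0 c1 c))) // => -[[]|d]; rewrite P bc andbT.
by rewrite big_pred0 // => -[[]|d]; rewrite P bc andbF.
Qed.

Lemma twist_edge c : twist k (edge c) = z.
Proof. by rewrite /twist mulr1. Qed.

Lemma conj_phase : z^* * z = 1.
Proof. by rewrite -expiN expiNK. Qed.

(** The vertices [(c, true)] with [1 < c] are the far ends of the separate edges, and the edge
    dictates the value there. For [c0] and [c1] such a vertex lies on no edge. *)
Definition line_val (U B : 'I_m -> R[i]) (v : vert Q) : R[i] :=
  if v.2 then z^* * edge_val mu (U v.1) (B v.1) 1 else U v.1.
Definition line_slope (B : 'I_m -> R[i]) (d : cedge) : R[i] :=
  match d with inr c => B c | inl i => match i with end end.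

(** For [1 < c] these are Neumann conditions at both ends of a separate edge; the lines [c0] and
    [c1] continue into each other, value and slope, with the phase [z]. *)
Definition line_solution (U B : 'I_m -> R[i]) : Prop := forall c : 'I_m,
  if (1 < c)%N then B c = 0 /\ edge_slope mu (U c) (B c) 1 = 0
  else edge_val mu (U c) (B c) 1 = z * U (tperm c0 c1 c) /\
       z * B (tperm c0 c1 c) = edge_slope mu (U c) (B c) 1.

Lemma line_cell_solution U B : line_solution U B ->
  cell_solution k mu (line_val U B) (line_slope B).
Proof.
move=> sol; split=> [[[]|c]|[c b]].
  rewrite twist_edge /line_val /= /len /=; have := sol c; case: ifP => c_gt1 [h1 h2].
    by rewrite tperm_fix // mulrA [z * _]mulrC conj_phase mul1r.
  exact: h1.
rewrite source_sum target_sum /= /line_val /len /=.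
case: b => /=.
  case: ifP => // /eqP c_gt1; rewrite tperm_fix // twist_edge.
  by have := sol c; rewrite -c_gt1 => -[_ ->]; rewrite mulr0.
case: ifP => [/eqP c_le1|c_gt1].
  have := sol (tperm c0 c1 c); rewrite tpermK.
  have -> : (1 < tperm c0 c1 c)%N = false by rewrite [RHS]c_le1; case: tpermP => [->|->|].
  by move=> [_ <-]; rewrite twist_edge mulrA conj_phase mul1r.
have := sol c; have -> : (1 < c)%N by move: c_gt1; case: ltnP.
by case.
Qed.

Lemma cell_line_solution (val : vert Q -> R[i]) (b : cedge -> R[i]) : cell_solution k mu val b ->
  line_solution (fun c => val (c, false)) (fun c => b (edge c)).
Proof.
move=> [cend ckir] c; case: ifP => c_gt1; split.
- have := ckir (c, false); rewrite source_sum target_sum /= c_gt1 /=; exact.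
- have := ckir (c, true); rewrite source_sum target_sum /= c_gt1 /= tperm_fix // twist_edge.
  move=> /esym/eqP; rewrite mulf_eq0 -expiN (negPf (expi_neq0 _)) /= => /eqP; exact.
- by have := cend (edge c); rewrite twist_edge /= c_gt1.
have := ckir (tperm c0 c1 c, false); rewrite source_sum target_sum /= tpermK.
have -> : (1 < tperm c0 c1 c)%N = false by rewrite -c_gt1; case: tpermP => [->|->|].
by move=> /= ->; rewrite twist_edge mulrA [z * _]mulrC conj_phase mul1r.
Qed.

Variable rho : R[i].
Hypothesis rho_sqr : rho ^+ 2 = - real_complex R mu.
Local Notation Ep := (C + rho * S).
Local Notation Em := (C - rho * S).

(* The solutions on the two exchanged lines are combinations of the waves with
   exponents rho and - rho, indexed by [c0] and [c1]; [branch c] tells whether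
   the wave [c] is compatible with the quasi-momentum.  For mu = 0 the two waves
   coincide, and only [c0] is counted. *)
Definition branch (c : 'I_m) : bool :=
  if c == c0 then Ep ^+ 2 == z ^+ 2
  else if c == c1 then (mu != 0) && (Em ^+ 2 == z ^+ 2)
  else mu * ssol mu 1 == 0.

(** [p c0] and [p c1] are the amplitudes of exp (rho x) and exp (- rho x) on the line [c0]; on [c1]
    the same waves appear after transport over one period, where [Ep] and [Em] are exp rho and exp
    (- rho). *)
Definition branch_val (p : 'I_m -> R[i]) (c : 'I_m) : R[i] :=
  if c == c0 then p c0 + p c1
  else if c == c1 then z^* * (Ep * p c0 + Em * p c1) else p c.
Definition branch_slope (p : 'I_m -> R[i]) (c : 'I_m) : R[i] :=
  if c == c0 then rho * (p c0 - p c1)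
  else if c == c1 then z^* * rho * (Ep * p c0 - Em * p c1) else 0.

Lemma line_cases (c : 'I_m) : [\/ c = c0, c = c1 | (1 < c)%N].
Proof.
case: c => [[|[|c]] ic]; [apply: Or31|apply: Or32|apply: Or33] => //; exact: val_inj.
Qed.

Lemma branch_line_solution p : (forall c, ~~ branch c -> p c = 0) ->
  line_solution (branch_val p) (branch_slope p).
Proof.
move=> p_supp c.
have zz := conj_phase; have z0 := expi_neq0 k.
have zE : z^* = z^-1 by apply: (mulIf z0); rewrite zz mulVf.
have P0 : Ep ^+ 2 * p c0 = z ^+ 2 * p c0.
  have := p_supp c0; rewrite /branch eqxx.
  by case: eqP => [->//|_ /(_ isT) ->]; rewrite !mulr0.
have P1 : Em ^+ 2 * p c1 = z ^+ 2 * p c1.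
  have := p_supp c1; rewrite /branch eqxx /=; case: (mu != 0) => /=.
    by case: eqP => [->//|_ /(_ isT) ->]; rewrite !mulr0.
  by move=> /(_ isT) ->; rewrite !mulr0.
have muE : real_complex R mu = - rho ^+ 2 by rewrite rho_sqr opprK.
have [->|->|c_gt1] := line_cases c.
- rewrite /= tpermL /branch_val /branch_slope !eqxx /= /edge_val /edge_slope muE zE.
  by split; field.
- rewrite /= tpermR /branch_val /branch_slope !eqxx /= /edge_val /edge_slope muE zE.
  split.
    transitivity (z^-1 * (Ep ^+ 2 * p c0 + Em ^+ 2 * p c1)); first by field.
    by rewrite P0 P1; field.
  transitivity (z^-1 * rho * (Ep ^+ 2 * p c0 - Em ^+ 2 * p c1)); last by field.
  by rewrite P0 P1; field.
have cN0 : (c == c0) = false by apply: contraTF c_gt1 => /eqP ->.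
have cN1 : (c == c1) = false by apply: contraTF c_gt1 => /eqP ->.
rewrite c_gt1 /branch_val /branch_slope cN0 cN1; split=> //.
rewrite /edge_slope mul0r addr0 mulrAC mulNr -rmorphM.
have := p_supp c; rewrite /branch cN0 cN1; case: eqP => [->|_ /(_ isT) ->].
  by rewrite rmorph0 oppr0 mul0r.
by rewrite mulr0.
Qed.

(** Two periods lead back to the same line. They multiply [rho * U + B] by [Ep ^+ 2] and
    [rho * U - B] by [Em ^+ 2], and both factors must equal [z ^+ 2] unless the amplitude
    vanishes. *)
Lemma line_solution_branch U B : line_solution U B -> exists p,
  [/\ forall c, ~~ branch c -> p c = 0, U =1 branch_val p & B =1 branch_slope p].
Proof.
move=> sol.
have zz := conj_phase; have z0 := expi_neq0 k.
have zE : z^* = z^-1 by apply: (mulIf z0); rewrite zz mulVf.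
have muE : real_complex R mu = - rho ^+ 2 by rewrite rho_sqr opprK.
have /= [] := sol c0; rewrite tpermL /edge_val /edge_slope muE => v0 s0.
have /= [] := sol c1; rewrite tpermR /edge_val /edge_slope muE => v1 s1.
have U1 : U c1 = z^-1 * (U c0 * C + B c0 * S) by rewrite v0 mulKf.
have B1 : B c1 = z^-1 * (- - rho ^+ 2 * U c0 * S + B c0 * C) by rewrite -s0 mulKf.
pose p c : R[i] := if c == c0 then (if rho == 0 then U c0 else (rho * U c0 + B c0) / (2 * rho))
  else if c == c1 then (if rho == 0 then 0 else (rho * U c0 - B c0) / (2 * rho)) else U c.
have rho0 : (rho == 0) = (mu == 0).
  rewrite -sqrf_eq0 rho_sqr oppr_eq0; apply/eqP/eqP => [/(congr1 (@complex.Re R))//|->].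
  exact: rmorph0.
have two0 : 2 != 0 :> R[i] by rewrite pnatr_eq0.
have p_else (c : 'I_m) : (1 < c)%N -> [/\ ~~ branch c -> p c = 0, U c = branch_val p c & B c = branch_slope p c].
  move=> c_gt1.
  have cN0 : (c == c0) = false by apply: contraTF c_gt1 => /eqP ->.
  have cN1 : (c == c1) = false by apply: contraTF c_gt1 => /eqP ->.
  have := sol c; rewrite c_gt1 /branch_val /branch_slope /branch /p cN0 cN1 => -[Bc0 sc].
  split=> // muS; move: sc; rewrite Bc0 /edge_slope mul0r addr0 mulrAC mulNr -rmorphM.
  move=> /eqP; rewrite mulf_eq0 oppr_eq0 => /orP[/eqP/(congr1 (@complex.Re R)) /= muS0|/eqP//].
  by rewrite muS0 eqxx in muS.
suff [H0 H1] : [/\ ~~ branch c0 -> p c0 = 0, U c0 = branch_val p c0 & B c0 = branch_slope p c0] /\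
    [/\ ~~ branch c1 -> p c1 = 0, U c1 = branch_val p c1 & B c1 = branch_slope p c1].
  by exists p; split=> c; case: (line_cases c) => [->|->|/p_else[]] //; case: H0; case: H1.
rewrite /branch_val /branch_slope /branch !eqxx /= zE /p !eqxx /=.
have [rho_eq0|rho_neq0] := eqVneq rho 0.
  have mu0 : mu = 0 by apply/eqP; rewrite -rho0 rho_eq0.
  have C1 : csol mu 1 = 1 by rewrite /csol mu0 ltxx eqxx.
  have S1 : ssol mu 1 = 1 by rewrite /ssol mu0 ltxx eqxx.
  move: v0 s0 v1 s1 U1 B1; rewrite !C1 !S1 rho_eq0 !rmorph1 expr0n /= !oppr0 !mul0r !add0r !mulr1.
  move=> v0 s0 v1 s1 U1 B1.
  (* At energy 0 the two relations force the slope to vanish, so no solution that is affine and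
     nonconstant survives. *)
  have hB : (z ^+ 2 - 1) * B c0 = 0.
    by rewrite mulrBl mul1r expr2 -mulrA s1 -s0 subrr.
  have hU : (z ^+ 2 - 1) * U c0 = 2 * B c0.
    by rewrite mulrBl mul1r expr2 -mulrA -v1 mulrDr -v0 s0; ring.
  have B0 : B c0 = 0.
    have [z1|z1] := eqVneq (z ^+ 2 - 1) 0.
      by move: hU; rewrite z1 mul0r => /esym/eqP; rewrite mulf_eq0 (negPf two0) => /eqP.
    by move/eqP: hB; rewrite mulf_eq0 (negPf z1) => /eqP.
  rewrite U1 B1 B0 mu0 eqxx /=; split; split; rewrite ?addr0 ?mulr0 ?mul1r ?mul0r ?addr0 //.
  rewrite expr1n => z1; move/eqP: hU; rewrite B0 mulr0 mulf_eq0 subr_eq0 eq_sym (negPf z1).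
  by move=> /eqP.
have mu_neq0 : mu != 0 by rewrite -rho0.
have hP : (Ep ^+ 2 - z ^+ 2) * (rho * U c0 + B c0) = 0.
  have -> : (Ep ^+ 2 - z ^+ 2) * (rho * U c0 + B c0) =
    Ep ^+ 2 * (rho * U c0 + B c0) - z * (rho * (z * U c0) + z * B c0) by ring.
  by rewrite -v1 s1 U1 B1; field.
have hM : (Em ^+ 2 - z ^+ 2) * (rho * U c0 - B c0) = 0.
  have -> : (Em ^+ 2 - z ^+ 2) * (rho * U c0 - B c0) =
    Em ^+ 2 * (rho * U c0 - B c0) - z * (rho * (z * U c0) - z * B c0) by ring.
  by rewrite -v1 s1 U1 B1; field.
rewrite mu_neq0 /=; split; split.
- move=> ne; move/eqP: hP; rewrite mulf_eq0 subr_eq0 (negPf ne) => /eqP ->.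
  by rewrite mul0r.
- by field.
- by field.
- move=> ne; move/eqP: hM; rewrite mulf_eq0 subr_eq0 (negPf ne) => /eqP ->.
  by rewrite mul0r.
- by rewrite U1; field; rewrite ?z0 ?rho_neq0.
- by rewrite B1; field; rewrite ?z0 ?rho_neq0.
Qed.

Definition branch_wave (p : 'I_m -> R[i]) : gfun Q :=
  wave k mu (line_val (branch_val p) (branch_slope p)) (line_slope (branch_slope p)).

Lemma branch_wave_linear a p q e x : branch_wave (fun c => a * p c + q c) e x =
  a * branch_wave p e x + branch_wave q e x.
Proof.
case: e => [[[]|c] j]; rewrite /branch_wave /wave /line_val /= /branch_val /branch_slope /edge_val.
by case: ifP => _; [ring | case: ifP => _; ring].
Qed.

Lemma branch_wave_sum (I : Type) (s : seq I) (a : I -> R[i]) (p : I -> 'I_m -> R[i]) e x :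
  branch_wave (fun c => \sum_(i <- s) a i * p i c) e x = \sum_(i <- s) a i * branch_wave (p i) e x.
Proof.
have w0 : branch_wave (fun=> 0) e x = 0.
  have wE : branch_wave (fun=> 0) e x =
      -1 * branch_wave (fun=> 0) e x + branch_wave (fun=> 0) e x.
    rewrite -branch_wave_linear; congr (branch_wave _ e x).
    by apply/funext => c; rewrite mulr0 addr0.
  by rewrite wE; ring.
elim: s => [|i s IH].
  by rewrite big_nil -[RHS]w0; congr (branch_wave _ e x); apply/funext => c; rewrite big_nil.
rewrite big_cons -IH -branch_wave_linear; congr (branch_wave _ e x).
by apply/funext => c; rewrite big_cons.
Qed.

Lemma branch_wave_eq0 p : (forall c, ~~ branch c -> p c = 0) ->
  (forall e x, x \in `[0, elen e] -> branch_wave p e x = 0) -> forall c, p c = 0.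
Proof.
move=> p_supp /wave_eq0 w0.
have U0 c : branch_val p c = 0 by have [+ _] := w0 (edge c).
have B0 c : branch_slope p c = 0 by have [_ +] := w0 (edge c).
have := U0 c0; have := B0 c0; rewrite /branch_val /branch_slope eqxx => /eqP.
rewrite mulf_eq0 subr_eq0 => /orP[/eqP rho0|/eqP p01] p_sum.
  have p1 : p c1 = 0.
    apply: p_supp; rewrite /branch eqxx /=; suff -> : mu = 0 by rewrite eqxx.
    move: rho_sqr; rewrite rho0 expr0n => /esym/eqP; rewrite oppr_eq0.
    by move=> /eqP/(congr1 (@complex.Re R)).
  move=> c; have := U0 c; rewrite /branch_val; case: eqP => [->|_].
    by rewrite p1 addr0.
  by case: eqP => [->|_].
have p0 : p c0 = 0.
  apply: (@mulfI _ 2); first by rewrite pnatr_eq0.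
  by rewrite mulr0 -[RHS]p_sum -p01; ring.
move=> c; have := U0 c; rewrite /branch_val; case: eqP => [->|_] //.
by case: eqP => [->|_]; rewrite // -p01.
Qed.

Lemma swap_eigenspace_dim : eigenspace_dim Q k mu #|[pred c | branch c]|.
Proof.
set A := [pred c | branch c].
pose delta (a : 'I_#|A|) (c : 'I_m) : R[i] := (c == enum_val a)%:R.
pose comb (g : 'I_#|A| -> R[i]) c := \sum_(a < #|A|) g a * delta a c.
have combE g a : comb g (enum_val a) = g a.
  rewrite /comb (bigD1 a) //= /delta eqxx mulr1 big1 ?addr0 // => b ba.
  by rewrite (inj_eq enum_val_inj) eq_sym (negPf ba) mulr0.
have comb_supp g c : ~~ branch c -> comb g c = 0.
  move=> Bc; apply: big1 => a _; rewrite /delta; case: eqP => [cE|]; last by rewrite mulr0.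
  by move: Bc; rewrite cE; have := enum_valP a; rewrite inE => ->.
have combW g e x : \sum_(a < #|A|) g a * branch_wave (delta a) e x = branch_wave (comb g) e x.
  by rewrite -branch_wave_sum.
exists (fun a => branch_wave (delta a)); split.
- move=> a; apply: cell_solution_eigenspace; apply: line_cell_solution.
  apply: branch_line_solution => c Bc; rewrite /delta; case: eqP => // cE.
  by move: Bc; rewrite cE; have := enum_valP a; rewrite inE => ->.
- move=> g g0 a; rewrite -combE; apply: branch_wave_eq0; first exact: comb_supp.
  by move=> e x xe; rewrite -combW g0.
move=> f /eigenspace_cell_solution[val [b [sol fE]]].
have [p [p_supp pU pB]] := line_solution_branch (cell_line_solution sol).
exists (fun a => p (enum_val a)) => e x xe; rewrite combW fE //.
have -> : comb (fun a => p (enum_val a)) = p.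
  apply/funext => c; have [Bc|Bc] := boolP (branch c); last by rewrite comb_supp ?p_supp.
  have cA : c \in A by rewrite inE.
  by rewrite -(enum_rankK_in cA cA) combE.
case: e xe => [[[]|c] j] _; rewrite /branch_wave /wave /line_val /=.
by rewrite -pU -pB.
Qed.

End SwapGraph.

(** * Distance from the quasi-momentum to the multiples of pi *)

Section Phases.
Variable R : realType.
Implicit Types x k t w : R.

Lemma sin_add_natpi x (i : nat) : sin (x + i%:R * pi) = (-1) ^+ i * sin x.
Proof.
elim: i => [|i IH]; first by rewrite mul0r addr0 expr0 mul1r.
by rewrite -natr1 mulrDl mul1r addrA sinDpi IH exprS mulN1r mulNr.
Qed.

Lemma sin_eq0_natpi x : - pi < x -> sin x = 0 <-> exists i : nat, x = i%:R * pi.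
Proof.
move=> xpi; split=> [sx|[i ->]]; last first.
  by rewrite -[X in sin X]add0r sin_add_natpi sin0 mulr0.
have x0 : 0 <= x.
  rewrite leNgt; apply/negP => x0; have : 0 < sin (- x) by rewrite sin_gt0_pi; lra.
  by rewrite sinN sx oppr0 ltxx.
pose i := Num.truncn (x / pi); have pi0 := pi_gt0 R.
have xp0 : 0 <= x / pi by rewrite divr_ge0 // ltW.
have /andP[] := truncn_itv xp0; rewrite -/i ler_pdivlMr // ltr_pdivrMr // => i1 i2.
exists i; apply/eqP; rewrite -subr_eq0; apply/eqP; set y := x - _.
have sy : sin y = 0.
  have := sin_add_natpi y i; rewrite subrK sx => /esym/eqP.
  by rewrite mulf_eq0 signr_eq0 => /eqP.
have [y0 ypi] : 0 <= y /\ y < pi by rewrite -natr1 mulrDl in i2; rewrite /y; lra.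
apply/le_anti; rewrite y0 andbT leNgt; apply/negP => ygt0.
by have : 0 < sin y; [rewrite sin_gt0_pi ?ygt0 | rewrite sy ltxx].
Qed.

Lemma expi_sqr_eq x t : expi x ^+ 2 = expi t ^+ 2 :> R[i] <-> sin (x - t) = 0.
Proof.
have xE : expi x = expi (x - t) * expi t by rewrite -expiD subrK.
have sqrE d : expi d ^+ 2 = Complex (cos d ^+ 2 - sin d ^+ 2) (2 * (sin d * cos d)) :> R[i].
  by apply/eqP; rewrite eq_complex /=; apply/andP; split; apply/eqP; ring.
have t0 : expi t ^+ 2 != 0 :> R[i] by rewrite expf_neq0 ?expi_neq0.
split=> [E|s0].
  have /(congr1 (@complex.Re R)) : expi (x - t) ^+ 2 = 1 :> R[i].
    by apply: (mulIf t0); rewrite -exprMn -xE E mul1r.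
  rewrite sqrE /=; have := cos2Dsin2 (x - t) => h1 h2.
  have /eqP : sin (x - t) ^+ 2 = 0 by lra.
  by rewrite sqrf_eq0 => /eqP.
rewrite xE exprMn (sqrE (x - t)) s0 expr0n /= mul0r mulr0 subr0.
have -> : cos (x - t) ^+ 2 = 1 by rewrite -(cos2Dsin2 (x - t)) s0 expr0n addr0.
exact: mul1r.
Qed.

Definition phase k : R := if `|k| <= pi / 2 then `|k| else pi - `|k|.

Lemma phase_bounds k : k \in `[- pi, pi] -> 0 <= phase k <= pi / 2.
Proof.
rewrite in_itv /= -ler_norml /phase => kpi.
by case: ifPn => [->|]; rewrite ?normr_ge0 // -ltNge => kpi2; apply/andP; split; lra.
Qed.

(** Squaring makes the exponential invariant under translation of [k] by [pi]; what remains is the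
    distance to the multiples of [pi] and a sign. *)
Lemma phase_expi k : exists2 e : R, e ^+ 2 = 1 & expi k ^+ 2 = expi (e * phase k) ^+ 2 :> R[i].
Proof.
have sinNpi : sin (- pi) = 0 :> R by rewrite sinN sinpi oppr0.
rewrite /phase; case: ifPn => _; have [k0|k0] := leP 0 k.
- by exists 1; rewrite ?expr1n // mul1r (ger0_norm k0).
- by exists (-1); rewrite ?sqrrN ?expr1n // mulN1r (ltr0_norm k0) opprK.
- exists (-1); rewrite ?sqrrN ?expr1n //; apply/expi_sqr_eq.
  by rewrite (ger0_norm k0) -[RHS](sinpi R); congr sin; ring.
exists 1; rewrite ?expr1n //; apply/expi_sqr_eq.
by rewrite (ltr0_norm k0) -[RHS]sinNpi; congr sin; ring.
Qed.

End Phases.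

(** * Eigenvalues of the exchanged lines *)

Section SwapSequence.
Variables (R : realType) (n : nat).
Local Notation m := n.+2.
Local Notation c0 := (line0 n).
Local Notation c1 := (line1 n).

(* The frequencies of [swap_graph], increasingly and with multiplicity, are the
   values of [frequency t] at J >= 2, where t is the distance from k to pi Z and
   J = i * m + c: the line [c0] contributes (i - 1) pi + t, the line [c1]
   contributes i pi - t, and each further edge contributes i pi. *)
Definition line_offset (t : R) (c : nat) : R :=
  if c == 0%N then pi - t else if c == 1%N then t else 0.

Definition frequency (t : R) (J : nat) : R := (J %/ m)%:R * pi - line_offset t (J %% m).

Lemma line_offset_bounds t c : 0 <= t <= pi / 2 -> 0 <= line_offset t c <= pi.
Proof.
have pi0 := pi_gt0 R; move=> /andP[t0 t1].
by rewrite /line_offset; case: ifP => _; [|case: ifP => _]; lra.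
Qed.

Lemma line_offset_decr t c d : 0 <= t <= pi / 2 -> (c <= d)%N ->
  line_offset t d <= line_offset t c.
Proof.
have pi0 := pi_gt0 R; move=> /andP[t0 t1]; rewrite /line_offset.
by case: c => [|[|c]]; case: d => [|[|d]] //= _; lra.
Qed.

Lemma frequency_incr t J L : 0 <= t <= pi / 2 -> (J <= L)%N -> frequency t J <= frequency t L.
Proof.
move=> tI JL; have := leq_div2r m JL; rewrite leq_eqVlt => /orP[/eqP eqd|ltd].
  rewrite /frequency eqd lerD2l lerN2 line_offset_decr //.
  by move: JL; rewrite {1}(divn_eq J m) {1}(divn_eq L m) eqd leq_add2l.
have /andP[ge0J leJ] := line_offset_bounds (J %% m) tI.
have /andP[ge0L leL] := line_offset_bounds (L %% m) tI.
have : (J %/ m)%:R + 1 <= (L %/ m)%:R :> R by rewrite natr1 ler_nat.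
by have := pi_gt0 R; rewrite /frequency; nra.
Qed.

Lemma frequency_ge0 t J : 0 <= t <= pi / 2 -> (2 <= J)%N -> 0 <= frequency t J.
Proof.
move=> tI J2; apply: le_trans (frequency_incr tI J2); rewrite /frequency.
(* For [m = 2] the index 2 is the line [c0] with [i = 1], of frequency [t]; for larger [m] it is a
   separate edge with [i = 0], of frequency 0. *)
have := pi_gt0 R; case: n => [|p] pi0 /=; rewrite /line_offset /=.
  by rewrite divnn /= mul1r; move: tI; lra.
by rewrite divn_small // mul0r subr0.
Qed.

Lemma frequencyE t i (c : 'I_m) : frequency t (i * m + c) = i%:R * pi - line_offset t c.
Proof. by rewrite /frequency divnMDl // divn_small // addn0 modnMDl modn_small. Qed.

(** Consecutive frequencies of one line differ by [pi]. *)
Lemma frequency_inj t J L : J = L %[mod m] -> frequency t J = frequency t L -> J = L.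
Proof.
rewrite /frequency => JL; rewrite JL => /addIr /(mulIf (lt0r_neq0 (pi_gt0 R))) /eqP.
by rewrite eqr_nat => /eqP dJL; rewrite (divn_eq J m) (divn_eq L m) dJL JL.
Qed.

(** The shift by 2 drops the values [t - pi] and [- t], whose squares come from the later
    frequencies [pi - t] and [t]. *)
Definition swap_band (j : nat) (k : R) : R := frequency (phase k) (j + 2) ^+ 2.

Lemma cos_sign (e x : R) : e ^+ 2 = 1 -> cos (e * x) = cos x.
Proof. by move/eqP; rewrite sqrf_eq1 => /orP[]/eqP->; rewrite ?mul1r // mulN1r cosN. Qed.

Lemma sin_sign (e x : R) : e ^+ 2 = 1 -> sin (e * x) = e * sin x.
Proof. by move/eqP; rewrite sqrf_eq1 => /orP[]/eqP->; rewrite ?mul1r // !mulN1r sinN. Qed.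

Lemma mul_ssol_sqr (w : R) : 0 <= w -> w * ssol (w ^+ 2) 1 = sin w.
Proof.
rewrite le_eqVlt => /predU1P[<-|w0]; first by rewrite mul0r sin0.
by rewrite /ssol exprn_gt0 // sqrtr_sqr gtr0_norm // mulr1 mulrCA divff ?mulr1 // gt_eqF.
Qed.

(** The compatibility conditions become [sin (w - t) = 0] on [c0], [sin (w + t) = 0] on [c1] and
    [w * sin w = 0] on the other edges; their solutions [w >= 0] are the listed frequencies. *)
Lemma branch_frequency k w : 0 <= w -> k \in `[- pi, pi] ->
  exists2 rho : R[i], rho ^+ 2 = - real_complex R (w ^+ 2) &
  forall c : 'I_m, branch k (w ^+ 2) rho c <->
    exists i, (2 <= i * m + c)%N /\ frequency (phase k) (i * m + c) = w.
Proof.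
move=> w0 kpi; have [e e1 kE] := phase_expi k.
have := phase_bounds kpi; set t := phase k in kE * => tI.
have /andP[t0 tpi] := tI; have pi0 := pi_gt0 R.
have e0 : e != 0 by apply: contraTneq (oner_neq0 R) => e_eq0; rewrite -e1 e_eq0 expr0n eqxx.
(* The sign [e] of the phase is built into [rho], so that [w] and [t] enter with the same sign and
   [e] factors out of the sine. *)
pose rho : R[i] := Complex 0 (e * w); exists rho.
  apply/eqP; rewrite eq_complex /=; apply/andP; split; apply/eqP; last by ring.
  by rewrite -[w ^+ 2]mul1r -e1; ring.
have Cw : csol (w ^+ 2) 1 = cos w by rewrite csol_cos ?sqr_ge0 // sqrtr_sqr ger0_norm // mulr1.
have Sw := mul_ssol_sqr w0.
have EpE : real_complex R (csol (w ^+ 2) 1) + rho * real_complex R (ssol (w ^+ 2) 1) = expi (e * w).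
  rewrite /expi cos_sign // sin_sign // -Sw -Cw.
  by apply/eqP; rewrite eq_complex /=; apply/andP; split; apply/eqP; ring.
have EmE : real_complex R (csol (w ^+ 2) 1) - rho * real_complex R (ssol (w ^+ 2) 1) = expi (- (e * w)).
  rewrite /expi cosN sinN cos_sign // sin_sign // -Sw -Cw.
  by apply/eqP; rewrite eq_complex /=; apply/andP; split; apply/eqP; ring.
move=> c; rewrite /branch EpE EmE kE; under eq_exists do rewrite frequencyE.
have [->|->|c_gt1] := line_cases c.
- rewrite eqxx; split.
    move=> /eqP/expi_sqr_eq; rewrite -mulrBr sin_sign // => /eqP.
    rewrite mulf_eq0 (negPf e0) /= => /eqP/(sin_eq0_natpi _)[|i wi]; first by lra.
    exists i.+1; split; first by rewrite addn0 mulSn.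
    by rewrite /line_offset /= -natr1 mulrDl mul1r -wi; ring.
  move=> [[|i] [i_gt0]] //; rewrite /line_offset /= -natr1 mulrDl mul1r => wi.
  apply/eqP/expi_sqr_eq; rewrite -mulrBr sin_sign // (_ : w - t = i%:R * pi); last by rewrite -wi; ring.
  by rewrite -[i%:R * pi]add0r sin_add_natpi sin0 !mulr0.
- have -> : (c1 == c0) = false by [].
  rewrite eqxx; split.
    move=> /andP[w_neq0 /eqP/expi_sqr_eq]; rewrite -opprD sinN -mulrDr sin_sign // => /eqP.
    rewrite oppr_eq0 mulf_eq0 (negPf e0) /= => /eqP/(sin_eq0_natpi _)[|[|i] wi]; first by lra.
      by rewrite sqrf_eq0 in w_neq0; have := w0; rewrite le_eqVlt eq_sym (negPf w_neq0) /=; lra.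
    exists i.+1; split; first by rewrite mulSn.
    by rewrite /line_offset /= -wi; ring.
  move=> [[|i] [i_gt0]] //; rewrite /line_offset /= => wi.
  apply/andP; split.
    rewrite sqrf_eq0 gt_eqF // -wi -natr1 mulrDl mul1r.
    have : 0 <= i%:R * pi :> R by rewrite mulr_ge0 // ltW.
    lra.
  apply/eqP/expi_sqr_eq; rewrite -opprD sinN -mulrDr sin_sign //.
  rewrite (_ : w + t = i.+1%:R * pi); last by rewrite -wi; ring.
  by rewrite -[i.+1%:R * pi]add0r sin_add_natpi sin0 !mulr0 oppr0.
have cN0 : (c == c0) = false by apply: contraTF c_gt1 => /eqP ->.
have cN1 : (c == c1) = false by apply: contraTF c_gt1 => /eqP ->.
rewrite cN0 cN1 expr2 -mulrA -/(w ^+ 2) Sw mulf_eq0.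
have -> : line_offset t c = 0.
  by rewrite /line_offset; case: (nat_of_ord c) c_gt1 => [|[|]].
split.
  move=> ws; have /(sin_eq0_natpi _)[|i wi] : sin w = 0 by case/orP: ws => /eqP // ->; rewrite sin0.
    by lra.
  by exists i; split; [rewrite ltn_addl | rewrite subr0 wi].
move=> [i [_]]; rewrite subr0 => <-.
by rewrite -[X in sin X]add0r sin_add_natpi sin0 mulr0 eqxx orbT.
Qed.

(** A real wave factor compatible with a phase has fourth power 1, whereas here the factors are
    [P > 1] and its inverse [N]; separate edges fail since [mu * ssol mu 1] is nonzero. *)
Lemma branch_neg k mu : mu < 0 -> exists2 rho : R[i], rho ^+ 2 = - real_complex R mu &
  forall c : 'I_m, ~~ branch k mu rho c.
Proof.
move=> mu0; have mu1 : 0 < - mu by rewrite oppr_gt0.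
pose r := Num.sqrt (- mu); have r0 : 0 < r by rewrite sqrtr_gt0.
exists (real_complex R r); first by rewrite -rmorphXn sqr_sqrtr ?(ltW mu1) // rmorphN.
have S0 : 0 < ssol mu 1 by apply: ssol_gt0; rewrite // ltr0_sqrtr // mul0r pi_gt0.
have C1 : 1 < csol mu 1 by apply: csol_neg_gt1.
have CS := csol_ssol_sqr mu 1.
have r2 : r ^+ 2 = - mu by rewrite sqr_sqrtr // ltW.
pose P := csol mu 1 + r * ssol mu 1; pose N := csol mu 1 - r * ssol mu 1.
have P1 : 1 < P by rewrite /P; have := mulr_gt0 r0 S0; lra.
have PN : P * N = 1.
  transitivity (csol mu 1 ^+ 2 - r ^+ 2 * ssol mu 1 ^+ 2); first by rewrite /P /N; ring.
  by rewrite r2 mulNr opprK.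
have unimod (x : R) : real_complex R x ^+ 2 = expi k ^+ 2 -> x ^+ 4 = 1.
  move=> xk; have : expi k ^+ 2 * (expi k ^+ 2)^* = 1.
    by rewrite rmorphXn -exprMn mulrC conj_phase expr1n.
  rewrite -xk conj_Creal; last by apply/complex_realP; exists (x ^+ 2); rewrite rmorphXn.
  by rewrite -!rmorphXn -rmorphM => /(congr1 (@complex.Re R)) /= <-; ring.
have P4 : 1 < P ^+ 4 by rewrite exprn_egt1.
move=> c; rewrite /branch; case: ifP => _.
  apply/negP => /eqP h; have /unimod : real_complex R P ^+ 2 = expi k ^+ 2.
    by rewrite -h rmorphD rmorphM.
  by move=> E; rewrite E ltxx in P4.
case: ifP => _; last by rewrite mulf_neq0 ?(lt_eqF mu0) ?gt_eqF.
rewrite negb_and; apply/orP; right; apply/negP => /eqP h.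
have /unimod N4 : real_complex R N ^+ 2 = expi k ^+ 2 by rewrite -h rmorphB rmorphM.
have : P ^+ 4 * N ^+ 4 = 1 by rewrite -exprMn PN expr1n.
by rewrite N4 mulr1 => P41; rewrite P41 ltxx in P4.
Qed.

Lemma swap_band_mult k mu : k \in `[- pi, pi] -> exists N,
  eigenspace_dim (swap_graph R n) k mu N /\ ([set j | swap_band j k = mu] #= `I_N)%card.
Proof.
move=> kpi; have tI := phase_bounds kpi.
have [mu0|mu0] := ltP mu 0.
  have [rho rho2 Bn] := branch_neg k mu0.
  exists #|[pred c : 'I_m | branch k mu rho c]|; split; first exact: swap_eigenspace_dim.
  have -> : #|[pred c : 'I_m | branch k mu rho c]| = 0%N.
    by apply: eq_card0 => c; rewrite !inE; apply/negbTE/Bn.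
  rewrite II0 card_eq0; apply/eqP/seteqP; split=> // j /= jmu.
  by move: mu0; rewrite -jmu ltNge sqr_ge0.
pose w := Num.sqrt mu; have w0 : 0 <= w by apply: sqrtr_ge0.
have muE : mu = w ^+ 2 by rewrite sqr_sqrtr.
have [rho rho2 Bw] := branch_frequency w0 kpi; rewrite muE.
exists #|[pred c : 'I_m | branch k (w ^+ 2) rho c]|; split; first exact: swap_eigenspace_dim.
set A := [pred c : 'I_m | branch k (w ^+ 2) rho c].
(* Each index goes to the line that carries it. The frequencies of one line being distinct, this is
   a bijection from the level set onto the compatible branches. *)
pose line (j : nat) : 'I_m := Ordinal (ltn_pmod (j + 2) (isT : (0 < m)%N)).
have bandE j : swap_band j k = w ^+ 2 <-> frequency (phase k) (j + 2) = w.
  rewrite /swap_band; split=> [/eqP|->//].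
  by rewrite eqrXn2 // ?frequency_ge0 ?leq_addl // => /eqP.
have line_img : line @` [set j | swap_band j k = w ^+ 2] = [set c | c \in A]%classic.
  apply/seteqP; split=> [_ [j /= /bandE jw <-]|c /=].
    rewrite inE; apply/Bw; exists ((j + 2) %/ m)%N.
    by rewrite -[nat_of_ord _]/((j + 2) %% m)%N -divn_eq leq_addl.
  rewrite inE => /Bw[i [i2 iw]]; exists (i * m + c - 2)%N.
    by apply/bandE; rewrite subnK.
  by apply/val_inj; rewrite /= subnK // modnMDl modn_small.
have line_inj : {in [set j | swap_band j k = w ^+ 2] &, injective line}.
  move=> i j; rewrite !inE => /bandE iw /bandE jw /(congr1 val) /= ij.
  by apply/eqP; rewrite -(eqn_add2r 2); apply/eqP/(@frequency_inj (phase k) _ _ ij); rewrite iw jw.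
have enum_img : enum_val @` [set: 'I_#|A|] = [set c | c \in A]%classic.
  apply/seteqP; split=> [_ [a _ <-]|c /= cA]; first exact: enum_valP.
  by exists (enum_rank_in cA c); rewrite // enum_rankK_in.
apply: (card_eq_trans (card_esym (inj_card_eq line_inj))); rewrite line_img -enum_img.
apply: (card_eq_trans (inj_card_eq _)); first by move=> a b _ _; apply: enum_val_inj.
by rewrite card_eq_sym card_II.
Qed.

Lemma swap_band_functions : band_functions (swap_graph R n) swap_band.
Proof.
move=> k kpi; have tI := phase_bounds kpi; split; last by move=> mu; apply: swap_band_mult.
move=> i j ij; rewrite /swap_band ler_pXn2r ?nnegrE ?frequency_ge0 ?leq_addl //.
by apply: frequency_incr; rewrite // leq_add2r.
Qed.

(** The index [n + 2 = 1 * m + 0] belongs to the line [c0] with [i = 1], whose frequency is the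
    phase itself. *)
Lemma swap_band_phase k : swap_band n k = phase k ^+ 2.
Proof.
rewrite /swap_band addn2 /frequency divnn modnn /line_offset /= mul1r.
by congr (_ ^+ 2); ring.
Qed.

Lemma swap_band_ends : ~ band_ends_attained swap_band.
Proof.
have pi0 := pi_gt0 R; move=> /(_ n)[_ [k0 k0_end k0_ub]].
have k0_phase : phase k0 = 0.
  rewrite /phase; move: k0_end => [[->|->]|->].
  - by rewrite normr0 ifT // divr_ge0 // ltW.
  - rewrite gtr0_norm // ifF ?subrr //; apply/negbTE; rewrite -ltNge; lra.
  - rewrite normrN gtr0_norm // ifF ?subrr //; apply/negbTE; rewrite -ltNge; lra.
have : swap_band n (pi / 2) <= swap_band n k0.
  by apply: k0_ub; exists (pi / 2) => //; rewrite /= in_itv /=; apply/andP; split; lra.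
rewrite !swap_band_phase k0_phase /phase gtr0_norm; last by lra.
by rewrite lexx expr0n leNgt exprn_gt0 //; lra.
Qed.

End SwapSequence.

Theorem theorem3 (R : realType) :
  (forall (Q : chain_graph R 1) (lam : nat -> R -> R),
      band_functions Q lam -> band_ends_attained lam) /\
  (forall m : nat, (1 < m)%N ->
    ~ (forall (Q : chain_graph R m) (lam : nat -> R -> R),
         band_functions Q lam -> band_ends_attained lam)).
Proof.
split=> [Q lam|[|[|n]] // _ bands]; first exact: single_edge_band_ends.
exact: swap_band_ends (bands _ _ (@swap_band_functions R n)).
Qed.
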